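(* Consider the process $\dot x=Ax+Bu+d$, $y=x+n$, $x(0)=x_0$, under the packetized, buffered remote control law described in the context, with $\delta$ satisfying the sampling condition in the context. Consider any DoS signal satisfying Assumptions 1 and 2 with parameters such that $$\frac{1}{T}+\frac{\Delta}{\tau_D}<1 .$$ If the prediction horizon satisfies $$h\delta>\frac{\omega_2}{\omega_1+\omega_2}\,(Q+\Delta),\qquad Q:=(\kappa+\eta\Delta)\Big(1-\frac1T-\frac{\Delta}{\tau_D}\Big)^{-1},$$ with $\omega_1:=\frac{\gamma_1-\sigma\gamma_2}{2\alpha_2}$ and $\omega_2:=\frac{\gamma_2(2+\sigma)}{\alpha_1}$, then the closed-loop system is stable, i.e., for every initial condition $x_0$ and all bounded $d,n$, all closed-loop signals remain bounded, and they converge to zero whenever $d$ and $n$ converge to zero.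
   Context: Process: $x(t)\in\mathbb R^n$, $u(t)\in\mathbb R^m$, $(A,B)$ stabilizable, $d,n:\mathbb R_{\ge0}\to\mathbb R^n$ unknown bounded measurable disturbance and measurement noise; $w:=[d'\;n']'$ and $\|w_t\|_\infty:=\sup_{s\in[0,t]}\|w(s)\|$. Network and DoS: transmission attempts at $t_k=k\Delta$, $k\in\mathbb N_0$, $\Delta>0$. A DoS signal is given by off/on transition times $h_0<h_1<\dots$ with durations $\tau_n\ge0$; $H_n:=\{h_n\}\cup[h_n,h_n+\tau_n)$. For $0\le\tau\le t$, $n(\tau,t)$ is the number of transitions $h_n$ in $[\tau,t)$ and $\Xi(\tau,t):=\bigcup_nH_n\cap[\tau,t]$, with $|\cdot|$ Lebesgue measure. Assumption 1 (DoS frequency): there exist $\eta\ge0$, $\tau_D>0$ with $n(\tau,t)\le\eta+(t-\tau)/\tau_D$ for all $0\le\tau\le t$. Assumption 2 (DoS duration): there exist $\kappa\ge0$, $T>1$ with $|\Xi(\tau,t)|\le\kappa+(t-\tau)/T$ for all $0\le\tau\le t$. A transmission attempt at $t_k$ fails iff $t_k\in\bigcup_nH_n$; $z_0<z_1<\dots$ are the successful transmission times. Controller: $K$ with $\Phi:=A+BK$ Hurwitz. $\delta:=\Delta/b$, $b\in\mathbb N_1$; $A_\delta:=e^{A\delta}$, $B_\delta:=\int_0^\delta e^{A\tau}B\,d\tau$; $h\in\mathbb N_1$ buffer size. At each $z_m$: $\alpha_0(z_m)=y(z_m)$, $u_p(z_m)=K\alpha_p(z_m)$, $\alpha_{p+1}(z_m)=A_\delta\alpha_p(z_m)+B_\delta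 u_p(z_m)$, $p=0,\dots,h-2$. With $I_p(z_m):=[z_m+p\delta,\min\{z_m+(p+1)\delta,z_{m+1}\})$ for $p\le h-2$ and $I_{h-1}(z_m):=[z_m+(h-1)\delta,z_{m+1})$, the applied input is $u(t)=0$ on $[0,z_0)$ and $u(t)=u_p(z_m)$ on $I_p(z_m)$. Constants: $M$ symmetric positive definite, $P$ solves $\Phi'P+P\Phi+M=0$; $\alpha_1,\alpha_2$ smallest and largest eigenvalues of $P$; $\gamma_1$ smallest eigenvalue of $M$; $\gamma_2:=\|2PBK\|$; $\mu_A$ the largest eigenvalue of $(A+A')/2$; $\sigma>0$ with $\gamma_1-\sigma\gamma_2>0$. Sampling condition: $\delta\le\frac{1}{\mu_A}\log[(\frac{\sigma}{1+\sigma})\frac{\mu_A}{\max\{\|\Phi\|,1\}}+1]$ if $\mu_A>0$, and $\delta\le(\frac{\sigma}{1+\sigma})\frac{1}{\max\{\|\Phi\|,1\}}$ if $\mu_A\le0$. *)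

(* Defs.v *)
From Stdlib Require Import Reals Lra ClassicalEpsilon Factorial List.
Open Scope R_scope.

(** * Finite-dimensional linear algebra on R^k, encoded as functions on nat.
    Only indices < k are meaningful; all equalities are stated componentwise
    on indices < k. *)
Definition vec := nat -> R.
Definition mat := nat -> nat -> R.

Fixpoint fsum (k : nat) (f : nat -> R) : R :=
  match k with O => 0 | S k' => fsum k' f + f k' end.

Definition mv (k : nat) (M : mat) (v : vec) : vec :=
  fun i => fsum k (fun j => M i j * v j).
Definition mm (k : nat) (M N : mat) : mat :=
  fun i j => fsum k (fun l => M i l * N l j).
Definition madd (M N : mat) : mat := fun i j => M i j + N i j.
Definition mscale (c : R) (M : mat) : mat := fun i j => c * M i j.
Definition mtr (M : mat) : mat := fun i j => M j i.
Definition mid : mat := fun i j => if Nat.eqb i j then 1 else 0.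
Definition vadd (u v : vec) : vec := fun i => u i + v i.
Definition vsub (u v : vec) : vec := fun i => u i - v i.
Definition vscale (c : R) (v : vec) : vec := fun i => c * v i.
Definition vzero : vec := fun _ => 0.

Fixpoint mpow (k : nat) (M : mat) (p : nat) : mat :=
  match p with O => mid | S p' => mm k (mpow k M p') M end.

Definition veq (k : nat) (u v : vec) : Prop := forall i, (i < k)%nat -> u i = v i.
Definition meq (k l : nat) (M N : mat) : Prop :=
  forall i j, (i < k)%nat -> (j < l)%nat -> M i j = N i j.
Definition vnonzero (k : nat) (v : vec) : Prop := exists i, (i < k)%nat /\ v i <> 0.

Definition vnorm (k : nat) (v : vec) : R := sqrt (fsum k (fun i => v i ^ 2)).
Definition qform (k : nat) (M : mat) (v : vec) : R := fsum k (fun i => v i * mv k M v i).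

Definition is_opnorm (k l : nat) (M : mat) (c : R) : Prop :=
  is_lub (fun r => exists v, vnorm l v <= 1 /\ r = vnorm k (mv l M v)) c.

Definition symmetric (k : nat) (M : mat) : Prop := meq k k M (mtr M).
Definition pos_def (k : nat) (M : mat) : Prop :=
  symmetric k M /\ forall v, vnonzero k v -> 0 < qform k M v.

Definition is_eigenvalue (k : nat) (M : mat) (lam : R) : Prop :=
  exists v, vnonzero k v /\ veq k (mv k M v) (vscale lam v).
Definition is_min_eigenvalue (k : nat) (M : mat) (lam : R) : Prop :=
  is_eigenvalue k M lam /\ forall mu, is_eigenvalue k M mu -> lam <= mu.
Definition is_max_eigenvalue (k : nat) (M : mat) (lam : R) : Prop :=
  is_eigenvalue k M lam /\ forall mu, is_eigenvalue k M mu -> mu <= lam.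

(* complex eigenvalue a + i b of a real matrix, with complex eigenvector p + i q *)
Definition is_complex_eigenvalue (k : nat) (M : mat) (a b : R) : Prop :=
  exists p q : vec, (vnonzero k p \/ vnonzero k q) /\
    veq k (mv k M p) (vsub (vscale a p) (vscale b q)) /\
    veq k (mv k M q) (vadd (vscale b p) (vscale a q)).
Definition hurwitz (k : nat) (M : mat) : Prop :=
  forall a b, is_complex_eigenvalue k M a b -> a < 0.

Definition stabilizable (n m : nat) (A B : mat) : Prop :=
  exists K : mat, hurwitz n (madd A (mm m B K)).

Definition series_sum (f : nat -> R) : R :=
  epsilon (inhabits 0) (fun l => infinite_sum f l).
Definition RInt (f : R -> R) (a b : R) : R :=
  epsilon (inhabits 0) (fun v => exists pr : Riemann_integrable f a b, RiemannInt pr = v).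

Definition expm (k : nat) (M : mat) (t : R) : mat :=
  fun i j => series_sum (fun p => mpow k M p i j * t ^ p / INR (fact p)).
Definition Adisc (n : nat) (A : mat) (delta : R) : mat := expm n A delta.
Definition Bdisc (n : nat) (A B : mat) (delta : R) : mat :=
  fun i j => RInt (fun tau => mm n (expm n A tau) B i j) 0 delta.

Definition rderiv (k : nat) (f : R -> vec) (t : R) (l : vec) : Prop :=
  forall eps, 0 < eps -> exists del, 0 < del /\ forall s, 0 < s < del ->
    forall i, (i < k)%nat -> Rabs ((f (t + s) i - f t i) / s - l i) < eps.

Definition cont_nonneg (k : nat) (f : R -> vec) : Prop :=
  forall t, 0 <= t -> forall eps, 0 < eps -> exists del, 0 < del /\
    forall s, 0 <= s -> Rabs (s - t) < del -> vnorm k (vsub (f s) (f t)) < eps.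

(** * DoS model.  The DoS signal is given by the set of valid indices [dom]
   (downward closed: finitely or infinitely many DoS periods), the
   off/on transition times [hs n] and durations [taus n]. *)
Definition dos_signal (dom : nat -> Prop) (hs taus : nat -> R) : Prop :=
  (forall k, dom (S k) -> dom k) /\
  (dom 0%nat -> 0 <= hs 0%nat) /\
  (forall k, dom k -> 0 <= taus k) /\
  (forall k, dom (S k) -> hs k + taus k < hs (S k)).

Definition in_dos (dom : nat -> Prop) (hs taus : nat -> R) (t : R) : Prop :=
  exists k, dom k /\ (t = hs k \/ (hs k <= t /\ t < hs k + taus k)).

(* Lebesgue measure of H_k intersected with [a, b] *)
Definition dos_piece_len (hs taus : nat -> R) (a b : R) (k : nat) : R :=
  Rmax 0 (Rmin (hs k + taus k) b - Rmax (hs k) a).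

Fixpoint lsum (l : list nat) (f : nat -> R) : R :=
  match l with nil => 0 | cons x l' => f x + lsum l' f end.

(* Assumption 1: n(tau,t) <= eta + (t - tau)/tauD, n(tau,t) = number of h_n in [tau,t) *)
Definition dos_frequency (dom : nat -> Prop) (hs : nat -> R) (eta tauD : R) : Prop :=
  forall tau t, 0 <= tau <= t -> forall l : list nat, List.NoDup l ->
    (forall k, List.In k l -> dom k /\ tau <= hs k /\ hs k < t) ->
    INR (length l) <= eta + (t - tau) / tauD.

(* Assumption 2: |Xi(tau,t)| <= kappa + (t - tau)/T.  Since the H_n are pairwise
   disjoint, |Xi(tau,t)| is the (possibly infinite) sum over n of |H_n n [tau,t]|;
   the bound on it is equivalent to the bound on every finite partial sum. *)
Definition dos_duration (dom : nat -> Prop) (hs taus : nat -> R) (kappa T : R) : Prop :=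
  forall tau t, 0 <= tau <= t -> forall l : list nat, List.NoDup l ->
    (forall k, List.In k l -> dom k) ->
    lsum l (dos_piece_len hs taus tau t) <= kappa + (t - tau) / T.

Definition success (dom : nat -> Prop) (hs taus : nat -> R) (Delta z : R) : Prop :=
  exists k : nat, z = INR k * Delta /\ ~ in_dos dom hs taus z.

Fixpoint predict (n m : nat) (Ad Bd K : mat) (a0 : vec) (p : nat) : vec :=
  match p with
  | O => a0
  | S p' => let a := predict n m Ad Bd K a0 p' in
            vadd (mv n Ad a) (mv m Bd (mv n K a))
  end.

Definition bounded_sig (k : nat) (f : R -> vec) : Prop :=
  exists c, forall t, 0 <= t -> vnorm k (f t) <= c.
Definition conv_zero (k : nat) (f : R -> vec) : Prop :=
  forall eps, 0 < eps -> exists T0, forall t, T0 <= t -> vnorm k (f t) <= eps.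

(* The disturbance d is represented by its primitive D(t) = int_0^t d.
   d bounded measurable  <->  D(0)=0 and D Lipschitz;
   ess sup |d| -> 0       <->  eventual Lipschitz constants of D -> 0. *)
Definition primitive_of_bounded (k : nat) (D : R -> vec) : Prop :=
  veq k (D 0) vzero /\
  exists c, forall s t, 0 <= s -> 0 <= t -> vnorm k (vsub (D t) (D s)) <= c * Rabs (t - s).
Definition primitive_of_vanishing (k : nat) (D : R -> vec) : Prop :=
  forall eps, 0 < eps -> exists T0, forall s t, T0 <= s -> T0 <= t ->
    vnorm k (vsub (D t) (D s)) <= eps * Rabs (t - s).

(* Main.v *)
(** The Lyapunov function is [V x = x' P x]; the Lyapunov equation with [Phi] Hurwitz forces [P]
    to be symmetric positive definite. The disturbance is only known through a Lipschitz primitive,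
    so all estimates are one-sided Dini inequalities integrated by barrier arguments.

    While the buffer is not exhausted, the applied input is computed from a model state whose error
    is of the size of the disturbance and noise, and the sampling condition makes the inter-sample
    drift at most [sigma] times the state; hence [V] decays at rate [omega1]. Once the buffer is
    exhausted the last input is held and [V] grows at rate at most [omega2]. Enlarging each DoS
    interval by [Delta] covers every run of failed transmissions, which bounds the time between
    successes by [Q + Delta]. The horizon condition says that the decay over [h delta] beats the
    growth over the remaining time, so [V] contracts from one success to the next up to a multiple
    of the squared disturbance level. *)

From mathcomp Require all_boot all_order all_algebra spectral sesquilinear complex Rstruct.
From Stdlib Require Import Reals Lra Lia Wf_nat ClassicalEpsilon Classical Factorial List.
From Coquelicot Require Import Coquelicot.
Require Import Defs.
Open Scope R_scope.

(** Symmetry and definiteness of P must both be derived. The usual argument through the integral of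
    e^{Phi' t} M e^{Phi t} rests on decay of the matrix exponential; here the Lyapunov equation is
    treated by algebra alone, over the complex numbers and after triangularization. Both rates use
    the dissipation g = gamma1 - sigma gamma2. While packets last, half of g absorbs the terms
    linear in the disturbance level W and the other half gives omega1 = g / (2 alpha2). On a held
    input g only does the absorbing, so omega2 is free of W. With L = Q + Delta and H = h delta, a
    gap that outlasts the buffer multiplies V by at most exp(omega2 (L - H) - omega1 H), and the
    horizon condition says exactly that this exponent is negative; a shorter gap contracts because
    it lasts at least Delta. The additive terms are W^2 times constants that depend on neither x0
    nor W. Hence one recursion serves both claims: bounded signals give one level W, vanishing
    signals reach every W > 0 eventually. W stays positive because the barrier comparisons need a
    strict margin. *)

Module Lyapunov.
Import all_boot all_order all_algebra spectral sesquilinear complex.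
Import Order.TTheory GRing.Theory Num.Theory.
Local Set Implicit Arguments.
Local Unset Strict Implicit.
Local Open Scope ring_scope.
Local Open Scope sesquilinear_scope.

(** * Definiteness of Hermitian solutions of the Lyapunov equation *)

Section Lyapunov.
Variable C : numClosedFieldType.

(** On a [numClosedFieldType], [0 <] includes being real. Vectors are rows, as for [eigenvalue]. *)
Definition herm_pd n (H : 'M[C]_n) :=
  forall v : 'rV[C]_n, v != 0 -> 0 < (v *m H *m v ^t*) 0 0.

Lemma trmxC_mul m n p (X : 'M[C]_(m, n)) (Y : 'M[C]_(n, p)) :
  (X *m Y) ^t* = Y ^t* *m X ^t*.
Proof. by rewrite trmx_mul map_mxM. Qed.

Lemma herm_pd_congr n (G H : 'M[C]_n) :
  G \in unitmx -> herm_pd H -> herm_pd (G *m H *m G ^t*).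
Proof.
move=> Gu pdH v v0; have := pdH (v *m G); rewrite trmxC_mul !mulmxA; apply.
by apply: contraNneq v0 => vG; rewrite -(mulmxK Gu v) vG mul0mx.
Qed.

Lemma herm_pd_congr_inv n (G Gi H : 'M[C]_n) :
  Gi *m G = 1%:M -> herm_pd (G *m H *m G ^t*) -> herm_pd H.
Proof.
move=> GiG pd v v0.
have vE : v = v *m Gi *m G by rewrite -mulmxA GiG mulmx1.
have := pd (v *m Gi); rewrite !mulmxA -vE -mulmxA -trmxC_mul -vE; apply.
by apply: contraNneq v0 => w0; rewrite vE w0 mul0mx.
Qed.

(** The change of basis behind both reductions: the unitary one to triangular form and the
    elimination of the corner entry of H. *)
Lemma lyapunov_congr n (G Gi T H M : 'M[C]_n) : Gi *m G = 1%:M ->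
  T *m H + H *m T ^t* = - M ->
  (G *m T *m Gi) *m (G *m H *m G ^t*) +
   (G *m H *m G ^t*) *m (G *m T *m Gi) ^t* = - (G *m M *m G ^t*).
Proof.
move=> GiG eqn; rewrite -mulNmx -mulmxN -eqn mulmxDr mulmxDl; congr (_ + _).
  by rewrite !mulmxA -(mulmxA _ Gi G) GiG mulmx1.
rewrite !trmxC_mul !mulmxA -[_ *m G ^t* *m Gi ^t*]mulmxA -trmxC_mul GiG.
by rewrite trmx1 map_mx1 mulmx1.
Qed.

(* Induction on n: the corner entry of H is positive by the corner of the equation, and the
   Schur complement of that entry solves the Lyapunov equation of the remaining triangular block. *)
Lemma trig_lyapunov_pd n (T H M : 'M[C]_n) : is_trig_mx T ->
  (forall i, T i i + (T i i)^* < 0) -> H ^t* = H -> herm_pd M ->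
  T *m H + H *m T ^t* = - M -> herm_pd H.
Proof.
elim: n => [|n IH] in T H M *.
  by move=> _ _ _ _ _ v /eqP[]; apply/matrixP => i [].
move: T H M; rewrite -[n.+1]/(1 + n)%N => T H M.
move=> /is_trig_mxP Ttrig Tneg Hh pdM eqn.
pose a := H 0 0; pose t := T 0 0.
pose b := dlsubmx H; pose H' := drsubmx H; pose r := dlsubmx T; pose T' := drsubmx T.
have Hur : ursubmx H = b ^t*.
  by rewrite -[in LHS]Hh /b; apply/matrixP => i j; rewrite !mxE.
have HE : H = block_mx a%:M (b ^t*) b H'.
  rewrite -[LHS]submxK Hur; congr block_mx.
  by rewrite [LHS]mx11_scalar !mxE; congr (H _ _)%:M; apply/val_inj.
have TE : T = block_mx t%:M 0 r T'.
  rewrite -[LHS]submxK; congr block_mx.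
    by rewrite [LHS]mx11_scalar !mxE; congr (T _ _)%:M; apply/val_inj.
  by apply/matrixP => i j; rewrite !mxE Ttrig //= ord1.
have a_real : a^* = a.
  by rewrite /a -[in RHS]Hh !mxE.
have a_gt0 : 0 < a.
  have e0 : (delta_mx 0 0 : 'rV[C]_(1 + n)) != 0.
    apply/eqP => /matrixP /(_ 0 0); rewrite !mxE !eqxx => /eqP.
    by rewrite oner_eq0.
  have := pdM _ e0.
  have -> : (delta_mx 0 0 : 'rV[C]_(1 + n)) *m M *m (delta_mx 0 0) ^t* = (M 0 0)%:M.
    rewrite -rowE trmx_delta map_delta_mx -colE [LHS]mx11_scalar !mxE.
    by [].
  rewrite !mxE eqxx mulr1n.
  (* Beyond t the first row of the lower triangular T vanishes, so the corner of T H + H T^*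
     involves only a; positivity of M then fixes the sign of a. *)
  have M00 : - M 0 0 = (t + t^*) * a.
    have := congr1 (fun X : 'M[C]_(1 + n) => X 0 0) eqn.
    rewrite [in RHS]mxE => <-; rewrite mxE [in LHS]mxE [X in _ + X]mxE.
    have -> : \sum_j T 0 j * H j 0 = t * a.
      rewrite (bigD1 0) //= big1 ?addr0 // => i i0.
      by rewrite Ttrig ?mul0r // lt0n.
    have -> : \sum_j H 0 j * T ^t* j 0 = a * t^*.
      rewrite (bigD1 0) //= big1 ?addr0 => [|i i0]; first by rewrite !mxE.
      by rewrite !mxE Ttrig ?lt0n // conjC0 mulr0.
    by rewrite mulrDl; congr (_ + _); rewrite mulrC.
  by rewrite -oppr_lt0 M00 nmulr_rlt0 // Tneg.
have a_neq0 : a != 0 by rewrite gt_eqF.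
(* One step of symmetric elimination: G clears b and leaves a and the Schur complement [H'']. *)
pose G := block_mx 1%:M 0 (- (a^-1 *: b)) 1%:M : 'M[C]_(1 + n).
pose Gi := block_mx 1%:M 0 (a^-1 *: b) 1%:M : 'M[C]_(1 + n).
have GiG : Gi *m G = 1%:M.
  rewrite /G /Gi mulmx_block !(mulmx0, mul0mx, mulmx1, mul1mx, addr0, add0r).
  by rewrite subrr -scalar_mx_block.
have Gu : G \in unitmx by case/mulmx1_unit: GiG.
pose H'' := H' - a^-1 *: (b *m b ^t*).
have GHG : G *m H *m G ^t* = block_mx a%:M 0 0 H''.
  rewrite {1}HE /G tr_block_mx map_block_mx !mulmx_block.
  rewrite !(trmx0, map_mx0, tr_scalar_mx, map_scalar_mx) /= conjC1.
  rewrite !(mulmx0, mul0mx, mulmx1, mul1mx, addr0, add0r).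
  have ba : - (a^-1 *: b) *m a%:M + b = 0.
    rewrite mulNmx -scalemxAl mul_mx_scalar scalerA mulVf // scale1r.
    by rewrite addNr.
  rewrite ba mul0mx add0r; congr block_mx.
    apply/matrixP => i j; rewrite mul_scalar_mx !mxE rmorphN rmorphM fmorphV.
    by rewrite /= a_real mulrN mulrA mulfV // mul1r addNr.
  by rewrite mulNmx -scalemxAl addrC.
(* Conjugation by the unit lower triangular G keeps T block lower triangular with the same diagonal
   blocks; the lower left block may become anything. *)
have GTG : G *m T *m Gi = block_mx t%:M 0 (dlsubmx (G *m T *m Gi)) T'.
  rewrite -[LHS]submxK; congr block_mx.
  - by rewrite TE /G /Gi !mulmx_block block_mxKul
      !(mulmx0, mul0mx, mulmx1, mul1mx, addr0, add0r).
  - by rewrite TE /G /Gi !mulmx_block block_mxKur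
      !(mulmx0, mul0mx, mulmx1, mul1mx, addr0, add0r).
  - by rewrite TE /G /Gi !mulmx_block block_mxKdr
      !(mulmx0, mul0mx, mulmx1, mul1mx, addr0, add0r).
have pdM1 := herm_pd_congr Gu pdM.
have := lyapunov_congr GiG eqn; rewrite GTG GHG.
set M1 := G *m M *m G ^t* in pdM1 *.
rewrite tr_block_mx map_block_mx !mulmx_block.
rewrite !(trmx0, map_mx0, mulmx0, mul0mx, addr0, add0r) add_block_mx.
(* As G H G^* is block diagonal, the lower left block of G T Gi does not reach this corner, which is
   the Lyapunov equation of [T'] and [H'']. *)
move=> /(congr1 (@drsubmx _ 1 n 1 n)); rewrite block_mxKdr => eq1.
have pdH'' : herm_pd H''.
  apply: (IH T' H'' (drsubmx M1)).
  - by apply/is_trig_mxP => i j ij; rewrite !mxE Ttrig.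
  - by move=> i; rewrite !mxE Tneg.
  - rewrite /H'' linearB /= map_mxB linearZ /= map_mxZ trmxC_mul trmxCK.
    rewrite fmorphV /= a_real; congr (_ - _).
    by rewrite /H' -[in RHS]Hh; apply/matrixP => i j; rewrite !mxE.
  - move=> v v0; have := pdM1 (row_mx 0 v).
    rewrite -{1}[M1]submxK mul_row_block tr_row_mx map_col_mx mul_row_col.
    rewrite !(trmx0, map_mx0, mulmx0, mul0mx, addr0, add0r); apply.
    by apply: contraNneq v0 => e; have := row_mxKr (0 : 'rV[C]_1) v; rewrite e linear0 => <-.
  - by rewrite eq1; apply/matrixP => i j; rewrite !mxE.
apply: (herm_pd_congr_inv GiG); rewrite GHG => v.
rewrite -[v]hsubmxK; set s := lsubmx v; set w := rsubmx v => v0.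
rewrite mul_row_block tr_row_mx map_col_mx mul_row_col.
rewrite !(mulmx0, mul0mx, addr0, add0r) mxE.
have -> : (s *m a%:M *m s ^t*) 0 0 = a * `|s 0 0| ^+ 2.
  by rewrite mul_mx_scalar -scalemxAl mxE mxE big_ord1 !mxE normCK.
have [w0|w0] := eqVneq w 0; last first.
  by rewrite ltr_wpDl ?pdH'' // mulr_ge0 ?exprn_ge0 // ltW.
rewrite w0 !mul0mx [X in _ + X]mxE addr0 mulr_gt0 // exprn_gt0 // normr_gt0.
apply: contraNneq v0 => s0; rewrite w0 [s]mx11_scalar s0.
by rewrite raddf0 row_mx0.
Qed.
(** A unitary triangularization of F puts its eigenvalues on the diagonal, where [trig_lyapunov_pd]
    looks for them. *)
Lemma lyapunov_pd n (F H M : 'M[C]_n) :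
  (forall z, eigenvalue F z -> z + z^* < 0) -> H ^t* = H -> herm_pd M ->
  F *m H + H *m F ^t* = - M -> herm_pd H.
Proof.
case: n => [|n] in F H M *; first by move=> _ _ _ _ v /eqP[]; apply/matrixP => i [].
move=> Fneg Hh pdM eqn; have [U Uu] := Schur F (ltn0Sn n).
have UU : U *m U ^t* = 1%:M by apply/unitarymxP.
have UiU : U ^t* *m U = 1%:M by exact: mulmx1C.
have Uunit := unitarymx_unit Uu.
rewrite /similar_to /= conjumx // invmx_unitary // => Ttrig.
apply: (herm_pd_congr_inv UiU).
apply: (trig_lyapunov_pd Ttrig _ _ (herm_pd_congr Uunit pdM) (lyapunov_congr UiU eqn)); last first.
  by rewrite !trmxC_mul trmxCK Hh mulmxA.
move=> i; apply: Fneg; set T := U *m F *m U ^t*.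
have : eigenvalue T (T i i).
  rewrite eigenvalue_root_char char_poly_trig // rootE horner_prod.
  by rewrite (bigD1 i) //= hornerXsubC subrr mul0r.
move=> /eigenvalueP[v vT v0]; apply/eigenvalueP; exists (v *m U).
  by rewrite scalemxAl -vT /T -!mulmxA UiU mulmx1.
by apply: contraNneq v0 => vU; rewrite -(mulmxK Uunit v) vU mul0mx.
Qed.
End Lyapunov.

(** * Descent from complex to real matrices *)

Section RealLyapunov.
Variable R : rcfType.
Local Notation C := R[i].
Local Notation toC := (map_mx (real_complex R)).
Local Notation im := ('i%C : C).

Lemma conjC_real (x : R) : (x%:C%C : C)^* = x%:C%C.
Proof. exact: conjc_real. Qed.

Lemma conjC_im : im^* = - im.
Proof. by apply/eqP; rewrite eq_complex /= oppr0 !eqxx. Qed.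

Lemma map_realC_trmxC m n (X : 'M[R]_(m, n)) : toC X ^t* = toC (X^T).
Proof. by apply/matrixP => i j; rewrite !mxE conjC_real. Qed.

Lemma complex_mx_rect m n (V : 'M[C]_(m, n)) :
  exists p q : 'M[R]_(m, n), V = toC p + im *: toC q.
Proof.
exists (map_mx (@complex.Re R) V), (map_mx (@complex.Im R) V).
by apply/matrixP => i j; rewrite !mxE -complexE.
Qed.

Lemma trmxC_rect m n (p q : 'M[R]_(m, n)) :
  (toC p + im *: toC q) ^t* = toC (p^T) - im *: toC (q^T).
Proof.
apply/matrixP => i j; rewrite !mxE rmorphD rmorphM /= !conjC_real.
by rewrite conjC_im mulNr.
Qed.

Lemma complex_mx_eq m n (p q p' q' : 'M[R]_(m, n)) :
  toC p + im *: toC q = toC p' + im *: toC q' -> p = p' /\ q = q'.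
Proof.
move=> /matrixP e; split; apply/matrixP => i j; have := e i j; rewrite !mxE;
  by move=> /eqP; rewrite eq_complex /=; simpc => /andP[/eqP ? /eqP ?].
Qed.

(** For symmetric X the imaginary part cancels. For skew X the real part vanishes instead and 2 i q
    X p^T remains, so that i X has a real form; [real_lyapunov] uses both cases. *)
Lemma form_rect n (X : 'M[R]_n) (p q : 'rV[R]_n) :
  (toC p + im *: toC q) *m toC X *m (toC p + im *: toC q) ^t* =
  toC (p *m X *m p^T + q *m X *m q^T) + im *: toC (q *m X *m p^T - p *m X *m q^T).
Proof.
rewrite trmxC_rect mulmxDl mulmxBr !mulmxDl -!scalemxAr -!scalemxAl scalerA.
have -> : im * im = -1 by rewrite -expr2 sqr_i.
rewrite !(map_mxD, map_mxB, map_mxM) /= scaleN1r map_mxN !map_mxM /=.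
by rewrite scalerDr scalerN opprD opprK [- _ + _]addrC addrACA.
Qed.

Lemma form_swap n (X : 'M[R]_n) (p q : 'rV[R]_n) :
  p *m X *m q^T = q *m X^T *m p^T.
Proof.
have tr11 (Y : 'M[R]_1) : Y^T = Y by rewrite [Y]mx11_scalar tr_scalar_mx.
by rewrite -[LHS]tr11 !trmx_mul trmxK mulmxA.
Qed.

Lemma form_pair_pos n (X : 'M[R]_n) (p q : 'rV[R]_n) :
  (forall v : 'rV[R]_n, v != 0 -> 0 < (v *m X *m v^T) 0 0) ->
  (p != 0) || (q != 0) -> 0 < (p *m X *m p^T + q *m X *m q^T) 0 0.
Proof.
move=> pd; rewrite mxE; have [->|p0] := eqVneq p 0.
  by move=> /= q0; rewrite !mul0mx mxE add0r pd.
have [->|q0] := eqVneq q 0; first by rewrite !mul0mx [X in _ + X]mxE addr0 pd.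
by rewrite addr_gt0 ?pd.
Qed.

Lemma rect_neq0 n (p q : 'rV[R]_n) :
  (toC p + im *: toC q != 0) = (p != 0) || (q != 0).
Proof.
rewrite -negb_and; congr (~~ _); apply/eqP/andP; last first.
  by case=> /eqP-> /eqP->; rewrite !map_mx0 scaler0 addr0.
move=> e; have [] := @complex_mx_eq _ _ p q 0 0; last by move=> -> ->.
by rewrite e !map_mx0 scaler0 addr0.
Qed.

(* With S = P + P^T and N = P - P^T, every Hermitian matrix S + i c N, c real, solves the same
   equation and hence is positive definite; letting c vary forces N = 0. *)
Lemma real_lyapunov n (Phi P M : 'M[R]_n) :
  (forall a b (p q : 'cV[R]_n), (p != 0) || (q != 0) ->
     Phi *m p = a *: p - b *: q -> Phi *m q = b *: p + a *: q -> a < 0) ->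
  M^T = M -> (forall v : 'rV[R]_n, v != 0 -> 0 < (v *m M *m v^T) 0 0) ->
  Phi^T *m P + P *m Phi = - M ->
  P^T = P /\ (forall v : 'rV[R]_n, v != 0 -> 0 < (v *m P *m v^T) 0 0).
Proof.
move=> hur Ms Mpd eqn.
pose F := toC Phi^T.
have Fneg z : eigenvalue F z -> z + z^* < 0.
  move=> /eigenvalueP[v vF v0].
  have [p [q vE]] := complex_mx_rect v.
  have zE := complexE z; set a := complex.Re z in zE; set b := complex.Im z in zE.
  have [rePhi imPhi] : p *m Phi^T = a *: p - b *: q /\ q *m Phi^T = b *: p + a *: q.
    apply: complex_mx_eq.
    rewrite !map_mxM -/F scalemxAl -mulmxDl -vE vF zE vE.
    rewrite !(map_mxD, map_mxN, map_mxZ) /= scalerDl !scalerDr !scalerA.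
    rewrite mulrAC -expr2 sqr_i mulN1r scaleNr [_ *: toC p + _ *: toC q]addrC.
    by rewrite addrACA addrC [_ *: toC q + _ *: toC p]addrC [_ * im]mulrC.
  have : a < 0.
    apply: (hur a b p^T q^T).
    - by rewrite -[p^T]trmxK -[q^T]trmxK !trmx_eq0 -rect_neq0 -vE.
    - by rewrite -[Phi]trmxK -trmx_mul rePhi !linearD !linearN !linearZ.
    - by rewrite -[Phi]trmxK -trmx_mul imPhi !linearD !linearZ.
  have -> : z + z^* = (a + a)%:C%C.
    rewrite zE rmorphD rmorphM /= !conjC_real conjC_im mulNr addrACA subrr.
    by rewrite addr0 rmorphD.
  by rewrite ltcR => a0; rewrite -oppr_gt0 opprD addr_gt0 // oppr_gt0.
have eqnT : Phi^T *m P^T + P^T *m Phi = - M.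
  by rewrite -Ms -linearN /= -eqn linearD /= !trmx_mul trmxK addrC.
pose S := P + P^T; pose N := P - P^T.
(* P and P^T both solve the equation with M, so their sum S solves it with M + M. *)
have pdM : herm_pd (toC (M + M)).
  move=> v; have [p [q ->]] := complex_mx_rect v => v0.
  rewrite form_rect (form_swap _ q p).
  have -> : (M + M)^T = M + M by rewrite linearD /= Ms.
  rewrite subrr map_mx0 scaler0 addr0.
  rewrite mxE ltcR form_pair_pos -?rect_neq0 // => w w0.
  by rewrite mulmxDr mulmxDl mxE addr_gt0 ?Mpd.
have key c : herm_pd (toC S + (im * c%:C%C) *: toC N).
  apply: (lyapunov_pd Fneg _ pdM).
    rewrite linearD /= map_mxD map_realC_trmxC linearZ /= map_mxZ map_realC_trmxC.
    rewrite rmorphM /= conjC_real conjC_im /S /N !linearD /= linearN /= trmxK.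
    rewrite mulNr scaleNr -scalerN -map_mxN opprB.
    by rewrite [P^T + P]addrC.
  rewrite /F map_realC_trmxC trmxK mulmxDl mulmxDr -scalemxAl -scalemxAr.
  rewrite addrACA -scalerDr -!map_mxM -!map_mxD -map_mxN.
  have -> : Phi^T *m N + N *m Phi = 0.
    by rewrite /N mulmxBl mulmxBr addrACA -opprD eqn eqnT subrr.
  have -> : Phi^T *m S + S *m Phi = - (M + M).
    by rewrite /S mulmxDl mulmxDr addrACA eqn eqnT opprD.
  by rewrite map_mx0 scaler0 addr0.
have form0 (v : 'rV[R]_n) : v *m N *m v^T = 0.
  rewrite /N mulmxBr mulmxBl; apply/eqP; rewrite subr_eq0; apply/eqP.
  by rewrite form_swap.
have Sform c (p q : 'rV[R]_n) : (p != 0) || (q != 0) ->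
    0 < (p *m S *m p^T + q *m S *m q^T) 0 0 - 2%:R * c * (q *m N *m p^T) 0 0.
  rewrite -rect_neq0 => /(key c).
  rewrite mulmxDr mulmxDl -scalemxAr -scalemxAl !form_rect !form0.
  rewrite (form_swap S q p) (form_swap N p q).
  have -> : S^T = S by rewrite /S linearD /= trmxK addrC.
  have -> : N^T = - N by rewrite /N linearD linearN /= trmxK opprB.
  rewrite mulmxN mulNmx opprK subrr addr0 !map_mx0 scaler0 addr0 add0r scalerA.
  rewrite mulrAC -expr2 sqr_i mulN1r scaleNr -map_mxZ -map_mxB mxE ltcR.
  by rewrite -mulr2n -scaler_nat scalerA [2%:R * c]mulrC !mxE.
have NE : N = 0.
  apply/matrixP => i j; rewrite [RHS]mxE; apply/eqP/negPn/negP => Nij.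
  pose q : 'rV[R]_n := delta_mx 0 i; pose p : 'rV[R]_n := delta_mx 0 j.
  have qNp : (q *m N *m p^T) 0 0 = N i j.
    by rewrite /q /p -rowE trmx_delta -colE !mxE.
  have q0 : (p != 0) || (q != 0).
    apply/orP; right; apply/eqP => /matrixP/(_ 0 i); rewrite !mxE !eqxx => /eqP.
    by rewrite oner_eq0.
  have := Sform 0 p q q0; rewrite mulr0 mul0r subr0 => s0.
  (* With s > 0 the value at c = 0, this c turns the form into s - 2 s = - s, so N i j cannot be
     nonzero. *)
  have := Sform ((p *m S *m p^T + q *m S *m q^T) 0 0 / N i j) p q q0.
  rewrite qNp -mulrA mulfVK // mulrDl mul1r opprD addNKr oppr_gt0.
  by move/(lt_trans s0); rewrite ltxx.
have PP : P^T = P by apply/eqP; rewrite eq_sym -subr_eq0 -/N NE.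
split=> // v v0; have := Sform 0 v 0; rewrite v0 => /(_ isT).
rewrite mulr0 mul0r subr0 !mul0mx addr0 /S PP mulmxDr mulmxDl mxE -mulr2n.
by rewrite pmulrn_lgt0.
Qed.
End RealLyapunov.

(** * Transfer between function-encoded and MathComp matrices *)

Section Bridge.
Import Rstruct.

Definition mx_of n (A : mat) : 'M[R]_n := \matrix_(i, j) A i j.
Definition col_of n (v : vec) : 'cV[R]_n := \col_i v i.
Definition vec_of n (v : 'cV[R]_n) : vec :=
  fun i => if insub i is Some j then v j 0 else 0.

Lemma fsum_big n f : fsum n f = \sum_(i < n) f i.
Proof. by elim: n => [|n IH] /=; rewrite ?big_ord0 // big_ord_recr /= -IH. Qed.

Lemma col_of_mv n A v : col_of n (mv n A v) = mx_of n A *m col_of n v.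
Proof.
apply/matrixP => i j; rewrite !mxE /mv fsum_big; apply: eq_bigr => k _.
by rewrite !mxE.
Qed.

Lemma mx_of_mm n A B : mx_of n (mm n A B) = mx_of n A *m mx_of n B.
Proof.
apply/matrixP => i j; rewrite !mxE /mm fsum_big; apply: eq_bigr => k _.
by rewrite !mxE.
Qed.

Lemma mx_of_mtr n A : mx_of n (mtr A) = (mx_of n A)^T.
Proof. by apply/matrixP => i j; rewrite !mxE. Qed.

Lemma mx_of_madd n A B : mx_of n (madd A B) = mx_of n A + mx_of n B.
Proof. by apply/matrixP => i j; rewrite !mxE. Qed.

Lemma mx_of_meq n A B : meq n n A B <-> mx_of n A = mx_of n B.
Proof.
split=> [e|/matrixP e i j /ssrnat.ltP hi /ssrnat.ltP hj].
  by apply/matrixP => i j; rewrite !mxE; apply: e; apply/ssrnat.ltP.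
by have := e (Ordinal hi) (Ordinal hj); rewrite !mxE.
Qed.

Lemma col_of_veq n u v : veq n u v <-> col_of n u = col_of n v.
Proof.
split=> [e|/matrixP e i /ssrnat.ltP hi].
  by apply/matrixP => i j; rewrite !mxE; apply: e; apply/ssrnat.ltP.
by have := e (Ordinal hi) 0; rewrite !mxE.
Qed.

Lemma vec_ofK n (v : 'cV[R]_n) : col_of n (vec_of v) = v.
Proof.
by apply/matrixP => i j; rewrite !mxE /vec_of valK ord1.
Qed.

Definition mat_of n (X : 'M[R]_n) : mat := fun i j =>
  if insub i is Some i' then if insub j is Some j' then X i' j' else 0 else 0.

Lemma mat_ofK n (X : 'M[R]_n) : mx_of n (mat_of X) = X.
Proof. by apply/matrixP => i j; rewrite !mxE /mat_of !valK. Qed.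

Lemma col_of_neq0 n v : vnonzero n v <-> col_of n v != 0.
Proof.
split=> [[i [/ssrnat.ltP hi vi]]|v0].
  by apply/eqP => /matrixP /(_ (Ordinal hi) 0); rewrite !mxE.
apply: NNPP => nv; case/eqP: v0; apply/matrixP => i j; rewrite !mxE.
by apply: NNPP => vi; apply: nv; exists i; split=> //; apply/ssrnat.ltP.
Qed.

Lemma qform_mx n A v :
  qform n A v = ((col_of n v)^T *m mx_of n A *m col_of n v) 0 0.
Proof.
rewrite -mulmxA -col_of_mv mxE /qform fsum_big; apply: eq_bigr => i _.
by rewrite !mxE.
Qed.

(** For the eigenvalue bound: once M - s I is injective, its inverse must exist as a matrix so that
    [mv_bounded] applies to it. *)
Lemma right_inverse_of_injective n (A : mat) :
  (forall v, veq n (mv n A v) vzero -> veq n v vzero) ->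
  exists B : mat, forall v, veq n (mv n A (mv n B v)) v.
Proof.
move=> inj; have Au : mx_of n A \in unitmx.
  rewrite -unitmx_tr -row_free_unit -kermx_eq0; apply/eqP/row_matrixP => i.
  rewrite row0; set w := row i _.
  have wA : w *m (mx_of n A)^T = 0 by apply/sub_kermxP/row_sub.
  have := inj (vec_of w^T); rewrite !col_of_veq col_of_mv vec_ofK.
  have -> : col_of n vzero = 0 by apply/matrixP => k l; rewrite !mxE.
  rewrite -[mx_of n A]trmxK -trmx_mul wA trmx0 => /(_ erefl) w0.
  by rewrite -[w]trmxK w0 trmx0.
exists (mat_of (invmx (mx_of n A))) => v.
by apply/col_of_veq; rewrite !col_of_mv mat_ofK mulKVmx.
Qed.

Theorem lyapunov_pos_def n (Phi P M : mat) :
  hurwitz n Phi -> pos_def n M ->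
  meq n n (madd (madd (mm n (mtr Phi) P) (mm n P Phi)) M) (fun _ _ => 0%R) ->
  pos_def n P.
Proof.
move=> hur [Ms Mpd] /mx_of_meq; rewrite !mx_of_madd !mx_of_mm mx_of_mtr.
have -> : mx_of n (fun _ _ => 0%R) = 0 by apply/matrixP => k l; rewrite !mxE.
move=> /eqP; rewrite addr_eq0 => /eqP eqn.
move/mx_of_meq: Ms; rewrite mx_of_mtr => Ms.
have pdE (A : mat) : (forall v, vnonzero n v -> Rlt 0 (qform n A v)) <->
    (forall v : 'rV[R]_n, v != 0 -> 0 < (v *m mx_of n A *m v^T) 0 0).
  split=> pd v.
    move=> v0; have := pd (vec_of v^T); rewrite col_of_neq0 qform_mx vec_ofK trmxK.
    by rewrite trmx_eq0 => /(_ v0) /RltP.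
  by rewrite col_of_neq0 qform_mx => v0; apply/RltP; rewrite -{2}[col_of n v]trmxK pd ?trmx_eq0.
have [|||PT Ppd] := @real_lyapunov R n (mx_of n Phi) (mx_of n P) (mx_of n M) _ _ _ eqn.
- move=> a b p q pq0 ep eq; apply/RltP; apply: (hur a b).
  exists (vec_of p), (vec_of q); split; last split.
  + by rewrite !col_of_neq0 !vec_ofK; apply/orP.
  + rewrite col_of_veq col_of_mv vec_ofK ep; apply/matrixP => i j.
    by rewrite -[in LHS](vec_ofK p) -[in LHS](vec_ofK q) !mxE.
  + rewrite col_of_veq col_of_mv vec_ofK eq; apply/matrixP => i j.
    by rewrite -[in LHS](vec_ofK p) -[in LHS](vec_ofK q) !mxE.
- by [].
- exact/pdE.
split; first by apply/mx_of_meq; rewrite mx_of_mtr.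
exact/pdE.
Qed.
End Bridge.

End Lyapunov.

(** * Vectors and quadratic forms *)

Lemma fsum_ext k f g : (forall i, (i < k)%nat -> f i = g i) -> fsum k f = fsum k g.
Proof.
  induction k as [|k IH]; intros e; simpl; [reflexivity|].
  rewrite IH by (intros; apply e; lia). rewrite e by lia. reflexivity.
Qed.

Lemma fsum_plus k f g : fsum k (fun i => f i + g i) = fsum k f + fsum k g.
Proof. induction k as [|k IH]; simpl; [ring|rewrite IH; ring]. Qed.

Lemma fsum_scal k c f : fsum k (fun i => c * f i) = c * fsum k f.
Proof. induction k as [|k IH]; simpl; [ring|rewrite IH; ring]. Qed.

Lemma fsum_zero k : fsum k (fun _ => 0) = 0.
Proof. induction k as [|k IH]; simpl; [ring|rewrite IH; ring]. Qed.

Lemma fsum_le k f g : (forall i, (i < k)%nat -> f i <= g i) -> fsum k f <= fsum k g.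
Proof.
  induction k as [|k IH]; intros e; simpl; [lra|].
  apply Rplus_le_compat; [apply IH; intros; apply e; lia|apply e; lia].
Qed.

Lemma fsum_exchange k l f :
  fsum k (fun i => fsum l (fun j => f i j)) = fsum l (fun j => fsum k (fun i => f i j)).
Proof.
  induction k as [|k IH]; simpl; [symmetry; apply fsum_zero|].
  rewrite IH, <- fsum_plus. reflexivity.
Qed.

Lemma fsum_term_le k f i :
  (forall j, (j < k)%nat -> 0 <= f j) -> (i < k)%nat -> f i <= fsum k f.
Proof.
  induction k as [|k IH]; intros pos hi; simpl; [lia|].
  assert (0 <= fsum k f).
  { rewrite <- (fsum_zero k). apply fsum_le; intros; apply pos; lia. }
  destruct (Nat.eq_dec i k) as [->|ne]; [lra|].
  assert (f i <= fsum k f) by (apply IH; [intros; apply pos|]; lia).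
  specialize (pos k ltac:(lia)). lra.
Qed.

Definition dot (k : nat) (u v : vec) : R := fsum k (fun i => u i * v i).

Lemma dot_ext k u u' v v' : veq k u u' -> veq k v v' -> dot k u v = dot k u' v'.
Proof. intros e f; apply fsum_ext; intros i hi; rewrite e, f by easy; reflexivity. Qed.

Lemma dot_comm k u v : dot k u v = dot k v u.
Proof. apply fsum_ext; intros; ring. Qed.

Lemma dot_add_r k u v w : dot k u (vadd v w) = dot k u v + dot k u w.
Proof. unfold dot; rewrite <- fsum_plus; apply fsum_ext; intros; unfold vadd; ring. Qed.

Lemma dot_scale_r k c u v : dot k u (vscale c v) = c * dot k u v.
Proof. unfold dot; rewrite <- fsum_scal; apply fsum_ext; intros; unfold vscale; ring. Qed.

Lemma dot_sub_r k u v w : dot k u (vsub v w) = dot k u v - dot k u w.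
Proof.
  transitivity (dot k u (vadd v (vscale (-1) w))).
  - apply fsum_ext; intros; unfold vsub, vadd, vscale; ring.
  - rewrite dot_add_r, dot_scale_r; ring.
Qed.

Lemma dot_add_l k u v w : dot k (vadd v w) u = dot k v u + dot k w u.
Proof. rewrite !(dot_comm k _ u); apply dot_add_r. Qed.

Lemma dot_scale_l k c u v : dot k (vscale c v) u = c * dot k v u.
Proof. rewrite !(dot_comm k _ u); apply dot_scale_r. Qed.

Lemma dot_self_pos k u : 0 <= dot k u u.
Proof.
  unfold dot. rewrite <- (fsum_zero k). apply fsum_le; intros; nra.
Qed.

Lemma dot_self_eq0 k u : dot k u u = 0 -> veq k u vzero.
Proof.
  intros e i hi. unfold vzero.
  assert (u i * u i <= dot k u u).
  { apply (fsum_term_le k (fun i => u i * u i)); [intros; nra|easy]. }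
  nra.
Qed.

Lemma vnonzero_dot k u : vnonzero k u -> 0 < dot k u u.
Proof.
  intros [i [hi ui]]. destruct (Rle_lt_or_eq_dec _ _ (dot_self_pos k u)) as [|e]; [easy|].
  exfalso. apply ui. apply (dot_self_eq0 k u (eq_sym e) i hi).
Qed.

Lemma vnorm_dot k u : vnorm k u = sqrt (dot k u u).
Proof. unfold vnorm, dot. f_equal. apply fsum_ext; intros; ring. Qed.

Lemma vnorm_sqr k u : vnorm k u ^ 2 = dot k u u.
Proof. rewrite vnorm_dot. apply pow2_sqrt, dot_self_pos. Qed.

Lemma vnorm_pos k u : 0 <= vnorm k u.
Proof. rewrite vnorm_dot. apply sqrt_pos. Qed.

Lemma vnorm_ext k u v : veq k u v -> vnorm k u = vnorm k v.
Proof. intros e. rewrite !vnorm_dot. f_equal. now apply dot_ext. Qed.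

(** The degenerate case a = 0 matters: Cauchy-Schwarz for a singular semidefinite form meets vectors
    on which the form vanishes. *)
Lemma quadratic_discriminant a b c :
  (forall t, 0 <= a * t ^ 2 + 2 * b * t + c) -> b ^ 2 <= a * c.
Proof.
  intros q.
  destruct (Req_dec a 0) as [->|a0].
  - destruct (Req_dec b 0) as [->|b0]; [nra|].
    specialize (q (- (c + 1) / (2 * b))).
    replace (0 * (- (c + 1) / (2 * b)) ^ 2 + 2 * b * (- (c + 1) / (2 * b)) + c)
      with (-1) in q by (field; lra). lra.
  - assert (0 < a).
    { destruct (Rtotal_order a 0) as [lt|[?|?]]; [|lra|easy].
      exfalso. pose proof (q 0) as q0.
      set (t := (1 + c + Rabs b) / - a) in *.
      assert (a * t = - (1 + c + Rabs b)) by (unfold t; field; lra).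
      (* Adding the inequalities at t2 and - t2 cancels b. As t2 >= 1 and a t2 <= - (1 + c), the sum
         is negative, which rules out a < 0. *)
      set (t2 := 1 + t + 2 * Rabs b / - a).
      pose proof (q (t2)). pose proof (q (- t2)).
      assert (0 <= Rabs b) by apply Rabs_pos.
      assert (a * (2 * Rabs b / - a) = - 2 * Rabs b) by (field; lra).
      assert (0 <= t) by (unfold t; apply Rdiv_le_0_compat; lra).
      assert (0 <= 2 * Rabs b / - a) by (apply Rdiv_le_0_compat; lra).
      assert (a * t2 <= - (1 + c)) by (unfold t2; nra).
      assert (1 <= t2) by (unfold t2; lra).
      nra. }
    specialize (q (- b / a)).
    replace (a * (- b / a) ^ 2 + 2 * b * (- b / a) + c) with (c - b ^ 2 / a) in q
      by (field; lra).
    apply Rmult_le_reg_r with (/ a); [now apply Rinv_0_lt_compat|].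
    replace (a * c * / a) with c by (field; lra).
    unfold Rdiv in q. lra.
Qed.

Lemma dot_cauchy_schwarz k u v : Rabs (dot k u v) <= vnorm k u * vnorm k v.
Proof.
  apply Rsqr_incr_0_var.
  2: apply Rmult_le_pos; apply vnorm_pos.
  rewrite <- Rsqr_abs, !Rsqr_pow2, Rpow_mult_distr, !vnorm_sqr, Rmult_comm.
  apply quadratic_discriminant; intros t.
  pose proof (dot_self_pos k (vadd u (vscale t v))) as p.
  rewrite !dot_add_r, !dot_add_l, !dot_scale_r, !dot_scale_l, (dot_comm k v u) in p.
  nra.
Qed.

Lemma dot_le_norm k u v : dot k u v <= vnorm k u * vnorm k v.
Proof. eapply Rle_trans; [apply Rle_abs|apply dot_cauchy_schwarz]. Qed.

Lemma vnorm_le_sqr k u c : 0 <= c -> dot k u u <= c ^ 2 -> vnorm k u <= c.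
Proof. intros c0 h. rewrite <- vnorm_sqr in h. pose proof (vnorm_pos k u). nra. Qed.

Lemma vnorm_add k u v : vnorm k (vadd u v) <= vnorm k u + vnorm k v.
Proof.
  pose proof (vnorm_pos k u); pose proof (vnorm_pos k v).
  apply vnorm_le_sqr; [lra|].
  rewrite dot_add_r, !dot_add_l, (dot_comm k v u), <- !vnorm_sqr.
  pose proof (dot_le_norm k u v). nra.
Qed.

Lemma vnorm_scale k c u : vnorm k (vscale c u) = Rabs c * vnorm k u.
Proof.
  rewrite !vnorm_dot, dot_scale_r, dot_scale_l, <- Rmult_assoc.
  rewrite sqrt_mult by (try apply dot_self_pos; nra).
  f_equal. change (c * c) with (Rsqr c). apply sqrt_Rsqr_abs.
Qed.

Lemma vnorm_zero k : vnorm k vzero = 0.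
Proof.
  rewrite vnorm_dot. unfold dot, vzero. rewrite fsum_scal, Rmult_0_l. apply sqrt_0.
Qed.

Lemma vnorm_sub k u v : vnorm k (vsub u v) <= vnorm k u + vnorm k v.
Proof.
  rewrite (vnorm_ext k (vsub u v) (vadd u (vscale (-1) v))).
  2: intros i _; unfold vsub, vadd, vscale; ring.
  eapply Rle_trans; [apply vnorm_add|]. rewrite vnorm_scale, Rabs_left by lra. lra.
Qed.

Lemma vnorm_sub_sym k u v : vnorm k (vsub u v) = vnorm k (vsub v u).
Proof.
  rewrite (vnorm_ext k (vsub u v) (vscale (-1) (vsub v u))).
  2: intros i _; unfold vsub, vscale; ring.
  rewrite vnorm_scale, Rabs_left by lra. lra.
Qed.

Lemma vnorm_le_sub k u v : vnorm k u <= vnorm k v + vnorm k (vsub u v).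
Proof.
  rewrite (vnorm_ext k u (vadd v (vsub u v))) at 1.
  - apply vnorm_add.
  - intros i _; unfold vadd, vsub; ring.
Qed.

(** The factor k in place of its square root is enough: the bound only serves to produce some
    constant or a small error. *)
Lemma vnorm_le_components k u c :
  (forall i, (i < k)%nat -> Rabs (u i) <= c) -> vnorm k u <= INR k * c.
Proof.
  revert u. induction k as [|k IH]; intros u hu.
  - simpl. unfold vnorm; simpl. rewrite sqrt_0. lra.
  - pose proof (IH u ltac:(intros; apply hu; lia)) as h.
    pose proof (hu k ltac:(lia)) as hk. pose proof (Rabs_pos (u k)).
    assert (vnorm (S k) u <= vnorm k u + Rabs (u k)).
    { pose proof (vnorm_pos k u). apply vnorm_le_sqr; [lra|].
      unfold dot; simpl fsum. fold (dot k u u). rewrite <- vnorm_sqr.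
      assert (u k * u k = Rabs (u k) ^ 2) by (rewrite pow2_abs; ring). nra. }
    rewrite S_INR. lra.
Qed.

Lemma mv_ext k M u v i : veq k u v -> mv k M u i = mv k M v i.
Proof. intros e. apply fsum_ext. intros j hj. now rewrite e. Qed.

Lemma mv_madd k M N v i : mv k (madd M N) v i = mv k M v i + mv k N v i.
Proof. unfold mv. rewrite <- fsum_plus. apply fsum_ext; intros; unfold madd; ring. Qed.

Lemma mv_mscale k c M v i : mv k (mscale c M) v i = c * mv k M v i.
Proof. unfold mv. rewrite <- fsum_scal. apply fsum_ext; intros; unfold mscale; ring. Qed.

Lemma mv_mm k l M N v i : mv k (mm l M N) v i = mv l M (mv k N v) i.
Proof.
  unfold mv, mm.
  transitivity (fsum k (fun j => fsum l (fun p => M i p * (N p j * v j)))).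
  - apply fsum_ext; intros j _. rewrite Rmult_comm, <- fsum_scal.
    apply fsum_ext; intros; ring.
  - rewrite fsum_exchange. apply fsum_ext; intros j _. now rewrite fsum_scal.
Qed.

Lemma mv_vadd k M u v i : mv k M (vadd u v) i = mv k M u i + mv k M v i.
Proof. unfold mv. rewrite <- fsum_plus. apply fsum_ext; intros; unfold vadd; ring. Qed.

Lemma mv_vscale k M c v i : mv k M (vscale c v) i = c * mv k M v i.
Proof. unfold mv. rewrite <- fsum_scal. apply fsum_ext; intros; unfold vscale; ring. Qed.

Lemma mv_vsub k M u v i : mv k M (vsub u v) i = mv k M u i - mv k M v i.
Proof.
  rewrite (mv_ext k M (vsub u v) (vadd u (vscale (-1) v))).
  - rewrite mv_vadd, mv_vscale. ring.
  - intros j _; unfold vsub, vadd, vscale; ring.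
Qed.

Lemma mid_mv k v : veq k (mv k mid v) v.
Proof.
  intros i hi. unfold mv, mid. revert hi. induction k as [|k IH]; intros hi; [lia|].
  simpl. destruct (Nat.eq_dec i k) as [->|ne].
  - rewrite Nat.eqb_refl.
    rewrite (fsum_ext k _ (fun _ => 0)), fsum_zero; [ring|].
    intros j hj. replace (Nat.eqb k j) with false; [ring|].
    symmetry. apply Nat.eqb_neq. lia.
  - rewrite IH by lia. apply Nat.eqb_neq in ne. rewrite ne. ring.
Qed.

Lemma dot_mv k l u M v : dot k u (mv l M v) = dot l (mv k (mtr M) u) v.
Proof.
  unfold dot, mv, mtr.
  transitivity (fsum k (fun i => fsum l (fun j => u i * (M i j * v j)))).
  - apply fsum_ext; intros i _. now rewrite fsum_scal.
  - rewrite fsum_exchange. apply fsum_ext; intros j _.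
    rewrite Rmult_comm, <- fsum_scal. apply fsum_ext; intros; ring.
Qed.

Lemma qform_dot k M v : qform k M v = dot k v (mv k M v).
Proof. reflexivity. Qed.

Lemma symmetric_dot k M u v :
  symmetric k M -> dot k u (mv k M v) = dot k (mv k M u) v.
Proof.
  intros s. rewrite dot_mv. apply dot_ext; [|intros i _; reflexivity].
  intros i hi. apply fsum_ext. intros j hj. now rewrite (s i j hi hj).
Qed.

Lemma mv_bounded k l M : exists c, 0 <= c /\ forall v, vnorm k (mv l M v) <= c * vnorm l v.
Proof.
  exists (INR k * fsum k (fun i => vnorm l (M i))). split.
  - apply Rmult_le_pos; [apply pos_INR|].
    rewrite <- (fsum_zero k). apply fsum_le; intros; apply vnorm_pos.
  - intros v. rewrite Rmult_assoc. apply vnorm_le_components. intros i hi.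
    eapply Rle_trans; [apply (dot_cauchy_schwarz l (M i) v)|].
    apply Rmult_le_compat_r; [apply vnorm_pos|].
    apply (fsum_term_le k (fun i => vnorm l (M i))); [intros; apply vnorm_pos|easy].
Qed.

Lemma opnorm_bound k l M c v : is_opnorm k l M c -> vnorm k (mv l M v) <= c * vnorm l v.
Proof.
  intros [ub _]. destruct (Rle_lt_or_eq_dec _ _ (vnorm_pos l v)) as [p|e].
  - assert (vnorm k (mv l M (vscale (/ vnorm l v) v)) <= c) as h.
    { apply ub. exists (vscale (/ vnorm l v) v). split; [|reflexivity].
      rewrite vnorm_scale, Rabs_right by (left; now apply Rinv_0_lt_compat).
      right. field. lra. }
    rewrite (vnorm_ext k _ (vscale (/ vnorm l v) (mv l M v))) in h
      by (intros i _; apply mv_vscale).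
    rewrite vnorm_scale, Rabs_right in h by (left; now apply Rinv_0_lt_compat).
    apply Rmult_le_reg_l with (/ vnorm l v); [now apply Rinv_0_lt_compat|].
    replace (/ vnorm l v * (c * vnorm l v)) with c by (field; lra). exact h.
  (* A vector of norm zero cannot be normalized; [mv_bounded] shows that its image has norm zero
     too. *)
  - destruct (mv_bounded k l M) as [C [_ hC]]. specialize (hC v).
    rewrite <- e in *. lra.
Qed.

Lemma opnorm_nonneg k l M c : is_opnorm k l M c -> 0 <= c.
Proof.
  intros [ub _]. eapply Rle_trans; [apply (vnorm_pos k (mv l M vzero))|].
  apply ub. exists vzero. rewrite vnorm_zero. split; [lra|reflexivity].
Qed.

Lemma psd_cauchy_schwarz k N u v : symmetric k N -> (forall w, 0 <= qform k N w) ->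
  dot k u (mv k N v) ^ 2 <= qform k N u * qform k N v.
Proof.
  intros s psd. rewrite Rmult_comm. apply quadratic_discriminant; intros t.
  specialize (psd (vadd u (vscale t v))). rewrite qform_dot in psd.
  rewrite (dot_ext k _ (vadd u (vscale t v)) _ (vadd (mv k N u) (vscale t (mv k N v)))) in psd.
  2: easy.
  2: intros i _; rewrite mv_vadd, mv_vscale; reflexivity.
  rewrite !dot_add_r, !dot_add_l, !dot_scale_r, !dot_scale_l in psd.
  rewrite (dot_comm k v (mv k N u)), <- (symmetric_dot k N u v s) in psd.
  rewrite !qform_dot. nra.
Qed.

(* A positive semidefinite injective N satisfies |v|^2 <= c <v, N v>: apply
   Cauchy-Schwarz for the form of N to v and N^-1 v. So the largest s with
   M - s I positive semidefinite is an eigenvalue. *)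
Lemma min_eigenvalue_bound k M lam v : symmetric k M -> is_min_eigenvalue k M lam ->
  lam * dot k v v <= qform k M v.
Proof.
  intros sM [[w [w0 ew]] mini].
  pose (psd := fun s => forall v, s * dot k v v <= qform k M v).
  destruct (mv_bounded k k M) as [C [C0 hC]].
  assert (psd (- C)) as pC.
  { intros x. rewrite qform_dot.
    pose proof (dot_cauchy_schwarz k x (mv k M x)) as h.
    pose proof (Rle_abs (- dot k x (mv k M x))) as h1. rewrite Rabs_Ropp in h1.
    pose proof (hC x). pose proof (vnorm_pos k x). rewrite <- vnorm_sqr. nra. }
  assert (bound psd) as bd.
  { exists lam. intros s ps. specialize (ps w). rewrite qform_dot in ps.
    rewrite (dot_ext k w w (mv k M w) (vscale lam w)), dot_scale_r in ps by easy.
    pose proof (vnonzero_dot k w w0). nra. }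
  destruct (completeness psd bd (ex_intro _ _ pC)) as [s [ub lub]].
  assert (psd s) as ps.
  { intros x. destruct (Rle_lt_dec (s * dot k x x) (qform k M x)) as [|lt]; [easy|].
    exfalso. pose proof (dot_self_pos k x) as px.
    assert (dot k x x <> 0) as nx.
    { intros e. rewrite e in lt. specialize (pC x). rewrite e in pC. lra. }
    assert (s <= qform k M x / dot k x x) as h.
    { apply lub. intros s' ps'. specialize (ps' x).
      apply Rmult_le_reg_r with (dot k x x); [lra|].
      unfold Rdiv. rewrite Rmult_assoc, Rinv_l by easy. lra. }
    apply Rmult_le_compat_r with (r := dot k x x) in h; [|easy].
    unfold Rdiv in h. rewrite Rmult_assoc, Rinv_l in h by easy. lra. }
  enough (lam <= s) as le.
  { specialize (ps v). pose proof (dot_self_pos k v). nra. }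
  (* The supremum s is attained; were it not an eigenvalue, N would be invertible and the form would
     leave room 1 / (c + 1) above s, with c a bound for the inverse. *)
  apply mini. apply NNPP. intros ne.
  pose (N := madd M (mscale (- s) mid)).
  assert (forall x, veq k (mv k N x) (vsub (mv k M x) (vscale s x))) as eN.
  { intros x i hi. unfold N. rewrite mv_madd, mv_mscale, mid_mv by easy.
    unfold vsub, vscale. ring. }
  assert (symmetric k N) as sN.
  { intros i j hi hj. unfold N, madd, mscale, mtr, mid.
    rewrite (sM i j hi hj). unfold mtr. rewrite (Nat.eqb_sym i j). reflexivity. }
  assert (forall x, qform k N x = qform k M x - s * dot k x x) as qN.
  { intros x. rewrite !qform_dot.
    rewrite (dot_ext k x x (mv k N x) _ ltac:(easy) (eN x)).
    rewrite dot_sub_r, dot_scale_r. reflexivity. }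
  destruct (@Lyapunov.right_inverse_of_injective k N) as [B hB].
  { intros x ex. apply NNPP. intros nx. apply ne. exists x. split.
    - apply NNPP. intros nz. apply nx. intros i hi. apply NNPP. intros xi.
      apply nz. exists i. now split.
    - intros i hi. specialize (ex i hi). rewrite eN in ex by easy.
      unfold vsub, vzero in ex. lra. }
  destruct (mv_bounded k k B) as [c [c0 hc]].
  assert (psd (s + / (c + 1))) as pp.
  { intros x. pose proof (psd_cauchy_schwarz k N (mv k B x) x sN) as cs.
    assert (forall y, 0 <= qform k N y) as pN.
    { intros y. rewrite qN. specialize (ps y). lra. }
    specialize (cs pN). rewrite symmetric_dot in cs by easy.
    rewrite (dot_ext k (mv k N (mv k B x)) x x x (hB x) ltac:(easy)) in cs.
    rewrite qform_dot in cs.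
    rewrite (dot_ext k (mv k B x) (mv k B x) _ x ltac:(easy) (hB x)) in cs.
    pose proof (dot_le_norm k (mv k B x) x) as h1. specialize (hc x).
    pose proof (vnorm_pos k x). pose proof (vnorm_sqr k x) as e.
    pose proof (dot_self_pos k x) as dp. specialize (pN x).
    assert (dot k (mv k B x) x <= (c + 1) * dot k x x) as h2 by nra.
    assert (dot k x x <= (c + 1) * qform k N x) as h3.
    { destruct (Rle_lt_or_eq_dec _ _ dp) as [p|z]; [|rewrite <- z; nra].
      apply Rmult_le_reg_l with (dot k x x); [easy|]. nra. }
    rewrite qN in h3.
    apply Rmult_le_reg_l with (c + 1); [lra|].
    replace ((c + 1) * ((s + / (c + 1)) * dot k x x))
      with ((c + 1) * (s * dot k x x) + dot k x x) by (field; lra).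
    lra. }
  specialize (ub _ pp). assert (0 < / (c + 1)) by (apply Rinv_0_lt_compat; lra). lra.
Qed.

Lemma max_eigenvalue_bound k M lam v : symmetric k M -> is_max_eigenvalue k M lam ->
  qform k M v <= lam * dot k v v.
Proof.
  intros sM [[w [w0 ew]] maxi].
  assert (forall x, qform k (mscale (-1) M) x = - qform k M x) as q.
  { intros x. rewrite !qform_dot.
    rewrite (dot_ext k x x _ (vscale (-1) (mv k M x)) ltac:(easy)).
    - rewrite dot_scale_r. ring.
    - intros i _. apply mv_mscale. }
  enough (- lam * dot k v v <= qform k (mscale (-1) M) v) by (rewrite q in *; lra).
  apply min_eigenvalue_bound.
  - intros i j hi hj. unfold mscale, mtr. rewrite (sM i j hi hj). reflexivity.
  - split.
    + exists w. split; [easy|]. intros i hi. rewrite mv_mscale, ew by easy.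
      unfold vscale. ring.
    + intros mu [x [x0 ex]]. enough (- mu <= lam) by lra. apply maxi.
      exists x. split; [easy|]. intros i hi. specialize (ex i hi).
      rewrite mv_mscale in ex. unfold vscale in *. lra.
Qed.

(** * Gaps between successful transmissions *)

Lemma lsum_app l l' f : lsum (l ++ l') f = lsum l f + lsum l' f.
Proof. induction l as [|x l IH]; simpl; [ring|rewrite IH; ring]. Qed.

Lemma lsum_plus_const l f c : lsum l (fun i => f i + c) = lsum l f + INR (length l) * c.
Proof.
  induction l as [|x l IH]; [simpl; ring|].
  change (length (x :: l)) with (S (length l)). rewrite S_INR. simpl lsum. rewrite IH. ring.
Qed.

Lemma lsum_le l f g : (forall i, In i l -> f i <= g i) -> lsum l f <= lsum l g.
Proof.
  induction l as [|x l IH]; intros e; simpl; [lra|].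
  apply Rplus_le_compat; [apply e; now left|apply IH; intros; apply e; now right].
Qed.

(** The condition inside [in_dos] for a single period. The point [hs k] counts even when the
    duration is zero, so an instantaneous transition can block an attempt. *)
Definition in_period (hs taus : nat -> R) (k : nat) (t : R) : Prop :=
  t = hs k \/ (hs k <= t /\ t < hs k + taus k).

Section Gap.
Variables (dom : nat -> Prop) (hs taus : nat -> R) (eta tauD kappa T Delta : R).
Hypothesis sig : dos_signal dom hs taus.
Hypothesis (tauD0 : 0 < tauD) (T1 : 1 < T) (Delta0 : 0 < Delta).
Hypothesis freq : dos_frequency dom hs eta tauD.
Hypothesis dur : dos_duration dom hs taus kappa T.
Hypothesis slow : 1 / T + Delta / tauD < 1.
Let Q := (kappa + eta * Delta) * / (1 - 1 / T - Delta / tauD).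

Lemma dos_dom_le i j : dom j -> (i <= j)%nat -> dom i.
Proof.
  destruct sig as [down _]. intros dj le. induction le; [easy|]. apply IHle. now apply down.
Qed.

Lemma dos_period_bounds k t : dom k -> in_period hs taus k t -> hs k <= t <= hs k + taus k.
Proof.
  destruct sig as [_ [_ [pos _]]]. intros dk h. specialize (pos k dk).
  destruct h as [->|]; lra.
Qed.

Lemma dos_period_lt i j : dom j -> (i < j)%nat -> hs i + taus i < hs j.
Proof.
  destruct sig as [down [_ [pos step]]]. intros dj lt. induction lt; [now apply step|].
  pose proof (step _ dj). pose proof (pos _ (down _ dj)). specialize (IHlt (down _ dj)). lra.
Qed.

Lemma dos_hs_le i j : dom j -> (i <= j)%nat -> hs i <= hs j.
Proof.
  destruct sig as [_ [_ [pos _]]]. intros dj le.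
  destruct (Nat.eq_dec i j) as [->|ne]; [lra|].
  pose proof (dos_period_lt i j dj ltac:(lia)).
  pose proof (pos i (dos_dom_le i j dj le)). lra.
Qed.

Lemma dos_hs_nonneg j : dom j -> 0 <= hs j.
Proof.
  intros dj. destruct sig as [_ [h0 _]].
  pose proof (dos_hs_le 0 j dj ltac:(lia)). specialize (h0 (dos_dom_le 0 j dj ltac:(lia))). lra.
Qed.

(** Consecutive failed attempts in periods j and j' are Delta apart, which forces h_{j'} <= h_j +
    tau_j + Delta; chaining these gives the sum. Periods skipped between two attempts only add
    nonnegative terms. *)
Lemma failed_run k n0 N : dom n0 -> in_period hs taus n0 (INR k * Delta) ->
  (forall i, (i <= N)%nat -> in_dos dom hs taus (INR (k + i) * Delta)) ->
  exists j, (n0 <= j)%nat /\ dom j /\ in_period hs taus j (INR (k + N) * Delta) /\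
    hs j - hs n0 <= lsum (seq n0 (j - n0)) (fun i => taus i + Delta).
Proof.
  intros d0 p0. induction N as [|N IH]; intros fail.
  - exists n0. rewrite Nat.add_0_r, Nat.sub_diag. simpl. repeat split; try easy. lra.
  - destruct IH as [j [le [dj [pj hj]]]]; [intros; apply fail; lia|].
    destruct (fail (S N) ltac:(lia)) as [j' [dj' pj']].
    change (in_period hs taus j' (INR (k + S N) * Delta)) in pj'.
    pose proof (dos_period_bounds _ _ dj pj) as bj.
    pose proof (dos_period_bounds _ _ dj' pj') as bj'.
    assert (INR (k + S N) * Delta = INR (k + N) * Delta + Delta) as eN.
    { rewrite Nat.add_succ_r, S_INR. ring. }
    assert (j <= j')%nat as lejj.
    { destruct (Nat.le_gt_cases j j') as [|lt]; [easy|].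
      pose proof (dos_period_lt j' j dj lt). lra. }
    exists j'. split; [lia|]. split; [easy|]. split; [easy|].
    destruct (Nat.eq_dec j j') as [<-|ne]; [easy|].
    replace (j' - n0)%nat with ((j - n0) + S (j' - S j))%nat by lia.
    rewrite seq_app, lsum_app. replace (n0 + (j - n0))%nat with j by lia.
    simpl. destruct sig as [_ [_ [pos _]]].
    assert (0 <= lsum (seq (S j) (j' - S j)) (fun i => taus i + Delta)).
    { replace 0 with (lsum (seq (S j) (j' - S j)) (fun _ => 0)).
      - apply lsum_le. intros i hi. apply in_seq in hi.
        pose proof (pos i (dos_dom_le i j' dj' ltac:(lia))). lra.
      - generalize (seq (S j) (j' - S j)). intros l; induction l; simpl; lra. }
    lra.
Qed.

(* Enlarging each period by Delta covers the whole run, as an attempt is made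
   every Delta; the frequency and duration bounds then limit its length. *)
Lemma failed_run_length k N :
  (forall i, (i <= N)%nat -> in_dos dom hs taus (INR (k + i) * Delta)) ->
  INR (k + N) * Delta + Delta <= INR k * Delta + Q.
Proof.
  intros fail. destruct (fail 0%nat ltac:(lia)) as [n0 [d0 p0]].
  rewrite Nat.add_0_r in p0. change (in_period hs taus n0 (INR k * Delta)) in p0.
  destruct (failed_run k n0 N d0 p0 fail) as [j [le [dj [pj hj]]]].
  pose proof (dos_period_bounds _ _ d0 p0) as b0.
  pose proof (dos_period_bounds _ _ dj pj) as bj.
  pose proof (dos_hs_le n0 j dj le) as hle. pose proof (dos_hs_nonneg n0 d0) as h0.
  (* Ending the window one step after the last failed attempt puts h_j strictly inside the half-open
     interval that counts transitions, and t1 - h_{n0} becomes at most the DoS time plus Delta per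
     period. *)
  set (t1 := INR (k + N) * Delta + Delta) in *.
  set (l := seq n0 (S (j - n0))).
  assert (NoDup l) as nd by apply seq_NoDup.
  assert (forall i, In i l -> (n0 <= i <= j)%nat) as inl.
  { intros i hi. apply in_seq in hi. lia. }
  pose proof (freq (hs n0) t1 ltac:(unfold t1; lra) l nd) as f.
  pose proof (dur (hs n0) t1 ltac:(unfold t1; lra) l nd) as du.
  assert (INR (length l) <= eta + (t1 - hs n0) / tauD) as f'.
  { apply f. intros i hi. apply inl in hi.
    pose proof (dos_hs_le n0 i (dos_dom_le i j dj ltac:(lia)) ltac:(lia)).
    pose proof (dos_hs_le i j dj ltac:(lia)).
    split; [apply (dos_dom_le i j); easy|]. unfold t1; lra. }
  assert (lsum l (dos_piece_len hs taus (hs n0) t1) <= kappa + (t1 - hs n0) / T) as du'.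
  { apply du. intros i hi. apply inl in hi. apply (dos_dom_le i j); easy. }
  clear f du.
  unfold l in du'. rewrite seq_S, lsum_app in du'.
  replace (n0 + (j - n0))%nat with j in du' by lia. simpl in du'.
  assert (lsum (seq n0 (j - n0)) taus <=
          lsum (seq n0 (j - n0)) (dos_piece_len hs taus (hs n0) t1)) as l1.
  { apply lsum_le. intros i hi. apply in_seq in hi. unfold dos_piece_len.
    pose proof (dos_period_lt i j dj ltac:(lia)).
    pose proof (dos_hs_le n0 i (dos_dom_le i j dj ltac:(lia)) ltac:(lia)).
    rewrite (Rmin_left (hs i + taus i) t1) by (unfold t1; lra).
    rewrite (Rmax_left (hs i) (hs n0)) by lra.
    eapply Rle_trans; [|apply Rmax_r]. lra. }
  assert (INR (k + N) * Delta - hs j <= dos_piece_len hs taus (hs n0) t1 j) as l2.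
  { unfold dos_piece_len. rewrite (Rmax_left (hs j) (hs n0)) by lra.
    eapply Rle_trans; [|apply Rmax_r].
    assert (INR (k + N) * Delta <= Rmin (hs j + taus j) t1).
    { apply Rmin_glb; unfold t1; lra. } lra. }
  rewrite lsum_plus_const, length_seq in hj.
  unfold l in f'. rewrite length_seq, S_INR in f'.
  assert (Delta * (INR (j - n0) + 1) <= Delta * (eta + (t1 - hs n0) / tauD)) as f2
    by (apply Rmult_le_compat_l; lra).
  assert ((t1 - hs n0) * (1 - 1 / T - Delta / tauD) <= kappa + eta * Delta) as main.
  { replace ((t1 - hs n0) * (1 - 1 / T - Delta / tauD))
      with (t1 - hs n0 - (t1 - hs n0) / T - Delta * ((t1 - hs n0) / tauD)) by (field; lra).
    unfold t1 in *. lra. }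
  assert (t1 - hs n0 <= Q).
  { unfold Q. apply Rmult_le_reg_r with (1 - 1 / T - Delta / tauD); [lra|].
    rewrite Rmult_assoc, Rinv_l by lra. lra. }
  lra.
Qed.

(** If every attempt within Q of attempt k failed, [failed_run_length] would place the following
    attempt within Q as well; the run would never end, against its bounded length. *)
Lemma success_within k : 0 <= kappa -> 0 <= eta ->
  exists j, (k <= j)%nat /\ success dom hs taus Delta (INR j * Delta) /\
    INR j * Delta <= INR k * Delta + Q.
Proof.
  intros k0 e0. apply NNPP. intros no.
  assert (0 <= Q) as Q0.
  { unfold Q. apply Rmult_le_pos; [nra|]. left. apply Rinv_0_lt_compat. lra. }
  assert (forall j, (k <= j)%nat -> INR j * Delta <= INR k * Delta + Q ->
            in_dos dom hs taus (INR j * Delta)) as fail.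
  { intros j le lej. apply NNPP. intros nd. apply no. exists j.
    split; [easy|]. split; [|easy]. exists j. now split. }
  assert (forall N i, (i <= N)%nat -> in_dos dom hs taus (INR (k + i) * Delta)) as all.
  { induction N as [|N IH]; intros i hi.
    - replace i with 0%nat by lia. apply fail; [lia|]. rewrite Nat.add_0_r. lra.
    - destruct (Nat.eq_dec i (S N)) as [->|]; [|apply IH; lia].
      apply fail; [lia|]. pose proof (failed_run_length k N IH).
      rewrite Nat.add_succ_r, S_INR. lra. }
  destruct (INR_archimed Delta (Q + 1) Delta0) as [N hN].
  pose proof (failed_run_length k N (all N)) as h. rewrite plus_INR in h. lra.
Qed.
End Gap.

(** * Differential inequalities *)

Definition cont_on_nonneg (F : R -> R) : Prop :=
  forall t, 0 <= t -> forall eps, 0 < eps -> exists del, 0 < del /\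
    forall s, 0 <= s -> Rabs (s - t) < del -> Rabs (F s - F t) < eps.

Lemma cont_on_nonneg_minus F G :
  cont_on_nonneg F -> cont_on_nonneg G -> cont_on_nonneg (fun t => F t - G t).
Proof.
  intros cF cG t t0 eps e0.
  destruct (cF t t0 (eps / 2) ltac:(lra)) as [d1 [d10 h1]].
  destruct (cG t t0 (eps / 2) ltac:(lra)) as [d2 [d20 h2]].
  exists (Rmin d1 d2). split; [now apply Rmin_glb_lt|]. intros s s0 hs.
  specialize (h1 s s0 (Rlt_le_trans _ _ _ hs (Rmin_l _ _))).
  specialize (h2 s s0 (Rlt_le_trans _ _ _ hs (Rmin_r _ _))).
  replace (F s - G s - (F t - G t)) with ((F s - F t) + - (G s - G t)) by ring.
  eapply Rle_lt_trans; [apply Rabs_triang|]. rewrite Rabs_Ropp. lra.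
Qed.

Lemma derivable_cont_on_nonneg F F' :
  (forall t, derivable_pt_lim F t (F' t)) -> cont_on_nonneg F.
Proof.
  intros d t _ eps e0.
  assert (continuity_pt F t) as c by (apply derivable_continuous_pt; exists (F' t); apply d).
  destruct (c eps e0) as [del [del0 h]]. exists del. split; [easy|]. intros s _ hs.
  destruct (Req_dec s t) as [->|ne].
  - replace (F t - F t) with 0 by ring. now rewrite Rabs_R0.
  - apply h. split; [split; [exact I|auto]|easy].
Qed.

(** Continuous induction on the largest initial segment where g <= 0. At its end g <= 0 by
    continuity; a negative value extends further by continuity, a zero by the hypothesis on contact
    points. *)
Lemma nonpos_of_no_upcrossing g a b : 0 <= a -> cont_on_nonneg g -> g a <= 0 ->
  (forall t, a <= t < b -> g t = 0 ->
     exists del, 0 < del /\ forall s, 0 < s < del -> g (t + s) <= 0) ->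
  forall t, a <= t <= b -> g t <= 0.
Proof.
  intros a0 cg ga up t ht. destruct (Rle_lt_dec (g t) 0) as [|gt]; [easy|]. exfalso.
  pose (E := fun s => a <= s <= t /\ forall r, a <= r <= s -> g r <= 0).
  assert (E a) as Ea by (split; [lra|intros r hr; replace r with a by lra; easy]).
  assert (bound E) as bE by (exists t; intros s [hs _]; lra).
  destruct (completeness E bE (ex_intro _ _ Ea)) as [m [ub lub]].
  pose proof (ub a Ea) as am.
  assert (m <= t) as mt by (apply lub; intros s [hs _]; lra).
  assert (forall r, a <= r < m -> g r <= 0) as below.
  { intros r hr. apply NNPP. intros ng. assert (m <= r); [|lra].
    apply lub. intros s [hs hE]. destruct (Rle_lt_dec s r) as [|lt]; [easy|].
    exfalso. apply ng. apply hE. lra. }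
  assert (g m <= 0) as gm.
  { destruct (Rle_lt_dec (g m) 0) as [|gmp]; [easy|]. exfalso.
    destruct (cg m ltac:(lra) (g m) gmp) as [del [del0 h]].
    destruct (Req_dec m a) as [->|ne]; [lra|].
    set (r := Rmax a (m - del / 2)).
    assert (a <= r) by apply Rmax_l.
    assert (m - del / 2 <= r) by apply Rmax_r.
    assert (r < m) by (unfold r; apply Rmax_lub_lt; lra).
    specialize (h r ltac:(lra) ltac:(rewrite Rabs_left; lra)).
    specialize (below r ltac:(lra)). apply Rabs_def2 in h. lra. }
  assert (m < t) as mlt.
  { destruct (Req_dec m t) as [->|]; lra. }
  assert (exists del, 0 < del /\ forall s, 0 < s < del -> g (m + s) <= 0) as [del [del0 h]].
  { destruct (Req_dec (g m) 0) as [z|nz]; [apply up; lra|].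
    destruct (cg m ltac:(lra) (- g m) ltac:(lra)) as [del [del0 h]].
    exists del. split; [easy|]. intros s hs.
    specialize (h (m + s) ltac:(lra) ltac:(rewrite Rabs_right; lra)).
    apply Rabs_def2 in h. lra. }
  set (q := Rmin (m + del / 2) t).
  assert (q <= m + del / 2) by apply Rmin_l. assert (q <= t) by apply Rmin_r.
  assert (m < q) by (unfold q; apply Rmin_glb_lt; lra).
  assert (E q) as Eq.
  { split; [lra|]. intros r hr. destruct (Rtotal_order r m) as [lt|[->|gt']].
    - apply below; lra.
    - easy.
    - replace r with (m + (r - m)) by ring. apply h. lra. }
  specialize (ub q Eq). lra.
Qed.

(** Holds for every l above the upper right Dini derivative of F at t, whether or not F is
    differentiable there. *)
Definition right_slope_le (F : R -> R) (t l : R) : Prop :=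
  exists del, 0 < del /\ forall s, 0 < s < del -> F (t + s) <= F t + l * s.

(* Only a strict slope inequality at the contact points is needed, so that one-sided Dini bounds
   suffice for the merely continuous F. *)
Lemma barrier F U U' a b : 0 <= a -> cont_on_nonneg F ->
  (forall t, derivable_pt_lim U t (U' t)) -> F a <= U a ->
  (forall t, a <= t < b -> F t = U t -> exists l, l < U' t /\ right_slope_le F t l) ->
  forall t, a <= t <= b -> F t <= U t.
Proof.
  intros a0 cF dU Fa sl t ht. enough (F t - U t <= 0) by lra.
  apply (nonpos_of_no_upcrossing (fun t => F t - U t) a b); try easy.
  - apply cont_on_nonneg_minus; [easy|]. eapply derivable_cont_on_nonneg; apply dU.
  - lra.
  - intros r hr e. destruct (sl r hr ltac:(lra)) as [l [lU [d1 [d10 h1]]]].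
    destruct (dU r (U' r - l) ltac:(lra)) as [d2 h2].
    exists (Rmin d1 d2). split; [apply Rmin_glb_lt; [easy|apply cond_pos]|].
    intros s hs. pose proof (Rmin_l d1 d2). pose proof (Rmin_r d1 d2).
    specialize (h1 s ltac:(lra)).
    specialize (h2 s ltac:(lra) ltac:(rewrite Rabs_right; lra)).
    apply Rabs_def2 in h2. destruct h2 as [_ h2].
    assert (l < (U (r + s) - U r) / s) as h3 by lra.
    apply Rmult_lt_compat_r with (r := s) in h3; [|lra].
    unfold Rdiv in h3. rewrite Rmult_assoc, Rinv_l in h3 by lra. lra.
Qed.

Lemma exp_le_compat x y : x <= y -> exp x <= exp y.
Proof. intros [lt| ->]; [left; now apply exp_increasing|lra]. Qed.

Lemma exp_ge_1 x : 0 <= x -> 1 <= exp x.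
Proof. intros h. rewrite <- exp_0. now apply exp_le_compat. Qed.

(** The barrier U satisfies U' >= lam U + k because the exponential is at least 1 after o, and k0 <
    k gives strictness. The origin o may precede a, so that successive sampling steps continue one
    barrier; at a contact point F is known to be as large as U, which [V_growth] exploits. *)
Lemma growth_comparison F o a b lam k0 k F0 : 0 <= a -> o <= a -> 0 <= lam -> 0 <= k0 < k ->
  cont_on_nonneg F -> F a <= exp (lam * (a - o)) * (F0 + k * (a - o)) ->
  (forall t, a <= t < b -> F t = exp (lam * (t - o)) * (F0 + k * (t - o)) ->
     forall l, lam * F t + k0 < l -> right_slope_le F t l) ->
  forall t, a <= t <= b -> F t <= exp (lam * (t - o)) * (F0 + k * (t - o)).
Proof.
  intros a0 oa lam0 hk cF Fa sl.
  apply (barrier F (fun t => exp (lam * (t - o)) * (F0 + k * (t - o)))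
    (fun t => lam * (exp (lam * (t - o)) * (F0 + k * (t - o))) + exp (lam * (t - o)) * k)); try easy.
  - intros t. apply is_derive_Reals. auto_derive; [easy|]. unfold Rminus; ring.
  - intros t ht e. exists (lam * F t + (k0 + k) / 2). split; [|apply sl; lra].
    rewrite e. assert (1 <= exp (lam * (t - o))).
    { apply exp_ge_1. apply Rmult_le_pos; lra. }
    nra.
Qed.

(** The barrier U has U' = - w U + w k (t - a) + k >= - w U + k. Its linear growth is harmless on
    the bounded buffer time. *)
Lemma decay_comparison F a b w k0 k : 0 <= a -> 0 <= w -> 0 <= k0 < k -> cont_on_nonneg F ->
  (forall t, a <= t < b -> forall l, - w * F t + k0 < l -> right_slope_le F t l) ->
  forall t, a <= t <= b -> F t <= exp (- w * (t - a)) * F a + k * (t - a).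
Proof.
  intros a0 w0 hk cF sl.
  apply (barrier F (fun t => exp (- w * (t - a)) * F a + k * (t - a))
    (fun t => - w * (exp (- w * (t - a)) * F a) + k)); try easy.
  - intros t. apply is_derive_Reals. auto_derive; [easy|]. unfold Rminus; ring.
  - replace (- w * (a - a)) with 0 by ring. rewrite exp_0. lra.
  - intros t ht e. exists (- w * F t + (k0 + k) / 2). split; [|apply sl; [easy|lra]].
    rewrite e. assert (0 <= w * (k * (t - a))).
    { repeat apply Rmult_le_pos; lra. } lra.
Qed.

Lemma cont_qform k P f : cont_nonneg k f -> cont_on_nonneg (fun t => qform k P (f t)).
Proof.
  intros cf t t0 eps e0. destruct (mv_bounded k k P) as [C [C0 hC]].
  set (X := vnorm k (f t)). assert (0 <= X) by apply vnorm_pos.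
  set (B := C * (2 * X + 1) + 1). assert (0 < B) by (unfold B; nra).
  assert (0 < Rmin 1 (eps / B)) as m0.
  { apply Rmin_glb_lt; [lra|]. now apply Rdiv_lt_0_compat. }
  destruct (cf t t0 _ m0) as [del [del0 h]]. exists del. split; [easy|].
  intros s s0 hs. specialize (h s s0 hs). set (d := vsub (f s) (f t)) in *.
  set (nd := vnorm k d) in *. assert (0 <= nd) by apply vnorm_pos.
  assert (nd < 1) by (eapply Rlt_le_trans; [apply h|apply Rmin_l]).
  assert (nd * B < eps).
  { apply Rlt_div_r; [easy|]. eapply Rlt_le_trans; [apply h|apply Rmin_r]. }
  rewrite !qform_dot.
  rewrite (dot_ext k (f s) (vadd (f t) d) (mv k P (f s)) (vadd (mv k P (f t)) (mv k P d))).
  2: intros i _; unfold vadd, d, vsub; ring.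
  2: { intros i _. unfold vadd at 1. rewrite <- mv_vadd. apply mv_ext.
       intros j _; unfold vadd, d, vsub; ring. }
  rewrite !dot_add_r, !dot_add_l.
  pose proof (dot_cauchy_schwarz k (f t) (mv k P d)) as h1.
  pose proof (dot_cauchy_schwarz k d (mv k P d)) as h2.
  pose proof (dot_cauchy_schwarz k d (mv k P (f t))) as h3.
  pose proof (hC d) as c1. pose proof (hC (f t)) as c2. fold X nd in h1, h2, h3, c1, c2.
  set (y1 := dot k (f t) (mv k P d)) in *. set (y2 := dot k d (mv k P d)) in *.
  set (y3 := dot k d (mv k P (f t))) in *.
  assert (X * vnorm k (mv k P d) <= X * (C * nd)) by (apply Rmult_le_compat_l; easy).
  assert (nd * vnorm k (mv k P d) <= nd * (C * nd)) by (apply Rmult_le_compat_l; easy).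
  assert (nd * vnorm k (mv k P (f t)) <= nd * (C * X)) by (apply Rmult_le_compat_l; easy).
  assert (nd * (C * nd) <= nd * C) by (assert (0 <= nd * C) by (apply Rmult_le_pos; easy); nra).
  replace (_ - _) with (y3 + y1 + y2) by ring.
  eapply Rle_lt_trans; [apply Rabs_triang|].
  pose proof (Rabs_triang y3 y1). unfold B in *. nra.
Qed.

(** Stands for x' = f + d with |d| <= c when d is known only through the increments of a primitive;
    c = 0 is an ordinary right derivative. *)
Definition right_deriv_within (k : nat) (x : R -> vec) (t : R) (f : vec) (c : R) : Prop :=
  forall eps, 0 < eps -> exists del, 0 < del /\ forall s, 0 < s < del ->
    vnorm k (vsub (vsub (x (t + s)) (x t)) (vscale s f)) <= (c + eps) * s.

Lemma qform_right_slope k P x t f c l : symmetric k P -> 0 <= c ->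
  right_deriv_within k x t f c ->
  2 * dot k (mv k P (x t)) f + 2 * c * vnorm k (mv k P (x t)) < l ->
  right_slope_le (fun s => qform k P (x s)) t l.
Proof.
  intros sP c0 rd hl. destruct (mv_bounded k k P) as [C [C0 hC]].
  set (p := mv k P (x t)) in *. set (np := vnorm k p) in *.
  assert (0 <= np) by apply vnorm_pos.
  (* The slack g is split in two: eps keeps the derivative error below g / 2, and a small s does the
     same for the quadratic term of the expansion. *)
  set (g := l - (2 * dot k p f + 2 * c * np)). assert (0 < g) by (unfold g; lra).
  set (eps := Rmin 1 (g / (4 * (np + 1)))).
  assert (0 < eps) as e0.
  { unfold eps. apply Rmin_glb_lt; [lra|]. apply Rdiv_lt_0_compat; lra. }
  assert (eps <= 1) by apply Rmin_l.
  assert (np * eps <= g / 4).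
  { assert (eps * (4 * (np + 1)) <= g); [|nra].
    apply Rle_div_r; [lra|]. apply Rmin_r. }
  destruct (rd eps e0) as [del [del0 h]].
  set (F := vnorm k f). assert (0 <= F) by apply vnorm_pos.
  set (B := C * (F + c + 1) ^ 2 + 1). assert (0 < B).
  { unfold B. assert (0 <= (F + c + 1) ^ 2) by apply pow2_ge_0. nra. }
  exists (Rmin del (g / (2 * B))). split.
  { apply Rmin_glb_lt; [easy|]. apply Rdiv_lt_0_compat; lra. }
  intros s hs. pose proof (Rmin_l del (g / (2 * B))). pose proof (Rmin_r del (g / (2 * B))).
  specialize (h s ltac:(lra)).
  set (d := vsub (x (t + s)) (x t)) in *. set (r := vsub d (vscale s f)) in *.
  assert (s * (2 * B) < g) as sB by (apply Rlt_div_r; lra).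
  assert (qform k P (x (t + s)) = qform k P (x t) + 2 * dot k p d + dot k d (mv k P d)) as q.
  { rewrite !qform_dot.
    rewrite (dot_ext k (x (t + s)) (vadd (x t) d) (mv k P (x (t + s))) (vadd p (mv k P d))).
    - rewrite !dot_add_r, !dot_add_l, (symmetric_dot k P (x t) d sP).
      fold p. rewrite (dot_comm k d p). ring.
    - intros i _; unfold vadd, d, vsub; ring.
    - intros i _. unfold p, vadd at 1. rewrite <- mv_vadd. apply mv_ext.
      intros j _; unfold vadd, d, vsub; ring. }
  assert (dot k p d = s * dot k p f + dot k p r) as pd.
  { unfold r. rewrite dot_sub_r, dot_scale_r. ring. }
  pose proof (dot_le_norm k p r) as pr. fold np in pr.
  assert (vnorm k d <= s * (F + c + 1)) as dn.
  { pose proof (vnorm_le_sub k d (vscale s f)) as h1. fold r in h1.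
    rewrite vnorm_scale, Rabs_right in h1 by lra. fold F in h1. nra. }
  pose proof (dot_le_norm k d (mv k P d)) as dd. specialize (hC d).
  pose proof (vnorm_pos k d) as dp.
  assert (dot k d (mv k P d) <= C * vnorm k d ^ 2) as dd2 by nra.
  assert (vnorm k d ^ 2 <= (s * (F + c + 1)) ^ 2) as dd3.
  { apply pow_incr. lra. }
  assert (C * vnorm k d ^ 2 <= C * (s * (F + c + 1)) ^ 2) as dd4
    by (apply Rmult_le_compat_l; easy).
  assert (C * (s * (F + c + 1)) ^ 2 <= s * (s * B)) as dd5.
  { unfold B. replace (C * (s * (F + c + 1)) ^ 2) with (s * s * (C * (F + c + 1) ^ 2)) by ring.
    nra. }
  assert (s * (s * B) <= s * (g / 2)) as dd6 by (apply Rmult_le_compat_l; lra).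
  assert (np * vnorm k r <= np * ((c + eps) * s)) as pr2 by (apply Rmult_le_compat_l; easy).
  assert (np * eps * s <= g / 4 * s) as pr3 by (apply Rmult_le_compat_r; lra).
  cbv beta. rewrite q, pd. unfold g in *. nra.
Qed.

(** * The sampled-data model *)

Definition msum_norm (n : nat) (A : mat) : R := fsum n (fun i => fsum n (fun j => Rabs (A i j))).

(** [mpow] multiplies on the right; the derivative A e^{tA} and the entrywise bound need the new
    factor on the left. *)
Lemma mm_mpow n A p i j : (i < n)%nat -> (j < n)%nat ->
  mpow n A (S p) i j = mm n A (mpow n A p) i j.
Proof.
  revert i j. induction p as [|p IH]; intros i j hi hj.
  - simpl. transitivity (A i j).
    + exact (mid_mv n (fun l => A l j) i hi).
    + unfold mm. rewrite (fsum_ext n _ (fun l => mid j l * A i l)).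
      * symmetry. exact (mid_mv n (A i) j hj).
      * intros l hl. unfold mid. rewrite (Nat.eqb_sym l j). ring.
  - change (mpow n A (S (S p)) i j) with (fsum n (fun l => mpow n A (S p) i l * A l j)).
    rewrite (fsum_ext n _ (fun l => fsum n (fun q => A i q * (mpow n A p q l * A l j)))).
    + rewrite fsum_exchange. apply fsum_ext. intros q hq.
      rewrite fsum_scal. reflexivity.
    + intros l hl. rewrite IH by easy. unfold mm.
      rewrite Rmult_comm, <- fsum_scal. apply fsum_ext. intros; ring.
Qed.

(** Adding 1 keeps the base positive, so that the ratio test in [exp_coef_radius] meets no zero
    coefficient. *)
Lemma mpow_bound n A p i j : (i < n)%nat -> (j < n)%nat ->
  Rabs (mpow n A p i j) <= (msum_norm n A + 1) ^ p.
Proof.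
  assert (0 <= msum_norm n A) as c0.
  { unfold msum_norm. rewrite <- (fsum_zero n). apply fsum_le. intros.
    rewrite <- (fsum_zero n). apply fsum_le. intros. apply Rabs_pos. }
  revert i j. induction p as [|p IH]; intros i j hi hj.
  - simpl. unfold mid. destruct (Nat.eqb i j); [rewrite Rabs_R1|rewrite Rabs_R0]; lra.
  - rewrite mm_mpow by easy. unfold mm. simpl.
    apply Rle_trans with (fsum n (fun l => Rabs (A i l)) * (msum_norm n A + 1) ^ p).
    + clear c0. assert (forall k, (k <= n)%nat ->
        Rabs (fsum k (fun l => A i l * mpow n A p l j)) <=
        fsum k (fun l => Rabs (A i l)) * (msum_norm n A + 1) ^ p) as h; [|apply h; lia].
      induction k as [|k IHk]; intros hk; simpl; [rewrite Rabs_R0; lra|].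
      eapply Rle_trans; [apply Rabs_triang|]. rewrite Rabs_mult, Rmult_plus_distr_r.
      apply Rplus_le_compat; [apply IHk; lia|].
      apply Rmult_le_compat_l; [apply Rabs_pos|]. apply IH; [lia|easy].
    + apply Rmult_le_compat_r; [apply pow_le; lra|].
      eapply Rle_trans; [apply (fsum_term_le n (fun i => fsum n (fun l => Rabs (A i l))) i)|].
      * intros k _. rewrite <- (fsum_zero n). apply fsum_le. intros. apply Rabs_pos.
      * easy.
      * unfold msum_norm. lra.
Qed.

Definition exp_coef (n : nat) (A : mat) (i j p : nat) : R := mpow n A p i j / INR (fact p).

Lemma exp_coef_radius n A i j : (i < n)%nat -> (j < n)%nat ->
  CV_radius (exp_coef n A i j) = p_infty.
Proof.
  intros hi hj. pose (c := msum_norm n A + 1).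
  assert (0 < c) as c0.
  { unfold c, msum_norm.
    assert (0 <= fsum n (fun i => fsum n (fun j => Rabs (A i j)))); [|lra].
    rewrite <- (fsum_zero n). apply fsum_le. intros.
    rewrite <- (fsum_zero n). apply fsum_le. intros. apply Rabs_pos. }
  assert (CV_radius (fun p => c ^ p / INR (fact p)) = p_infty) as h.
  { apply CV_radius_infinite_DAlembert.
    - intros p. apply Rgt_not_eq, Rdiv_lt_0_compat; [now apply pow_lt|apply INR_fact_lt_0].
    - apply is_lim_seq_ext with (fun p => c * / INR (S p)).
      + intros p. rewrite Rabs_right.
        * rewrite fact_simpl, mult_INR. simpl pow. field.
          repeat split; try apply not_0_INR; try apply fact_neq_0; try lia.
          apply pow_nonzero; lra.
        * apply Rle_ge. left. apply Rdiv_lt_0_compat;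
            apply Rdiv_lt_0_compat; try apply pow_lt; try apply INR_fact_lt_0; easy.
      + replace (Finite 0) with (Rbar_mult c 0) by (simpl; f_equal; ring).
        apply is_lim_seq_scal_l. apply (is_lim_seq_incr_1 (fun p => / INR p)).
        replace (Finite 0) with (Rbar_inv p_infty) by reflexivity.
        apply is_lim_seq_inv; [apply is_lim_seq_INR|easy]. }
  assert (Rbar_le (CV_radius (fun p => c ^ p / INR (fact p))) (CV_radius (exp_coef n A i j))) as le.
  { destruct (CV_radius_bounded (fun p => c ^ p / INR (fact p))) as [_ least].
    destruct (CV_radius_bounded (exp_coef n A i j)) as [upper _].
    apply least. intros r [M hM]. apply upper. exists M. intros p.
    eapply Rle_trans; [|apply hM]. unfold exp_coef, Rdiv. rewrite !Rabs_mult.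
    apply Rmult_le_compat_r; [apply Rabs_pos|].
    apply Rmult_le_compat_r; [apply Rabs_pos|].
    rewrite (Rabs_right (c ^ p)) by (apply Rle_ge, pow_le; lra).
    now apply mpow_bound. }
  rewrite h in le. destruct (CV_radius (exp_coef n A i j)); simpl in le; easy.
Qed.

(** [series_sum] is a choice of limit; convergence identifies it with the power series, which can
    then be differentiated termwise. *)
Lemma expm_PSeries n A t i j : (i < n)%nat -> (j < n)%nat ->
  expm n A t i j = PSeries (exp_coef n A i j) t.
Proof.
  intros hi hj. unfold expm, series_sum.
  assert (infinite_sum (fun p => mpow n A p i j * t ^ p / INR (fact p))
            (PSeries (exp_coef n A i j) t)) as h.
  { apply is_series_Reals. apply is_series_ext with (fun p => exp_coef n A i j p * t ^ p).
    - assert (forall p, exp_coef n A i j p * t ^ p = mpow n A p i j * t ^ p / INR (fact p)) as e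
        by (intros; unfold exp_coef, Rdiv; ring).
      exact e.
    - apply is_pseries_R. apply PSeries_correct. apply CV_radius_inside.
      now rewrite exp_coef_radius. }
  eapply uniqueness_sum; [|exact h].
  apply (epsilon_spec (inhabits 0)
    (fun l => infinite_sum (fun p => mpow n A p i j * t ^ p / INR (fact p)) l)).
  now exists (PSeries (exp_coef n A i j) t).
Qed.

Lemma is_derive_fsum k (f : nat -> R -> R) (g : nat -> R) t :
  (forall i, (i < k)%nat -> is_derive (f i) t (g i)) ->
  is_derive (fun s => fsum k (fun i => f i s)) t (fsum k g).
Proof.
  induction k as [|k IH]; intros h; simpl.
  - apply is_derive_Reals. apply derivable_pt_lim_const.
  - apply (is_derive_plus (V := R_NormedModule)); [apply IH; intros; apply h|apply h]; lia.
Qed.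

Lemma is_derive_expm n A t i j : (i < n)%nat -> (j < n)%nat ->
  is_derive (fun s => expm n A s i j) t (mm n A (expm n A t) i j).
Proof.
  intros hi hj.
  apply is_derive_ext with (PSeries (exp_coef n A i j)).
  { intros s. now rewrite expm_PSeries. }
  replace (mm n A (expm n A t) i j) with (PSeries (PS_derive (exp_coef n A i j)) t).
  { apply is_derive_PSeries. now rewrite exp_coef_radius. }
  unfold mm. rewrite (fsum_ext n _ (fun l => A i l * PSeries (exp_coef n A l j) t)).
  2: intros l hl; now rewrite expm_PSeries.
  transitivity (PSeries (fun p => fsum n (fun l => A i l * exp_coef n A l j p)) t).
  - apply PSeries_ext. intros p. unfold PS_derive, exp_coef.
    rewrite mm_mpow by easy. unfold mm. unfold Rdiv.
    rewrite (Rmult_comm _ (/ INR (fact (S p)))), <- fsum_scal, <- fsum_scal.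
    apply fsum_ext. intros l hl. rewrite fact_simpl, mult_INR. field.
    split; apply not_0_INR; [apply fact_neq_0|lia].
  - assert (forall k, (k <= n)%nat ->
      is_pseries (fun p => fsum k (fun l => A i l * exp_coef n A l j p)) t
        (fsum k (fun l => A i l * PSeries (exp_coef n A l j) t))) as h.
    { induction k as [|k IH]; intros hk; simpl.
      - apply is_pseries_R. apply is_series_ext with (fun _ => 0).
        + assert (forall p, 0 = 0 * t ^ p) as e by (intros; ring). exact e.
        + apply is_series_Reals. intros eps e0. exists 0%nat. intros q _.
          rewrite sum_eq_R0 by easy. unfold R_dist.
          rewrite Rminus_diag, Rabs_R0. easy.
      - apply (is_pseries_plus (V := R_NormedModule)); [apply IH; lia|].
        apply (is_pseries_scal (V := R_NormedModule)); [apply Rmult_comm|].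
        apply PSeries_correct. apply CV_radius_inside. now rewrite exp_coef_radius by lia. }
    apply is_pseries_unique. apply h. lia.
Qed.

Lemma expm_0 n A i j : (i < n)%nat -> (j < n)%nat -> expm n A 0 i j = mid i j.
Proof.
  intros hi hj. rewrite expm_PSeries by easy. rewrite PSeries_0.
  unfold exp_coef. simpl. field.
Qed.

Lemma Defs_RInt_correct f a b : ex_RInt f a b -> RInt f a b = RInt.RInt f a b.
Proof.
  intros h. pose (pr := ex_RInt_Reals_0 _ _ _ h).
  assert (exists v, exists pr : Riemann_integrable f a b, RiemannInt pr = v) as ex
    by (exists (RiemannInt pr), pr; reflexivity).
  destruct (epsilon_spec (inhabits 0)
    (fun v => exists pr : Riemann_integrable f a b, RiemannInt pr = v) ex) as [pr' e].
  unfold RInt. rewrite <- e. symmetry. apply RInt_Reals.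
Qed.

Lemma is_derive_mm_expm n A B t i j : (i < n)%nat ->
  is_derive (fun s => mm n (expm n A s) B i j) t (mm n (mm n A (expm n A t)) B i j).
Proof.
  intros hi. unfold mm at 1 2. apply is_derive_fsum. intros l hl.
  apply is_derive_Reals.
  replace (mm n A (expm n A t) i l * B l j)
    with (mm n A (expm n A t) i l * B l j + expm n A t i l * 0) by ring.
  apply (derivable_pt_lim_mult (fun s => expm n A s i l) (fun _ => B l j)).
  - apply is_derive_Reals. now apply is_derive_expm.
  - apply derivable_pt_lim_const.
Qed.

Lemma is_derive_Bdisc n A B t i j : (i < n)%nat ->
  is_derive (fun s => Bdisc n A B s i j) t (mm n (expm n A t) B i j).
Proof.
  intros hi.
  assert (forall s, continuous (fun tau => mm n (expm n A tau) B i j) s) as c.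
  { intros s. apply (ex_derive_continuous (V := R_NormedModule)).
    exists (mm n (mm n A (expm n A s)) B i j). now apply is_derive_mm_expm. }
  assert (forall s, ex_RInt (fun tau => mm n (expm n A tau) B i j) 0 s) as ex.
  { intros s. apply (ex_RInt_continuous (V := R_CompleteNormedModule)). intros; apply c. }
  apply is_derive_ext with (fun s => RInt.RInt (fun tau => mm n (expm n A tau) B i j) 0 s).
  - intros s. unfold Bdisc. now rewrite Defs_RInt_correct.
  - apply (is_derive_RInt (V := R_CompleteNormedModule)
             (fun tau => mm n (expm n A tau) B i j) _ 0).
    + exists (mkposreal 1 Rlt_0_1). intros s _. apply RInt_correct. apply ex.
    + apply c.
Qed.

Lemma Bdisc_0 n A B i j : Bdisc n A B 0 i j = 0.
Proof.
  unfold Bdisc. rewrite Defs_RInt_correct; [apply (RInt_point (V := R_CompleteNormedModule))|].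
  apply ex_RInt_point.
Qed.

(** Both sides have derivative A e^{tA} B and agree at t = 0. No inverse of A enters, so singular A
    is covered. *)
Lemma Bdisc_identity n A B t i j : (i < n)%nat ->
  mm n A (Bdisc n A B t) i j + B i j = mm n (expm n A t) B i j.
Proof.
  intros hi.
  pose (f := fun s => mm n A (Bdisc n A B s) i j - mm n (expm n A s) B i j).
  assert (forall s, is_derive f s 0) as df.
  { intros s. unfold f.
    replace 0 with (mm n A (mm n (expm n A s) B) i j - mm n (mm n A (expm n A s)) B i j).
    - apply (is_derive_minus (V := R_NormedModule)); [|now apply is_derive_mm_expm].
      unfold mm at 1 3. apply is_derive_fsum. intros l hl.
      apply (is_derive_scal (fun x => Bdisc n A B x l j)). now apply is_derive_Bdisc.
    - apply Rminus_diag_eq. symmetry. exact (mv_mm n n A (expm n A s) (fun l => B l j) i). }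
  assert (f t = f 0) as e.
  { destruct (Rtotal_order 0 t) as [lt|[<-|lt]]; [symmetry| |].
    - apply (eq_is_derive (V := R_NormedModule)); [intros; apply df|easy].
    - reflexivity.
    - apply (eq_is_derive (V := R_NormedModule)); [intros; apply df|easy]. }
  assert (mm n A (Bdisc n A B 0) i j = 0) as e1.
  { unfold mm. rewrite (fsum_ext n _ (fun _ => 0)); [apply fsum_zero|].
    intros l _. rewrite Bdisc_0. ring. }
  assert (mm n (expm n A 0) B i j = B i j) as e2.
  { rewrite <- (mid_mv n (fun l => B l j) i hi). apply fsum_ext. intros l hl.
    now rewrite expm_0. }
  unfold f in e. rewrite e1, e2 in e. lra.
Qed.

(** Interpolates one step of [predict] by a solution of the undisturbed process under the constant
    input w, so that plant and model can be compared in continuous time. *)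
Lemma sampled_model_solution n m A B (a w : vec) : exists psi : R -> vec,
  (forall s, veq n (psi s) (vadd (mv n (Adisc n A s) a) (mv m (Bdisc n A B s) w))) /\
  veq n (psi 0) a /\
  (forall s i, (i < n)%nat ->
     is_derive (fun r => psi r i) s (vadd (mv n A (psi s)) (mv m B w) i)).
Proof.
  exists (fun s => vadd (mv n (Adisc n A s) a) (mv m (Bdisc n A B s) w)).
  split; [intros s i _; reflexivity|]. split.
  - intros i hi. unfold vadd. rewrite <- (Rplus_0_r (a i)). f_equal.
    + transitivity (mv n mid a i); [|now apply mid_mv]. apply fsum_ext. intros l hl.
      unfold Adisc. now rewrite expm_0.
    + unfold mv. rewrite (fsum_ext m _ (fun _ => 0)); [apply fsum_zero|].
      intros l _. rewrite Bdisc_0. ring.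
  - intros s i hi. unfold vadd at 1.
    replace (vadd (mv n A (vadd (mv n (Adisc n A s) a) (mv m (Bdisc n A B s) w))) (mv m B w) i)
      with (mv n (mm n A (expm n A s)) a i + mv m (mm n (expm n A s) B) w i).
    + apply (is_derive_plus (V := R_NormedModule)).
      * apply (is_derive_fsum n (fun l r => Adisc n A r i l * a l)). intros l hl.
        apply (is_derive_ext (fun r => a l * expm n A r i l)); [intros; exact (Rmult_comm _ _)|].
        rewrite Rmult_comm. apply (is_derive_scal (fun r => expm n A r i l)).
        now apply is_derive_expm.
      * apply (is_derive_fsum m (fun l r => Bdisc n A B r i l * w l)). intros l hl.
        apply (is_derive_ext (fun r => w l * Bdisc n A B r i l)); [intros; exact (Rmult_comm _ _)|].
        rewrite Rmult_comm. apply (is_derive_scal (fun r => Bdisc n A B r i l)).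
        now apply is_derive_Bdisc.
    + assert (mv m (mm n (expm n A s) B) w i =
              mv m (mm n A (Bdisc n A B s)) w i + mv m B w i) as e.
      { rewrite <- mv_madd. apply fsum_ext. intros l _. unfold madd.
        now rewrite Bdisc_identity. }
      rewrite e, !mv_mm. unfold vadd at 1. rewrite mv_vadd. unfold Adisc. ring.
Qed.

(** * One-sided derivatives of vector functions *)

Lemma common_radius k (Q : nat -> R -> Prop) :
  (forall i, (i < k)%nat -> exists del, 0 < del /\ forall s, Rabs s < del -> Q i s) ->
  exists del, 0 < del /\ forall s, Rabs s < del -> forall i, (i < k)%nat -> Q i s.
Proof.
  induction k as [|k IH]; intros h.
  - exists 1. split; [lra|]. intros; lia.
  - destruct IH as [d1 [d10 h1]]; [intros; apply h; lia|].
    destruct (h k ltac:(lia)) as [d2 [d20 h2]].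
    exists (Rmin d1 d2). split; [now apply Rmin_glb_lt|]. intros s hs i hi.
    pose proof (Rmin_l d1 d2). pose proof (Rmin_r d1 d2).
    destruct (Nat.eq_dec i k) as [->|]; [apply h2; lra|apply h1; [lra|lia]].
Qed.

Lemma rderiv_of_components k (f : R -> vec) t l :
  (forall i, (i < k)%nat -> is_derive (fun s => f s i) t (l i)) -> rderiv k f t l.
Proof.
  intros d eps e0.
  destruct (common_radius k (fun i s => 0 < s ->
    Rabs ((f (t + s) i - f t i) / s - l i) < eps)) as [del [del0 h]].
  - intros i hi. destruct (proj1 (is_derive_Reals _ _ _) (d i hi) eps e0) as [del hd].
    exists del. split; [apply cond_pos|]. intros s hs s0. apply hd; [lra|easy].
  - exists del. split; [easy|]. intros s hs i hi. apply h; [|easy|lra].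
    rewrite Rabs_right; lra.
Qed.

Lemma cont_of_components k (f : R -> vec) (f' : R -> vec) :
  (forall t i, (i < k)%nat -> is_derive (fun s => f s i) t (f' t i)) -> cont_nonneg k f.
Proof.
  intros d t _ eps e0.
  set (e := eps / (INR k + 1)).
  assert (0 <= INR k) by apply pos_INR.
  assert (0 < e) as e1 by (apply Rdiv_lt_0_compat; lra).
  destruct (common_radius k (fun i s => Rabs (f (t + s) i - f t i) < e)) as [del [del0 h]].
  - intros i hi.
    assert (continuity_pt (fun s => f s i) t) as c.
    { apply derivable_continuous_pt. exists (f' t i). apply is_derive_Reals. now apply d. }
    destruct (c e e1) as [del [del0 hd]]. exists del. split; [easy|]. intros s hs.
    destruct (Req_dec s 0) as [->|ne].
    + rewrite Rplus_0_r, Rminus_diag, Rabs_R0. easy.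
    + apply (hd (t + s)). split; [split; [exact I|lra]|].
      simpl. unfold R_dist. replace (t + s - t) with s by ring. easy.
  - exists del. split; [easy|]. intros s s0 hs.
    apply Rle_lt_trans with (INR k * e).
    + apply vnorm_le_components. intros i hi. left. unfold vsub.
      specialize (h (s - t) hs i hi). cbv beta in h. now replace (t + (s - t)) with s in h by ring.
    + unfold e. apply Rmult_lt_reg_r with (INR k + 1); [lra|].
      replace (INR k * (eps / (INR k + 1)) * (INR k + 1)) with (INR k * eps) by (field; lra). nra.
Qed.

Lemma cont_nonneg_sub k f g :
  cont_nonneg k f -> cont_nonneg k g -> cont_nonneg k (fun t => vsub (f t) (g t)).
Proof.
  intros cf cg t t0 eps e0.
  destruct (cf t t0 (eps / 2) ltac:(lra)) as [d1 [d10 h1]].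
  destruct (cg t t0 (eps / 2) ltac:(lra)) as [d2 [d20 h2]].
  exists (Rmin d1 d2). split; [now apply Rmin_glb_lt|]. intros s s0 hs.
  specialize (h1 s s0 (Rlt_le_trans _ _ _ hs (Rmin_l _ _))).
  specialize (h2 s s0 (Rlt_le_trans _ _ _ hs (Rmin_r _ _))).
  rewrite (vnorm_ext k _ (vsub (vsub (f s) (f t)) (vsub (g s) (g t))))
    by (intros i _; unfold vsub; ring).
  eapply Rle_lt_trans; [apply vnorm_sub|]. lra.
Qed.

Lemma right_deriv_within_sub k x y t f g c c' :
  right_deriv_within k x t f c -> right_deriv_within k y t g c' ->
  right_deriv_within k (fun s => vsub (x s) (y s)) t (vsub f g) (c + c').
Proof.
  intros hx hy eps e0.
  destruct (hx (eps / 2) ltac:(lra)) as [d1 [d10 h1]].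
  destruct (hy (eps / 2) ltac:(lra)) as [d2 [d20 h2]].
  exists (Rmin d1 d2). split; [now apply Rmin_glb_lt|]. intros s hs.
  pose proof (Rmin_l d1 d2). pose proof (Rmin_r d1 d2).
  specialize (h1 s ltac:(lra)). specialize (h2 s ltac:(lra)).
  rewrite (vnorm_ext k _ (vsub (vsub (vsub (x (t + s)) (x t)) (vscale s f))
                              (vsub (vsub (y (t + s)) (y t)) (vscale s g))))
    by (intros i _; unfold vsub, vscale; ring).
  eapply Rle_trans; [apply vnorm_sub|]. nra.
Qed.

Lemma right_deriv_within_ext k x y t f c :
  (forall s, veq k (x s) (y s)) -> right_deriv_within k x t f c -> right_deriv_within k y t f c.
Proof.
  intros e h eps e0. destruct (h eps e0) as [del [del0 hd]]. exists del. split; [easy|].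
  intros s hs. rewrite (vnorm_ext k _ (vsub (vsub (x (t + s)) (x t)) (vscale s f))).
  - now apply hd.
  - intros i hi. unfold vsub. rewrite !e by easy. reflexivity.
Qed.

Lemma right_deriv_within_ext_deriv k x t f g c :
  veq k f g -> right_deriv_within k x t f c -> right_deriv_within k x t g c.
Proof.
  intros e h eps e0. destruct (h eps e0) as [del [del0 hd]]. exists del. split; [easy|].
  intros s hs. rewrite (vnorm_ext k _ (vsub (vsub (x (t + s)) (x t)) (vscale s f))).
  - now apply hd.
  - intros i hi. unfold vsub, vscale. rewrite e by easy. reflexivity.
Qed.

Lemma rderiv_within k x t f : rderiv k x t f -> right_deriv_within k x t f 0.
Proof.
  intros h eps e0. set (e := eps / (INR k + 1)).
  assert (0 <= INR k) by apply pos_INR.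
  assert (0 < e) as e1 by (apply Rdiv_lt_0_compat; lra).
  destruct (h e e1) as [del [del0 hd]]. exists del. split; [easy|]. intros s hs.
  apply Rle_trans with (INR k * (e * s)).
  - apply vnorm_le_components. intros i hi. specialize (hd s hs i hi).
    unfold vsub, vscale.
    replace (x (t + s) i - x t i - s * f i) with (((x (t + s) i - x t i) / s - f i) * s)
      by (field; lra).
    rewrite Rabs_mult, (Rabs_right s) by lra. apply Rmult_le_compat_r; lra.
  - rewrite <- Rmult_assoc. apply Rmult_le_compat_r; [lra|].
    assert (e * (INR k + 1) = eps) by (unfold e; field; lra). lra.
Qed.

Lemma vnorm_neg k u v : vnorm k (vsub (vscale (-1) u) (vscale (-1) v)) = vnorm k (vsub u v).
Proof.
  rewrite (vnorm_sub_sym k u v). apply vnorm_ext. intros i _. unfold vsub, vscale. ring.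
Qed.

(** x is the sum of x - D, which has a right derivative, and of D, whose increments the Lipschitz
    bound controls. *)
Lemma perturbed_right_deriv k (x D : R -> vec) t f c r : 0 < r ->
  rderiv k (fun s => vsub (x s) (D s)) t f ->
  (forall s, 0 < s < r -> vnorm k (vsub (D (t + s)) (D t)) <= c * s) ->
  right_deriv_within k x t f c.
Proof.
  intros r0 hf hD.
  apply right_deriv_within_ext with
    (fun s => vsub (vsub (x s) (D s)) (vscale (-1) (D s))).
  { intros s i _. unfold vsub, vscale. ring. }
  apply right_deriv_within_ext_deriv with (vsub f vzero).
  { intros i _. unfold vsub, vzero. ring. }
  rewrite <- (Rplus_0_l c). apply right_deriv_within_sub; [now apply rderiv_within|].
  intros eps e0. exists r. split; [easy|]. intros s hs.
  rewrite (vnorm_ext k _ (vsub (vscale (-1) (D (t + s))) (vscale (-1) (D t))))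
    by (intros i _; unfold vsub, vscale, vzero; ring).
  rewrite vnorm_neg. specialize (hD s hs). nra.
Qed.

Lemma qform_mid k v : qform k mid v = dot k v v.
Proof. apply dot_ext; [easy|apply mid_mv]. Qed.

Lemma symmetric_mid k : symmetric k mid.
Proof. intros i j _ _. unfold mtr, mid. now rewrite (Nat.eqb_sym i j). Qed.

Lemma norm_sqr_right_slope k x t f c l : 0 <= c -> right_deriv_within k x t f c ->
  2 * dot k (x t) f + 2 * c * vnorm k (x t) < l ->
  right_slope_le (fun s => dot k (x s) (x s)) t l.
Proof.
  intros c0 h hl.
  destruct (qform_right_slope k mid x t f c l (symmetric_mid k) c0 h) as [del [del0 hd]].
  - rewrite (vnorm_ext k _ (x t)) by apply mid_mv.
    rewrite (dot_ext k _ (x t) f f) by (try apply mid_mv; easy). easy.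
  - exists del. split; [easy|]. intros s hs. specialize (hd s hs).
    now rewrite !qform_mid in hd.
Qed.

Lemma cont_norm_sqr k f : cont_nonneg k f -> cont_on_nonneg (fun t => dot k (f t) (f t)).
Proof.
  intros c t t0 eps e0. destruct (cont_qform k mid f c t t0 eps e0) as [del [del0 h]].
  exists del. split; [easy|]. intros s s0 hs. specialize (h s s0 hs). now rewrite !qform_mid in h.
Qed.

(** * Drift of the model within one sampling period *)

Section SampleDrift.
Variables (n m : nat) (A B K : mat) (muA normPhi sigma delta : R).
Hypothesis mu : is_max_eigenvalue n (mscale (1 / 2) (madd A (mtr A))) muA.
Hypothesis nPhi : is_opnorm n n (madd A (mm m B K)) normPhi.
Hypothesis sigma0 : 0 < sigma.
Hypothesis samp_pos :
  0 < muA -> delta <= 1 / muA * ln (sigma / (1 + sigma) * muA / Rmax normPhi 1 + 1).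
Hypothesis samp_neg : muA <= 0 -> delta <= sigma / (1 + sigma) * (1 / Rmax normPhi 1).

(** Only the symmetric part of A contributes: muA is the logarithmic norm of A. *)
Lemma dot_mv_le_mu v : dot n v (mv n A v) <= muA * dot n v v.
Proof.
  assert (symmetric n (mscale (1 / 2) (madd A (mtr A)))) as s.
  { intros i j _ _. unfold mscale, madd, mtr. ring. }
  pose proof (max_eigenvalue_bound n _ muA v s mu) as h. rewrite qform_dot in h.
  rewrite (dot_ext n v v _ (vscale (1 / 2) (vadd (mv n A v) (mv n (mtr A) v)))) in h.
  2: easy.
  2: intros i _; rewrite mv_mscale, mv_madd; reflexivity.
  rewrite dot_scale_r, dot_add_r, (dot_comm n v (mv n (mtr A) v)), <- dot_mv in h. lra.
Qed.

(** The drift phi = psi - a satisfies phi' = A phi + Phi a, so |phi| should stay below |Phi| |a| g,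
    where g' = lam g + 1. The norm is not differentiable at 0, where phi starts; hence squares are
    compared, against a barrier lifted by eta to be positive. *)
Lemma drift_comparison psi a g lam s0 :
  veq n (psi 0) a ->
  (forall s i, (i < n)%nat ->
     is_derive (fun r => psi r i) s (vadd (mv n A (psi s)) (mv m B (mv n K a)) i)) ->
  0 <= lam -> muA <= lam -> (forall s, derivable_pt_lim g s (lam * g s + 1)) -> g 0 = 0 ->
  (forall s, 0 <= s -> 0 <= g s) -> 0 <= s0 ->
  vnorm n (vsub (psi s0) a) <= normPhi * vnorm n a * g s0.
Proof.
  intros e0 de lam0 mulam dg g0 gpos s00.
  set (N := normPhi * vnorm n a).
  assert (0 <= N) as N0.
  { apply Rmult_le_pos; [eapply opnorm_nonneg; apply nPhi|apply vnorm_pos]. }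
  pose (phi := fun s => vsub (psi s) a).
  assert (forall s i, (i < n)%nat ->
     is_derive (fun r => phi r i) s (vadd (mv n A (psi s)) (mv m B (mv n K a)) i)) as dphi.
  { intros s i hi. unfold phi, vsub. rewrite <- (Rminus_0_r (vadd _ _ i)).
    apply (is_derive_minus (V := R_NormedModule)); [now apply de|].
    apply (is_derive_const (V := R_NormedModule)). }
  assert (cont_nonneg n phi) as cphi by (eapply cont_of_components; apply dphi).
  assert (forall eta, 0 < eta ->
    vnorm n (phi s0) <= (N + eta) * g s0 + eta * exp (lam * s0)) as key.
  { intros eta eta0.
    pose (U0 := fun s => (N + eta) * g s + eta * exp (lam * s)).
    assert (forall s, 0 <= s -> 0 < U0 s) as U0p.
    { intros s hs. unfold U0. specialize (gpos s hs).
      assert (0 < exp (lam * s)) by apply exp_pos.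
      assert (0 <= (N + eta) * g s) by (apply Rmult_le_pos; lra).
      assert (0 < eta * exp (lam * s)) by (apply Rmult_lt_0_compat; lra). lra. }
    assert (forall s, derivable_pt_lim U0 s (lam * U0 s + (N + eta))) as dU0.
    { intros s. unfold U0.
      replace (lam * ((N + eta) * g s + eta * exp (lam * s)) + (N + eta))
        with ((N + eta) * (lam * g s + 1) + eta * (lam * exp (lam * s))) by ring.
      apply (derivable_pt_lim_plus (fun s => (N + eta) * g s) (fun s => eta * exp (lam * s))).
      - apply (derivable_pt_lim_scal g). apply dg.
      - apply is_derive_Reals. auto_derive; [easy|]. ring. }
    assert (dot n (phi s0) (phi s0) <= U0 s0 * U0 s0) as h.
    { apply (barrier (fun s => dot n (phi s) (phi s)) (fun s => U0 s * U0 s)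
        (fun s => (lam * U0 s + (N + eta)) * U0 s + U0 s * (lam * U0 s + (N + eta))) 0 s0);
        [lra|now apply cont_norm_sqr| | | |lra].
      - intros s. apply (derivable_pt_lim_mult U0 U0); apply dU0.
      - rewrite (dot_ext n _ vzero _ vzero).
        + rewrite <- vnorm_sqr, vnorm_zero. specialize (U0p 0 ltac:(lra)). nra.
        + intros i hi. unfold phi, vsub. rewrite e0 by easy. unfold vzero. ring.
        + intros i hi. unfold phi, vsub. rewrite e0 by easy. unfold vzero. ring.
      - intros s hs e. specialize (U0p s ltac:(lra)).
        exists (2 * lam * (U0 s * U0 s) + U0 s * (2 * N + eta)). split.
        { assert (0 < U0 s * eta) by (apply Rmult_lt_0_compat; easy). nra. }
        eapply norm_sqr_right_slope; [apply Rle_refl| |].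
        + apply rderiv_within. apply rderiv_of_components. apply dphi.
        + rewrite Rmult_0_r, Rmult_0_l, Rplus_0_r.
          rewrite (dot_ext n (phi s) (phi s) _
            (vadd (mv n A (phi s)) (mv n (madd A (mm m B K)) a))).
          2: easy.
          2: { intros i _. unfold vadd. unfold phi. rewrite mv_vsub, mv_madd, mv_mm. ring. }
          rewrite dot_add_r. pose proof (dot_mv_le_mu (phi s)) as h1.
          pose proof (dot_le_norm n (phi s) (mv n (madd A (mm m B K)) a)) as h2.
          pose proof (opnorm_bound n n _ _ a nPhi) as h3. fold N in h3.
          pose proof (vnorm_sqr n (phi s)) as h4. rewrite e in h4.
          assert (vnorm n (phi s) = U0 s) as h5.
          { pose proof (vnorm_pos n (phi s)). nra. }
          rewrite h5 in h2. rewrite e in h1.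
          assert (U0 s * vnorm n (mv n (madd A (mm m B K)) a) <= U0 s * N)
            by (apply Rmult_le_compat_l; lra).
          assert (muA * (U0 s * U0 s) <= lam * (U0 s * U0 s))
            by (apply Rmult_le_compat_r; nra).
          assert (0 < U0 s * eta) by (apply Rmult_lt_0_compat; easy). nra. }
    apply vnorm_le_sqr; [left; now apply U0p|]. unfold U0 in h |- *. nra. }
  (* This lets eta tend to 0: a positive gap is refuted by eta = gap / (2 c). *)
  apply Rnot_lt_le. intros lt.
  set (gap := vnorm n (vsub (psi s0) a) - N * g s0) in *.
  assert (0 < gap) as gap0 by (unfold gap; lra).
  set (c := g s0 + exp (lam * s0)).
  assert (0 < c).
  { unfold c. pose proof (exp_pos (lam * s0)). specialize (gpos s0 s00). lra. }
  specialize (key (gap / (2 * c)) ltac:(apply Rdiv_lt_0_compat; lra)).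
  assert (gap / (2 * c) * c = gap / 2) as e1 by (field; lra).
  unfold c in e1 at 2. unfold phi, gap in *. nra.
Qed.

(** The sampling condition is the inequality [Rmax normPhi 1] g(delta) <= sigma / (1 + sigma) solved
    for delta, with g as in [drift_comparison]. For muA <= 0 the rate is replaced by 0, so g(s) =
    s. *)
Lemma sample_drift psi a s :
  veq n (psi 0) a ->
  (forall s i, (i < n)%nat ->
     is_derive (fun r => psi r i) s (vadd (mv n A (psi s)) (mv m B (mv n K a)) i)) ->
  0 <= s <= delta -> vnorm n (vsub (psi s) a) <= sigma / (1 + sigma) * vnorm n a.
Proof.
  intros e0 de hs.
  assert (1 <= Rmax normPhi 1) as m1 by apply Rmax_r.
  assert (normPhi <= Rmax normPhi 1) as m2 by apply Rmax_l.
  pose proof (opnorm_nonneg _ _ _ _ nPhi) as n0.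
  pose proof (vnorm_pos n a) as a0.
  set (q := sigma / (1 + sigma)) in *.
  assert (0 < q) as q0 by (apply Rdiv_lt_0_compat; lra).
  enough (exists G, 0 <= G /\ G * Rmax normPhi 1 <= q /\
            vnorm n (vsub (psi s) a) <= normPhi * vnorm n a * G) as [G [G0 [Gq hG]]].
  { eapply Rle_trans; [apply hG|].
    assert (normPhi * G <= q) by nra. nra. }
  destruct (Rlt_le_dec 0 muA) as [mp|mn].
  - exists ((exp (muA * s) - 1) / muA).
    assert (forall r, 0 <= r -> 0 <= (exp (muA * r) - 1) / muA) as pos.
    { intros r hr. apply Rdiv_le_0_compat; [|easy].
      assert (1 <= exp (muA * r)) by (apply exp_ge_1; nra). lra. }
    split; [apply pos; lra|]. split.
    + specialize (samp_pos mp).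
      set (y := q * muA / Rmax normPhi 1) in *.
      assert (0 < y) by (apply Rdiv_lt_0_compat; [nra|lra]).
      assert (exp (muA * s) <= y + 1) as h.
      { rewrite <- (exp_ln (y + 1)) by lra. apply exp_le_compat.
        apply Rle_trans with (muA * (1 / muA * ln (y + 1))).
        - apply Rmult_le_compat_l; lra.
        - right. field. lra. }
      apply Rmult_le_reg_r with (muA / Rmax normPhi 1); [apply Rdiv_lt_0_compat; lra|].
      replace ((exp (muA * s) - 1) / muA * Rmax normPhi 1 * (muA / Rmax normPhi 1))
        with (exp (muA * s) - 1) by (field; lra).
      unfold y in h. unfold Rdiv in *. lra.
    + apply (drift_comparison psi a (fun r => (exp (muA * r) - 1) / muA) muA); try easy; try lra.
      * intros r. apply is_derive_Reals. auto_derive; [easy|]. field. lra.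
      * rewrite Rmult_0_r, exp_0. field. lra.
  - exists s. split; [lra|]. split.
    + specialize (samp_neg mn).
      assert (s <= q * (1 / Rmax normPhi 1)) as h by lra.
      apply Rmult_le_compat_r with (r := Rmax normPhi 1) in h; [|lra].
      replace (q * (1 / Rmax normPhi 1) * Rmax normPhi 1) with q in h by (field; lra). easy.
    + apply (drift_comparison psi a (fun r => r) 0); try easy; try lra.
      intros r. replace (0 * r + 1) with 1 by ring. apply derivable_pt_lim_id.
Qed.
End SampleDrift.

(** * The closed loop between two successful transmissions *)

Lemma sampling_index r d : 0 <= r -> 0 < d -> exists p, INR p * d <= r < INR (S p) * d.
Proof.
  intros r0 d0. destruct (nfloor_ex (r / d)) as [p hp]; [now apply Rdiv_le_0_compat|].
  exists p. rewrite S_INR.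
  assert (r = r / d * d) as e by (field; lra). split; rewrite e; nra.
Qed.

Section ClosedLoop.
Variables (n m : nat) (A B K M P : mat).
Variables (alpha1 alpha2 gamma1 gamma2 muA normPhi sigma Delta delta : R) (h : nat).
Let Phi := madd A (mm m B K).
Hypothesis hur : hurwitz n Phi.
Hypothesis Mpd : pos_def n M.
Hypothesis lyap :
  meq n n (madd (madd (mm n (mtr Phi) P) (mm n P Phi)) M) (fun _ _ => 0).
Hypothesis hal1 : is_min_eigenvalue n P alpha1.
Hypothesis hal2 : is_max_eigenvalue n P alpha2.
Hypothesis hga1 : is_min_eigenvalue n M gamma1.
Hypothesis hga2 : is_opnorm n n (mscale 2 (mm m (mm n P B) K)) gamma2.
Hypothesis hmu : is_max_eigenvalue n (mscale (1 / 2) (madd A (mtr A))) muA.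
Hypothesis hPhi : is_opnorm n n Phi normPhi.
Hypothesis sigma0 : 0 < sigma.
Hypothesis margin : 0 < gamma1 - sigma * gamma2.
Hypothesis delta0 : 0 < delta.
Hypothesis h1 : (1 <= h)%nat.
Hypothesis samp_pos :
  0 < muA -> delta <= 1 / muA * ln (sigma / (1 + sigma) * muA / Rmax normPhi 1 + 1).
Hypothesis samp_neg : muA <= 0 -> delta <= sigma / (1 + sigma) * (1 / Rmax normPhi 1).

Let V v := qform n P v.
Let w1 := (gamma1 - sigma * gamma2) / (2 * alpha2).
Let w2 := gamma2 * (2 + sigma) / alpha1.

Lemma P_pos_def : pos_def n P.
Proof. exact (Lyapunov.lyapunov_pos_def hur Mpd lyap). Qed.

Lemma alpha1_pos : 0 < alpha1.
Proof.
  destruct P_pos_def as [_ pd]. destruct hal1 as [[v [v0 ev]] _].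
  specialize (pd v v0). rewrite qform_dot in pd.
  rewrite (dot_ext n v v _ (vscale alpha1 v) ltac:(easy) ev), dot_scale_r in pd.
  pose proof (vnonzero_dot n v v0). nra.
Qed.

Lemma V_lower v : alpha1 * dot n v v <= V v.
Proof. apply min_eigenvalue_bound; [apply P_pos_def|easy]. Qed.

Lemma V_upper v : V v <= alpha2 * dot n v v.
Proof. apply max_eigenvalue_bound; [apply P_pos_def|easy]. Qed.

Lemma alpha2_pos : 0 < alpha2.
Proof.
  destruct hal1 as [[v [v0 _]] _]. pose proof (V_lower v). pose proof (V_upper v).
  pose proof (vnonzero_dot n v v0). pose proof alpha1_pos. nra.
Qed.

Lemma gamma2_nonneg : 0 <= gamma2.
Proof. eapply opnorm_nonneg; apply hga2. Qed.

Lemma w1_pos : 0 < w1.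
Proof. unfold w1. pose proof alpha2_pos. apply Rdiv_lt_0_compat; lra. Qed.

Lemma w2_nonneg : 0 <= w2.
Proof.
  unfold w2. pose proof alpha1_pos. pose proof gamma2_nonneg.
  apply Rdiv_le_0_compat; [nra|easy].
Qed.

Lemma V_nonneg v : 0 <= V v.
Proof. pose proof (V_lower v). pose proof (dot_self_pos n v). pose proof alpha1_pos. nra. Qed.

Lemma lyapunov_identity v : 2 * dot n (mv n P v) (mv n Phi v) = - qform n M v.
Proof.
  assert (dot n v (mv n (madd (madd (mm n (mtr Phi) P) (mm n P Phi)) M) v) = 0) as e.
  { rewrite (dot_ext n v v _ vzero ltac:(easy)).
    - unfold dot, vzero. rewrite (fsum_ext n _ (fun _ => 0)); [apply fsum_zero|].
      intros; ring.
    - intros i hi. unfold mv, vzero. rewrite (fsum_ext n _ (fun _ => 0)); [apply fsum_zero|].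
      intros j hj. rewrite lyap by easy. ring. }
  rewrite (dot_ext n v v _ (vadd (vadd (mv n (mtr Phi) (mv n P v)) (mv n P (mv n Phi v)))
    (mv n M v)) ltac:(easy)) in e.
  2: { intros i _. unfold vadd. rewrite !mv_madd, !mv_mm. reflexivity. }
  rewrite !dot_add_r, (dot_mv n n v (mtr Phi)) in e.
  change (mtr (mtr Phi)) with Phi in e.
  rewrite (symmetric_dot n P v (mv n Phi v)) in e by apply P_pos_def.
  rewrite (dot_comm n (mv n Phi v)) in e. rewrite qform_dot. lra.
Qed.

(** A v + B K a = Phi v + B K (a - v): the Lyapunov equation handles the first part and gamma2 the
    input error. *)
Lemma V_derivative_bound v a :
  2 * dot n (mv n P v) (vadd (mv n A v) (mv m B (mv n K a))) <=
  - gamma1 * vnorm n v ^ 2 + gamma2 * vnorm n v * vnorm n (vsub a v).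
Proof.
  rewrite (dot_ext n (mv n P v) (mv n P v) _
    (vadd (mv n Phi v) (mv m B (mv n K (vsub a v)))) ltac:(easy)).
  2: { intros i _. unfold vadd, Phi. rewrite mv_madd, mv_mm.
       rewrite (mv_ext m B (mv n K (vsub a v)) (vsub (mv n K a) (mv n K v))).
       - rewrite mv_vsub. ring.
       - intros j _. rewrite mv_vsub. reflexivity. }
  rewrite dot_add_r, Rmult_plus_distr_l, lyapunov_identity.
  destruct Mpd as [sM _].
  pose proof (min_eigenvalue_bound n M gamma1 v sM hga1) as hm.
  rewrite vnorm_sqr.
  assert (2 * dot n (mv n P v) (mv m B (mv n K (vsub a v))) =
          dot n v (mv n (mscale 2 (mm m (mm n P B) K)) (vsub a v))) as e.
  { rewrite <- symmetric_dot by apply P_pos_def. rewrite <- dot_scale_r.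
    apply dot_ext; [easy|]. intros i _. unfold vscale. rewrite mv_mscale, !mv_mm. reflexivity. }
  rewrite e.
  pose proof (dot_le_norm n v (mv n (mscale 2 (mm m (mm n P B) K)) (vsub a v))) as h2.
  pose proof (opnorm_bound n n _ _ (vsub a v) hga2) as h3.
  pose proof (vnorm_pos n v). nra.
Qed.

(** * The interval from one success z to the next success z', with signals at level W *)

Variables (x u D : R -> vec).
Hypothesis xcont : cont_nonneg n x.
Hypothesis xdyn : forall t, 0 <= t ->
  rderiv n (fun s => vsub (x s) (D s)) t (vadd (mv n A (x t)) (mv m B (u t))).
Variables (a0 : vec) (z z' W : R).
Hypothesis z0 : 0 <= z.
Hypothesis W0 : 0 < W.
Hypothesis init : vnorm n (vsub (x z) a0) <= W.
Hypothesis Dlip : forall s t, z <= s <= z' -> z <= t <= z' ->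
  vnorm n (vsub (D t) (D s)) <= W * Rabs (t - s).
Let alpha := predict n m (Adisc n A delta) (Bdisc n A B delta) K a0.
Hypothesis law : forall t (p : nat), z <= t < z' -> INR p * delta <= t - z < INR (S p) * delta ->
  veq m (u t) (mv n K (alpha (Nat.min p (h - 1)))).

Lemma x_right_deriv t a : z <= t < z' -> veq m (u t) (mv n K a) ->
  right_deriv_within n x t (vadd (mv n A (x t)) (mv m B (mv n K a))) W.
Proof.
  intros ht hu. apply right_deriv_within_ext_deriv with (vadd (mv n A (x t)) (mv m B (u t))).
  { intros i _. unfold vadd. f_equal. now apply mv_ext. }
  apply (perturbed_right_deriv n x D t _ W (z' - t)); [lra|apply xdyn; lra|].
  intros s hs. specialize (Dlip t (t + s) ltac:(lra) ltac:(lra)).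
  replace (t + s - t) with s in Dlip by ring. now rewrite Rabs_right in Dlip by lra.
Qed.

(** Chosen from 2 muA |e|^2 + 2 W |e| <= lam |e|^2 + W^2 for an error e driven by a disturbance of
    size W; cE then bounds the error over the buffer time H per unit of W. *)
Let lam := 2 * Rabs muA + 1.
Let H := INR h * delta.
Let cE := exp (lam * H) * (1 + 2 * H).

Definition model_solution (a : vec) (psi : R -> vec) : Prop :=
  veq n (psi 0) a /\
  forall s i, (i < n)%nat ->
    is_derive (fun r => psi r i) s (vadd (mv n A (psi s)) (mv m B (mv n K a)) i).

Lemma H_pos : 0 < H.
Proof. unfold H. apply Rmult_lt_0_compat; [|easy]. apply lt_0_INR. lia. Qed.

(** Starts at W^2, which bounds the squared noise in the packet; the coefficient 2 W^2 exceeds the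
    forcing W^2 strictly, as the comparison requires. *)
Let err t := exp (lam * (t - z)) * (W ^ 2 + 2 * W ^ 2 * (t - z)).

(** Plant and model receive the same input, so it cancels in their difference, which obeys e' = A e
    + d. One barrier [err] with origin z serves all sampling steps. *)
Lemma prediction_error_step p psi t : (p < h)%nat -> model_solution (alpha p) psi ->
  let o := z + INR p * delta in
  dot n (vsub (x o) (psi 0)) (vsub (x o) (psi 0)) <= err o ->
  o <= t <= z + INR (S p) * delta -> t <= z' ->
  dot n (vsub (x t) (psi (t - o))) (vsub (x t) (psi (t - o))) <= err t.
Proof.
  intros hp [_ dpsi] o start ht tz'.
  assert (0 <= lam) as lam0 by (unfold lam; pose proof (Rabs_pos muA); lra).
  assert (0 < W ^ 2) as W2 by nra.
  assert (z <= o) as zo by (unfold o; pose proof (pos_INR p); nra).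
  pose (e := fun r => vsub (x r) (psi (r - o))).
  assert (forall r i, (i < n)%nat -> is_derive (fun r => psi (r - o) i) r
    (vadd (mv n A (psi (r - o))) (mv m B (mv n K (alpha p))) i)) as dsh.
  { intros r i hi.
    pose proof (is_derive_comp (V := R_NormedModule) (fun s => psi s i) (fun r => r - o) r
      _ 1 (dpsi (r - o) i hi)) as d.
    unfold scal in d. simpl in d. unfold mult in d. simpl in d. rewrite Rmult_1_l in d.
    apply d. auto_derive; [easy|ring]. }
  assert (cont_nonneg n e) as ce.
  { apply cont_nonneg_sub; [easy|].
    apply cont_of_components with
      (fun r => vadd (mv n A (psi (r - o))) (mv m B (mv n K (alpha p)))). exact dsh. }
  apply (growth_comparison (fun r => dot n (e r) (e r)) z o t lam (W ^ 2) (2 * W ^ 2) (W ^ 2));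
    try easy; try lra.
  - now apply cont_norm_sqr.
  - unfold e. rewrite Rminus_diag. exact start.
  - intros r hr _ l hl.
    assert (veq m (u r) (mv n K (alpha p))) as hu.
    { replace p with (Nat.min p (h - 1)) by lia. apply law; [lra|unfold o in hr; lra]. }
    eapply norm_sqr_right_slope with (c := W + 0); [lra| |].
    + apply right_deriv_within_sub; [apply (x_right_deriv r _ ltac:(lra) hu)|].
      apply rderiv_within. apply rderiv_of_components. exact (dsh r).
    + fold (e r).
      rewrite (dot_ext n (e r) (e r) _ (mv n A (e r)) ltac:(easy)).
      2: { intros i _. unfold e, vsub at 1. rewrite mv_vsub. unfold vadd. ring. }
      pose proof (dot_mv_le_mu n A muA hmu (e r)) as h2.
      pose proof (Rle_abs muA) as h3. pose proof (dot_self_pos n (e r)) as h4.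
      pose proof (vnorm_sqr n (e r)) as h5. pose proof (vnorm_pos n (e r)) as h6.
      assert (muA * dot n (e r) (e r) <= Rabs muA * dot n (e r) (e r))
        by (apply Rmult_le_compat_r; easy).
      assert (2 * W * vnorm n (e r) <= W ^ 2 + vnorm n (e r) ^ 2)
        by (pose proof (pow2_ge_0 (W - vnorm n (e r))); nra).
      unfold lam in hl. nra.
Qed.

Lemma model_solution_exists a : exists psi, model_solution a psi /\
  veq n (psi delta) (vadd (mv n (Adisc n A delta) a) (mv m (Bdisc n A B delta) (mv n K a))).
Proof.
  destruct (sampled_model_solution n m A B a (mv n K a)) as [psi [e [e0 d]]].
  exists psi. split; [split; easy|apply e].
Qed.

Lemma prediction_error_piece p psi t : (p < h)%nat -> model_solution (alpha p) psi ->
  z + INR p * delta <= t <= z + INR (S p) * delta -> t <= z' ->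
  dot n (vsub (x t) (psi (t - (z + INR p * delta))))
        (vsub (x t) (psi (t - (z + INR p * delta)))) <= err t.
Proof.
  revert psi t. induction p as [|p IH]; intros psi t hp hpsi ht tz'.
  - apply prediction_error_step; try easy. simpl. rewrite Rmult_0_l, Rplus_0_r.
    unfold err. replace (z - z) with 0 by ring. rewrite Rmult_0_r, exp_0.
    rewrite <- vnorm_sqr, (vnorm_ext n _ (vsub (x z) a0)).
    + pose proof (vnorm_pos n (vsub (x z) a0)). nra.
    + intros i hi. destruct hpsi as [e _]. unfold vsub. rewrite e by easy. reflexivity.
  - apply prediction_error_step; try easy.
    (* The model ends step p at [psi' delta], which is the next prediction, so the error passes
       continuously to the next step. *)
    destruct (model_solution_exists (alpha p)) as [psi' [hpsi' e']].
    assert (z + INR (S p) * delta <= z') as le by lra.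
    specialize (IH psi' (z + INR (S p) * delta) ltac:(lia) hpsi').
    replace (z + INR (S p) * delta - (z + INR p * delta)) with delta in IH
      by (rewrite S_INR; ring).
    rewrite (dot_ext n _ (vsub (x (z + INR (S p) * delta)) (psi' delta))
                       _ (vsub (x (z + INR (S p) * delta)) (psi' delta))).
    + apply IH; [|easy]. rewrite S_INR. lra.
    + intros i hi. destruct hpsi as [e _]. unfold vsub. rewrite e, e' by easy. reflexivity.
    + intros i hi. destruct hpsi as [e _]. unfold vsub. rewrite e, e' by easy. reflexivity.
Qed.

Lemma err_bound t : z <= t <= z + H -> err t <= (cE * W) ^ 2.
Proof.
  intros ht. pose proof H_pos as H0.
  assert (0 <= lam) as lam0 by (unfold lam; pose proof (Rabs_pos muA); lra).
  assert (exp (lam * (t - z)) <= exp (lam * H)) as l1.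
  { apply exp_le_compat. apply Rmult_le_compat_l; lra. }
  assert (1 <= exp (lam * H)) as l2 by (apply exp_ge_1; nra).
  assert (1 <= cE) as l3 by (unfold cE; nra).
  assert (0 < W ^ 2) by nra.
  (* Since cE >= 1 it may be squared, which makes the resulting bound on the norm linear in W and
     free of roots. *)
  apply Rle_trans with (cE * W ^ 2).
  - unfold err, cE. pose proof (exp_pos (lam * (t - z))).
    replace (exp (lam * H) * (1 + 2 * H) * W ^ 2)
      with (exp (lam * H) * (W ^ 2 + 2 * W ^ 2 * H)) by ring.
    apply Rmult_le_compat; nra.
  - rewrite Rpow_mult_distr. apply Rmult_le_compat_r; [lra|]. nra.
Qed.

Lemma prediction_error p psi t : (p < h)%nat -> model_solution (alpha p) psi ->
  z + INR p * delta <= t <= z + INR (S p) * delta -> t <= z' ->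
  vnorm n (vsub (x t) (psi (t - (z + INR p * delta)))) <= cE * W.
Proof.
  intros hp hpsi ht tz'.
  assert (INR (S p) * delta <= H) as le.
  { unfold H. apply Rmult_le_compat_r; [lra|]. apply le_INR. lia. }
  assert (0 <= INR p * delta) by (apply Rmult_le_pos; [apply pos_INR|lra]).
  apply vnorm_le_sqr.
  - apply Rmult_le_pos; [|lra]. unfold cE. pose proof H_pos. pose proof (exp_pos (lam * H)). nra.
  - eapply Rle_trans; [now apply prediction_error_piece|]. apply err_bound. lra.
Qed.

(** If the drift q is at most sigma / (1 + sigma) |alpha| and |alpha| <= |psi| + q, then q <= sigma
    |psi|: the fraction in the sampling condition turns a bound relative to the packet entry into
    one relative to the current state. The right endpoint of the step is included, for use at z +
    H. *)
Lemma input_error p t : (p < h)%nat ->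
  z + INR p * delta <= t <= z + INR (S p) * delta -> t <= z' ->
  vnorm n (vsub (alpha p) (x t)) <= sigma * vnorm n (x t) + (1 + sigma) * (cE * W).
Proof.
  intros hp ht tz'. destruct (model_solution_exists (alpha p)) as [psi [hpsi _]].
  pose proof (prediction_error p psi t hp hpsi ht tz') as he.
  set (s := t - (z + INR p * delta)) in *.
  assert (0 <= s <= delta) as hs by (unfold s; rewrite S_INR in ht; lra).
  destruct hpsi as [psi0 dpsi].
  pose proof (sample_drift n m A B K muA normPhi sigma delta hmu hPhi sigma0
    samp_pos samp_neg psi (alpha p) s psi0 dpsi hs) as hd.
  pose proof (vnorm_le_sub n (alpha p) (psi s)) as t1. rewrite vnorm_sub_sym in t1.
  assert (vnorm n (vsub (alpha p) (x t)) <=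
          vnorm n (vsub (psi s) (alpha p)) + vnorm n (vsub (x t) (psi s))) as t2.
  { rewrite (vnorm_ext n _ (vsub (vsub (alpha p) (psi s)) (vsub (x t) (psi s))))
      by (intros i _; unfold vsub; ring).
    rewrite (vnorm_sub_sym n (psi s)). apply vnorm_sub. }
  pose proof (vnorm_le_sub n (psi s) (x t)) as t3. rewrite vnorm_sub_sym in t3.
  set (q := vnorm n (vsub (psi s) (alpha p))) in *.
  set (ee := vnorm n (vsub (x t) (psi s))) in *.
  assert (q * (1 + sigma) <= sigma * vnorm n (alpha p)) as h2.
  { apply Rmult_le_compat_r with (r := 1 + sigma) in hd; [|lra].
    now replace (sigma / (1 + sigma) * vnorm n (alpha p) * (1 + sigma))
      with (sigma * vnorm n (alpha p)) in hd by (field; lra). }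
  assert (q <= sigma * vnorm n (psi s)) by nra.
  assert (sigma * vnorm n (psi s) <= sigma * (vnorm n (x t) + ee))
    by (apply Rmult_le_compat_l; lra).
  assert (sigma * ee <= sigma * (cE * W)) by (apply Rmult_le_compat_l; lra).
  lra.
Qed.

Variable pP : R.
Hypothesis pP0 : 0 <= pP.
Hypothesis hpP : forall v, vnorm n (mv n P v) <= pP * vnorm n v.
(** The coefficient of W |x| in the bound on V': the input error contributes gamma2 (1 + sigma) cE,
    the disturbance 2 pP. [C1] is what [absorb_linear] makes of it. *)
Let c1 := gamma2 * (1 + sigma) * cE + 2 * pP.
Let C1 := c1 ^ 2 / (2 * (gamma1 - sigma * gamma2)).

Lemma V_right_slope t a l : z <= t < z' -> veq m (u t) (mv n K a) ->
  - gamma1 * vnorm n (x t) ^ 2 + gamma2 * vnorm n (x t) * vnorm n (vsub a (x t))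
    + 2 * W * (pP * vnorm n (x t)) < l ->
  right_slope_le (fun s => V (x s)) t l.
Proof.
  intros ht hu hl.
  apply (qform_right_slope n P x t _ W l (proj1 P_pos_def) (Rlt_le _ _ W0)
           (x_right_deriv t a ht hu)).
  eapply Rle_lt_trans; [|apply hl].
  pose proof (V_derivative_bound (x t) a). specialize (hpP (x t)). nra.
Qed.

Lemma C1_nonneg : 0 <= C1.
Proof. unfold C1. apply Rdiv_le_0_compat; [apply pow2_ge_0|lra]. Qed.

(** Completing the square spends half of the dissipation g on the disturbance; the other half
    explains the 2 in the denominator of [w1]. *)
Lemma absorb_linear g X c : 0 < g ->
  - g * X ^ 2 + c * W * X <= - (g / 2) * X ^ 2 + c ^ 2 / (2 * g) * W ^ 2.
Proof.
  intros g0. assert (0 <= (g * X - c * W) ^ 2 / (2 * g)) as h2.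
  { apply Rdiv_le_0_compat; [apply pow2_ge_0|lra]. }
  replace ((g * X - c * W) ^ 2 / (2 * g))
    with (g / 2 * X ^ 2 - c * W * X + c ^ 2 / (2 * g) * W ^ 2) in h2 by (field; lra). lra.
Qed.

Lemma V_decay t : z <= t <= z + H -> t <= z' ->
  V (x t) <= exp (- w1 * (t - z)) * V (x z) + (C1 + 1) * W ^ 2 * (t - z).
Proof.
  intros ht tz'. pose proof C1_nonneg. assert (0 < W ^ 2) by nra.
  apply (decay_comparison (fun s => V (x s)) z t w1 (C1 * W ^ 2) ((C1 + 1) * W ^ 2)); try lra.
  - left. apply w1_pos.
  - nra.
  - now apply cont_qform.
  - intros r hr l hl. destruct (sampling_index (r - z) delta ltac:(lra) delta0) as [p hp].
    assert (p < h)%nat as ph.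
    { apply INR_lt. apply Rmult_lt_reg_r with delta; [easy|]. fold H. lra. }
    assert (veq m (u r) (mv n K (alpha p))) as hu.
    { replace p with (Nat.min p (h - 1)) by lia. apply law; lra. }
    apply (V_right_slope r (alpha p)); [lra|easy|].
    eapply Rle_lt_trans; [|apply hl].
    pose proof (input_error p r ph ltac:(lra) ltac:(lra)) as ie.
    set (X := vnorm n (x r)) in *. assert (0 <= X) by apply vnorm_pos.
    pose proof gamma2_nonneg.
    pose proof (absorb_linear (gamma1 - sigma * gamma2) X c1 margin) as ab. fold C1 in ab.
    assert (gamma2 * X * vnorm n (vsub (alpha p) (x r)) <=
            gamma2 * X * (sigma * X + (1 + sigma) * (cE * W))) as h2
      by (apply Rmult_le_compat_l; [nra|easy]).
    assert (w1 * V (x r) <= (gamma1 - sigma * gamma2) / 2 * X ^ 2) as h3.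
    { unfold X. rewrite vnorm_sqr. pose proof (V_upper (x r)) as vu.
      apply Rmult_le_compat_l with (r := w1) in vu; [|left; apply w1_pos].
      replace (w1 * (alpha2 * dot n (x r) (x r)))
        with ((gamma1 - sigma * gamma2) / 2 * dot n (x r) (x r)) in vu; [easy|].
      unfold w1. pose proof alpha2_pos. field. lra. }
    unfold c1 in ab. nra.
Qed.

(* The held input differs from x by at most |x| + (1 + sigma) |x(z + H)| plus noise, so V grows
   at rate at most w2 wherever it exceeds V(x(z + H)), as it does on the barrier. *)
Lemma V_growth t : z + H <= t <= z' ->
  V (x t) <= exp (w2 * (t - (z + H))) * (V (x (z + H)) + (C1 + 1) * W ^ 2 * (t - (z + H))).
Proof.
  intros ht. pose proof C1_nonneg. assert (0 < W ^ 2) by nra. pose proof H_pos.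
  pose proof w2_nonneg. set (zh := z + H) in *.
  apply (growth_comparison (fun s => V (x s)) zh zh t w2 (C1 * W ^ 2) ((C1 + 1) * W ^ 2)
           (V (x zh))); try lra; try (unfold zh; lra).
  - nra.
  - now apply cont_qform.
  - rewrite Rminus_diag, !Rmult_0_r, exp_0. lra.
  - intros r hr e l hl. destruct (sampling_index (r - z) delta ltac:(unfold zh in hr; lra) delta0) as [p hp].
    assert (h <= p)%nat as ph.
    { apply le_S_n. apply INR_lt. apply Rmult_lt_reg_r with delta; [easy|].
      fold H. unfold zh in hr. lra. }
    set (a := alpha (h - 1)).
    assert (veq m (u r) (mv n K a)) as hu.
    { unfold a. replace (h - 1)%nat with (Nat.min p (h - 1)) by lia.
      apply law; unfold zh in hr; lra. }
    apply (V_right_slope r a); [unfold zh in hr; lra|easy|].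
    eapply Rle_lt_trans; [|apply hl].
    (* The held input is the last packet entry, and zh is the closed end of its own sampling step,
       the last time at which prediction and state are compared. *)
    assert (vnorm n (vsub a (x zh)) <= sigma * vnorm n (x zh) + (1 + sigma) * (cE * W)) as ie.
    { unfold a. apply input_error; [lia| |lra].
      replace (S (h - 1)) with h by lia. fold H. unfold zh.
      assert (INR (h - 1) * delta <= H); [|lra].
      unfold H. apply Rmult_le_compat_r; [lra|]. apply le_INR. lia. }
    assert (vnorm n (vsub a (x r)) <=
      vnorm n (x r) + (1 + sigma) * vnorm n (x zh) + (1 + sigma) * (cE * W)) as ie2.
    { pose proof (vnorm_sub n a (x r)). pose proof (vnorm_le_sub n a (x zh)). lra. }
    set (X := vnorm n (x r)) in *. assert (0 <= X) by apply vnorm_pos.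
    set (Y := vnorm n (x zh)) in *. assert (0 <= Y) by apply vnorm_pos.
    pose proof gamma2_nonneg as g20.
    pose proof (absorb_linear (gamma1 - sigma * gamma2) X c1 margin) as ab. fold C1 in ab.
    assert (gamma2 * X * vnorm n (vsub a (x r)) <=
            gamma2 * X * (X + (1 + sigma) * Y + (1 + sigma) * (cE * W))) as h2
      by (apply Rmult_le_compat_l; [nra|easy]).
    assert (V (x zh) <= V (x r)) as vle.
    { rewrite e. pose proof (V_nonneg (x zh)).
      assert (1 <= exp (w2 * (r - zh))) by (apply exp_ge_1; apply Rmult_le_pos; lra).
      assert (0 <= (C1 + 1) * W ^ 2 * (r - zh)) by (apply Rmult_le_pos; nra). nra. }
    (* Both X^2 and X Y are at most V / alpha1 here, whence 1 + (1 + sigma) = 2 + sigma in [w2]. *)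
    assert (gamma2 * X * (X + (1 + sigma) * Y) <= w2 * V (x r)) as h3.
    { pose proof alpha1_pos as a10.
      assert (alpha1 * X ^ 2 <= V (x r)) as x2 by (unfold X; rewrite vnorm_sqr; apply V_lower).
      assert (alpha1 * Y ^ 2 <= V (x r)) as y2.
      { eapply Rle_trans; [|apply vle]. unfold Y. rewrite vnorm_sqr. apply V_lower. }
      assert (alpha1 * (X * Y) <= V (x r)) as xy.
      { pose proof (pow2_ge_0 (X - Y)). nra. }
      apply Rmult_le_reg_l with alpha1; [easy|].
      replace (alpha1 * (w2 * V (x r))) with (gamma2 * ((2 + sigma) * V (x r)))
        by (unfold w2; field; lra).
      replace (alpha1 * (gamma2 * X * (X + (1 + sigma) * Y)))
        with (gamma2 * (alpha1 * X ^ 2 + (1 + sigma) * (alpha1 * (X * Y)))) by ring.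
      apply Rmult_le_compat_l; [easy|]. nra. }
    (* Here - gamma1 X^2 only absorbs the terms linear in W, so the growth rate stays [w2]. *)
    assert (0 <= sigma * gamma2 * X ^ 2) by (repeat apply Rmult_le_pos; try lra; apply pow2_ge_0).
    assert (0 <= (gamma1 - sigma * gamma2) / 2 * X ^ 2)
      by (apply Rmult_le_pos; [lra|apply pow2_ge_0]).
    unfold c1 in ab. nra.
Qed.

(** No contraction is sought here: the bound covers all times of the interval and transfers
    estimates at successes to the times in between. *)
Lemma V_between t L : z <= t <= z' -> z' - z <= L ->
  V (x t) <= exp (w2 * L) * V (x z) + exp (w2 * L) * ((C1 + 1) * (H + L)) * W ^ 2.
Proof.
  intros ht hL. pose proof C1_nonneg. assert (0 < W ^ 2) by nra. pose proof H_pos.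
  pose proof w2_nonneg as w20. pose proof w1_pos as w10. pose proof (V_nonneg (x z)) as vz.
  assert (1 <= exp (w2 * L)) as eL by (apply exp_ge_1; apply Rmult_le_pos; lra).
  set (k := (C1 + 1) * W ^ 2). assert (0 < k) by (unfold k; nra).
  replace (exp (w2 * L) * ((C1 + 1) * (H + L)) * W ^ 2) with (exp (w2 * L) * (k * (H + L)))
    by (unfold k; ring).
  assert (forall r, z <= r <= z + H -> r <= z' -> V (x r) <= V (x z) + k * H) as dec.
  { intros r hr hr'. eapply Rle_trans; [now apply V_decay|]. fold k.
    assert (exp (- w1 * (r - z)) <= 1) by (rewrite <- exp_0; apply exp_le_compat; nra).
    assert (k * (r - z) <= k * H) by (apply Rmult_le_compat_l; lra). nra. }
  assert (0 <= k * H) by nra. assert (0 <= k * L) by nra.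
  destruct (Rle_lt_dec t (z + H)) as [le|gt].
  - specialize (dec t ltac:(lra) ltac:(lra)). nra.
  - specialize (dec (z + H) ltac:(lra) ltac:(lra)).
    pose proof (V_growth t ltac:(lra)) as g. fold k in g.
    assert (exp (w2 * (t - (z + H))) <= exp (w2 * L)) as el
      by (apply exp_le_compat; apply Rmult_le_compat_l; lra).
    eapply Rle_trans; [apply g|].
    replace (exp (w2 * L) * V (x z) + exp (w2 * L) * (k * (H + L)))
      with (exp (w2 * L) * (V (x z) + k * (H + L))) by ring.
    assert (k * (t - (z + H)) <= k * L) by (apply Rmult_le_compat_l; lra).
    assert (0 <= k * (t - (z + H))) by (apply Rmult_le_pos; lra).
    pose proof (V_nonneg (x (z + H))).
    apply Rmult_le_compat; [left; apply exp_pos|lra|easy|lra].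
Qed.

(** The first factor of the maximum covers a gap that ends within the buffer time, which still lasts
    at least Delta; the second covers decay for H followed by growth for at most L - H. *)
Lemma V_contraction L : z + Delta <= z' <= z + L ->
  0 <= Delta ->
  V (x z') <= Rmax (exp (- w1 * Delta)) (exp (w2 * (L - H) - w1 * H)) * V (x z)
    + exp (w2 * L) * ((C1 + 1) * (H + L)) * W ^ 2.
Proof.
  intros hz D0. pose proof C1_nonneg. assert (0 < W ^ 2) by nra. pose proof H_pos.
  pose proof w2_nonneg as w20. pose proof w1_pos as w10. pose proof (V_nonneg (x z)) as vz.
  assert (1 <= exp (w2 * L)) as eL by (apply exp_ge_1; apply Rmult_le_pos; lra).
  set (k := (C1 + 1) * W ^ 2). assert (0 < k) by (unfold k; nra).
  replace (exp (w2 * L) * ((C1 + 1) * (H + L)) * W ^ 2) with (exp (w2 * L) * (k * (H + L)))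
    by (unfold k; ring).
  assert (0 <= k * H) by nra. assert (0 <= k * L) by nra.
  destruct (Rle_lt_dec z' (z + H)) as [le|gt].
  - eapply Rle_trans; [apply V_decay; lra|]. fold k.
    assert (exp (- w1 * (z' - z)) <= Rmax (exp (- w1 * Delta)) (exp (w2 * (L - H) - w1 * H))) as e1.
    { eapply Rle_trans; [|apply Rmax_l]. apply exp_le_compat. nra. }
    assert (k * (z' - z) <= k * H) by (apply Rmult_le_compat_l; lra).
    apply Rplus_le_compat; [now apply Rmult_le_compat_r|nra].
  - pose proof (V_decay (z + H) ltac:(lra) ltac:(lra)) as d. fold k in d.
    replace (z + H - z) with H in d by ring.
    pose proof (V_growth z' ltac:(lra)) as g. fold k in g.
    set (E := exp (w2 * (z' - (z + H)))) in *.
    assert (0 < E) as E0 by apply exp_pos.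
    assert (E <= exp (w2 * L)) as el
      by (apply exp_le_compat; apply Rmult_le_compat_l; lra).
    assert (E * exp (- w1 * H) <= Rmax (exp (- w1 * Delta)) (exp (w2 * (L - H) - w1 * H))) as e1.
    { eapply Rle_trans; [|apply Rmax_r]. unfold E. rewrite <- exp_plus. apply exp_le_compat.
      assert (w2 * (z' - (z + H)) <= w2 * (L - H)) by (apply Rmult_le_compat_l; lra). lra. }
    assert (k * (z' - (z + H)) <= k * L) by (apply Rmult_le_compat_l; lra).
    apply Rle_trans with (E * (exp (- w1 * H) * V (x z) + k * (H + L))).
    { eapply Rle_trans; [apply g|]. apply Rmult_le_compat_l; lra. }
    rewrite Rmult_plus_distr_l, <- Rmult_assoc. apply Rplus_le_compat.
    + now apply Rmult_le_compat_r.
    + apply Rmult_le_compat_r; nra.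
Qed.

(** An input is computed from a prediction close to the state at the start s of its sampling step,
    so bounds on x over the interval carry over to u. *)
Lemma input_between t kK : z <= t < z' -> 0 <= kK ->
  (forall v, vnorm m (mv n K v) <= kK * vnorm n v) ->
  exists s, z <= s <= z' /\ vnorm m (u t) <= kK * (vnorm n (x s) + cE * W).
Proof.
  intros ht kK0 hK. destruct (sampling_index (t - z) delta ltac:(lra) delta0) as [p hp].
  set (q := Nat.min p (h - 1)).
  assert (0 <= INR q * delta) by (apply Rmult_le_pos; [apply pos_INR|lra]).
  assert (INR q * delta <= INR p * delta).
  { apply Rmult_le_compat_r; [lra|]. apply le_INR. unfold q; lia. }
  assert (INR q * delta <= INR (S q) * delta) by (rewrite S_INR; lra).
  exists (z + INR q * delta). split; [lra|].
  destruct (model_solution_exists (alpha q)) as [psi [hpsi _]].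
  pose proof (prediction_error q psi (z + INR q * delta) ltac:(unfold q; lia) hpsi
    ltac:(lra) ltac:(lra)) as pe.
  rewrite Rminus_diag in pe.
  rewrite (vnorm_ext m _ _ (law t p ht hp)). fold q.
  eapply Rle_trans; [apply hK|]. apply Rmult_le_compat_l; [easy|].
  rewrite (vnorm_ext n (alpha q) (psi 0)).
  2: { intros i hi. destruct hpsi as [e _]. now rewrite e. }
  pose proof (vnorm_le_sub n (psi 0) (x (z + INR q * delta))) as h2.
  rewrite vnorm_sub_sym in h2. lra.
Qed.
End ClosedLoop.

(** * Stability over the sequence of successful transmissions *)

Lemma geometric_recursion (v : nat -> R) rho c k0 : 0 <= rho < 1 -> 0 <= c ->
  (forall k, (k0 <= k)%nat -> v (S k) <= rho * v k + c) ->
  forall j, v (k0 + j)%nat <= rho ^ j * v k0 + c / (1 - rho).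
Proof.
  intros hr c0 st. assert (0 <= c / (1 - rho)) by (apply Rdiv_le_0_compat; lra).
  assert (c = c / (1 - rho) - rho * (c / (1 - rho))) as e by (field; lra).
  induction j as [|j IH].
  - rewrite Nat.add_0_r. simpl. lra.
  - rewrite Nat.add_succ_r. specialize (st (k0 + j)%nat ltac:(lia)). simpl.
    assert (rho * v (k0 + j)%nat <= rho * (rho ^ j * v k0 + c / (1 - rho)))
      by (apply Rmult_le_compat_l; lra).
    lra.
Qed.

Section Sequence.
Variables (zs : nat -> R) (d : R).
Hypothesis d0 : 0 < d.
Hypothesis gap : forall k, zs k + d <= zs (S k).

Lemma gap_sum k j : zs k + INR j * d <= zs (k + j)%nat.
Proof.
  induction j as [|j IH]; [simpl; rewrite Nat.add_0_r; lra|].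
  rewrite Nat.add_succ_r, S_INR. specialize (gap (k + j)). lra.
Qed.

Lemma sequence_cover k t : zs k <= t -> exists j, (k <= j)%nat /\ zs j <= t < zs (S j).
Proof.
  intros ht. destruct (INR_archimed d (t - zs k + 1) d0) as [N hN].
  assert (t < zs (k + N)%nat) as lt by (pose proof (gap_sum k N); lra).
  clear hN. induction N as [|N IH]; [rewrite Nat.add_0_r in lt; lra|].
  destruct (Rlt_le_dec t (zs (k + N)%nat)) as [l|l]; [now apply IH|].
  exists (k + N)%nat. split; [lia|]. rewrite Nat.add_succ_r in lt. lra.
Qed.

Lemma sequence_unbounded T0 : exists k, T0 <= zs k.
Proof.
  destruct (INR_archimed d (T0 - zs 0%nat) d0) as [N hN].
  exists N. pose proof (gap_sum 0 N) as g. simpl in g. lra.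
Qed.

Variables (v e : R -> R) (rho C : R) (level : R -> R -> Prop).
Hypothesis hrho : 0 <= rho < 1.
Hypothesis C0 : 0 <= C.
Hypothesis v0 : forall t, 0 <= v t.
Hypothesis level_mono : forall W s t, level W s -> s <= t -> level W t.
Hypothesis step : forall k W, 0 < W -> level W (zs k) ->
  v (zs (S k)) <= rho * v (zs k) + C * W ^ 2 /\
  forall t, zs k <= t < zs (S k) -> e t <= C * (v (zs k) + W ^ 2).

Lemma zs_mono k j : (k <= j)%nat -> zs k <= zs j.
Proof.
  intros le. replace j with (k + (j - k))%nat by lia. pose proof (gap_sum k (j - k)).
  assert (0 <= INR (j - k) * d) by (apply Rmult_le_pos; [apply pos_INR|lra]). lra.
Qed.

(** [level W s] abstracts that the signals stay below W from time s on; it persists, so the one-step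
    estimate iterates with a fixed W. *)
Lemma level_recursion W k0 : 0 < W -> level W (zs k0) ->
  forall j, v (zs (k0 + j)%nat) <= rho ^ j * v (zs k0) + C * W ^ 2 / (1 - rho).
Proof.
  intros W0 hl. apply (geometric_recursion (fun k => v (zs k))); [easy| |].
  - apply Rmult_le_pos; [easy|apply pow2_ge_0].
  - intros k hk. apply (step k W W0). apply level_mono with (zs k0); [easy|]. now apply zs_mono.
Qed.

Lemma switched_bounded W : 0 < W -> level W (zs 0%nat) ->
  exists c, forall t, zs 0%nat <= t -> e t <= c.
Proof.
  intros W0 hl. set (R0 := v (zs 0%nat) + C * W ^ 2 / (1 - rho)).
  exists (C * (R0 + W ^ 2)). intros t ht.
  destruct (sequence_cover 0 t ht) as [k [_ hk]].
  destruct (step k W W0) as [_ h]; [apply level_mono with (zs 0%nat); [easy|apply zs_mono; lia]|].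
  eapply Rle_trans; [now apply h|]. apply Rmult_le_compat_l; [easy|].
  pose proof (level_recursion W 0 W0 hl k) as r. simpl in r.
  assert (rho ^ k <= 1) by (rewrite <- (pow1 k); apply pow_incr; lra).
  specialize (v0 (zs 0%nat)). unfold R0. nra.
Qed.

Lemma switched_convergent : (forall W, 0 < W -> exists s, level W s) ->
  forall eps, 0 < eps -> exists T0, zs 0%nat <= T0 /\ forall t, T0 <= t -> e t <= eps.
Proof.
  intros small eps e0.
  (* S0 bounds the gain from W^2 to the eventual size of e, and W is tuned to make that part eps /
     2; N later brings the transient below the other half. The added ones keep divisors positive. *)
  set (S0 := (C + 1) * (C / (1 - rho) + 1)).
  assert (0 <= C / (1 - rho)) as q0 by (apply Rdiv_le_0_compat; lra).
  assert (0 < S0) by (unfold S0; apply Rmult_lt_0_compat; lra).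
  set (W := sqrt (eps / (2 * S0))).
  assert (0 < W) as W0 by (apply sqrt_lt_R0; apply Rdiv_lt_0_compat; lra).
  assert (W ^ 2 = eps / (2 * S0)) as W2.
  { unfold W. apply pow2_sqrt. left. apply Rdiv_lt_0_compat; lra. }
  assert (S0 * W ^ 2 = eps / 2) as W2' by (rewrite W2; field; lra).
  destruct (small W W0) as [s hs]. destruct (sequence_unbounded s) as [k0 hk0].
  assert (level W (zs k0)) as hl by (apply level_mono with s; easy).
  set (v1 := v (zs k0)). assert (0 <= v1) by apply v0.
  destruct (pow_lt_1_zero rho ltac:(rewrite Rabs_right; lra)
    (eps / (2 * ((C + 1) * (v1 + 1))))) as [N hN].
  { apply Rdiv_lt_0_compat; [easy|]. nra. }
  exists (zs (k0 + N)%nat). split; [apply zs_mono; lia|]. intros t ht.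
  destruct (sequence_cover (k0 + N) t ht) as [k [le hk]].
  destruct (step k W W0) as [_ h]; [apply level_mono with (zs k0); [easy|apply zs_mono; lia]|].
  eapply Rle_trans; [now apply h|].
  pose proof (level_recursion W k0 W0 hl (k - k0)) as r.
  replace (k0 + (k - k0))%nat with k in r by lia. fold v1 in r.
  specialize (hN (k - k0)%nat ltac:(lia)).
  assert (0 <= rho ^ (k - k0)) as rp by (apply pow_le; lra).
  rewrite Rabs_right in hN by lra. set (rk := rho ^ (k - k0)) in *.
  assert (rk * ((C + 1) * (v1 + 1)) <= eps / 2) as h2.
  { apply Rmult_lt_compat_r with (r := (C + 1) * (v1 + 1)) in hN; [|nra].
    replace (eps / (2 * ((C + 1) * (v1 + 1))) * ((C + 1) * (v1 + 1))) with (eps / 2) in hN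
      by (field; split; lra). lra. }
  assert (C * v (zs k) <= C * (rk * v1 + C * W ^ 2 / (1 - rho))) as h3
    by (apply Rmult_le_compat_l; easy).
  assert (C * (rk * v1) <= eps / 2) as h4.
  { eapply Rle_trans; [|apply h2]. assert (0 <= rk * v1) by nra. nra. }
  assert (C * (C * W ^ 2 / (1 - rho)) + C * W ^ 2 <= S0 * W ^ 2) as h5.
  { replace (C * (C * W ^ 2 / (1 - rho)) + C * W ^ 2)
      with (C * (C / (1 - rho) + 1) * W ^ 2) by (field; lra).
    apply Rmult_le_compat_r; [apply pow2_ge_0|]. unfold S0. nra. }
  lra.
Qed.
End Sequence.

(** * Enumeration of the successful transmissions *)

Section SuccessTimes.
Variables (dom : nat -> Prop) (hs taus : nat -> R) (Delta L : R).
Hypothesis Delta0 : 0 < Delta.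
Hypothesis within : forall k, exists j, (k <= j)%nat /\
  success dom hs taus Delta (INR j * Delta) /\ INR j * Delta <= INR k * Delta + L.

Definition first_success_from (k j : nat) : Prop :=
  (k <= j)%nat /\ success dom hs taus Delta (INR j * Delta) /\
  (forall i, (k <= i)%nat -> success dom hs taus Delta (INR i * Delta) -> (j <= i)%nat) /\
  INR j * Delta <= INR k * Delta + L.

Lemma first_success_exists k : exists j, first_success_from k j.
Proof.
  destruct (within k) as [j0 [le0 [s0 b0]]].
  destruct (dec_inh_nat_subset_has_unique_least_element
    (fun j => (k <= j)%nat /\ success dom hs taus Delta (INR j * Delta)))
    as [j [[[le s] least] _]].
  - intros i. apply classic.
  - exists j0. now split.
  - exists j. split; [easy|]. split; [easy|]. split.
    + intros i hi si. apply least. now split.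
    + apply Rle_trans with (INR j0 * Delta); [|easy].
      apply Rmult_le_compat_r; [lra|]. apply le_INR. apply least. now split.
Qed.

Definition first_success (k : nat) : nat := epsilon (inhabits 0%nat) (first_success_from k).

Lemma first_success_spec k : first_success_from k (first_success k).
Proof. exact (epsilon_spec _ _ (first_success_exists k)). Qed.

Fixpoint success_index (i : nat) : nat :=
  match i with
  | O => first_success 0
  | S i' => first_success (S (success_index i'))
  end.

Definition success_time (i : nat) : R := INR (success_index i) * Delta.

Lemma success_time_success i : success dom hs taus Delta (success_time i).
Proof. destruct i; apply first_success_spec. Qed.

(** L bounds the wait counted from an attempt. The search for the next success restarts one attempt
    after the current one, which adds Delta. *)
Lemma success_time_gap i : success_time i + Delta <= success_time (S i) <= success_time i + (L + Delta).
Proof.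
  unfold success_time. simpl. destruct (first_success_spec (S (success_index i))) as [le [_ [_ b]]].
  apply le_INR in le. rewrite S_INR in *. nra.
Qed.

Lemma success_index_of z : success dom hs taus Delta z ->
  exists i, z = INR i * Delta /\ success dom hs taus Delta (INR i * Delta).
Proof. intros [i [-> nd]]. exists i. split; [easy|]. exists i. now split. Qed.

Lemma success_time_first z : success dom hs taus Delta z -> success_time 0 <= z.
Proof.
  intros sz. destruct (success_index_of z sz) as [i [-> si]].
  destruct (first_success_spec 0) as [_ [_ [least _]]].
  apply Rmult_le_compat_r; [lra|]. apply le_INR. apply least; [lia|easy].
Qed.

(** The control law refers to the latest success up to t, not to an enumeration; minimality of the
    next success identifies the two. *)
Lemma success_time_last k z t : success_time k <= t < success_time (S k) ->
  success dom hs taus Delta z -> z <= t -> z <= success_time k.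
Proof.
  intros ht sz zt. destruct (success_index_of z sz) as [i [-> si]].
  apply Rmult_le_compat_r; [lra|]. apply le_INR.
  destruct (Nat.le_gt_cases i (success_index k)) as [|gt]; [easy|]. exfalso.
  destruct (first_success_spec (S (success_index k))) as [_ [_ [least _]]].
  specialize (least i gt si). apply le_INR in least.
  unfold success_time in ht. simpl in ht. nra.
Qed.
End SuccessTimes.

Lemma cont_of_primitive k (x D : R -> vec) c :
  (forall s t, 0 <= s -> 0 <= t -> vnorm k (vsub (D t) (D s)) <= c * Rabs (t - s)) ->
  cont_nonneg k (fun s => vsub (x s) (D s)) -> cont_nonneg k x.
Proof.
  intros lip cx t t0 eps e0.
  destruct (cx t t0 (eps / 2) ltac:(lra)) as [d1 [d10 h1]].
  set (d2 := eps / (2 * (Rabs c + 1))). pose proof (Rabs_pos c).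
  assert (0 < d2) by (apply Rdiv_lt_0_compat; lra).
  exists (Rmin d1 d2). split; [now apply Rmin_glb_lt|]. intros s s0 hs.
  specialize (h1 s s0 (Rlt_le_trans _ _ _ hs (Rmin_l _ _))).
  assert (Rabs (s - t) < d2) as h2 by (eapply Rlt_le_trans; [apply hs|apply Rmin_r]).
  rewrite (vnorm_ext k _ (vadd (vsub (vsub (x s) (D s)) (vsub (x t) (D t))) (vsub (D s) (D t))))
    by (intros i _; unfold vadd, vsub; ring).
  eapply Rle_lt_trans; [apply vnorm_add|].
  specialize (lip t s t0 s0). pose proof (Rabs_pos (s - t)). pose proof (Rle_abs c).
  assert (d2 * (Rabs c + 1) = eps / 2) by (unfold d2; field; lra). nra.
Qed.

(** Before the first success the loop is open and possibly unstable, but only for a bounded time, so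
    an exponential bound suffices. *)
Lemma zero_input_bounded n m A B muA (x u D : R -> vec) c t1 :
  is_max_eigenvalue n (mscale (1 / 2) (madd A (mtr A))) muA ->
  cont_nonneg n x ->
  (forall t, 0 <= t ->
     rderiv n (fun s => vsub (x s) (D s)) t (vadd (mv n A (x t)) (mv m B (u t)))) ->
  (forall s t, 0 <= s -> 0 <= t -> vnorm n (vsub (D t) (D s)) <= c * Rabs (t - s)) ->
  0 <= c -> (forall t, 0 <= t < t1 -> veq m (u t) vzero) ->
  exists b, forall t, 0 <= t <= t1 -> dot n (x t) (x t) <= b.
Proof.
  intros hmu xcont xdyn lip c0 hu. set (lam := 2 * Rabs muA + 1).
  assert (0 <= lam) as lam0 by (unfold lam; pose proof (Rabs_pos muA); lra).
  set (X0 := dot n (x 0) (x 0)). assert (0 <= X0) by apply dot_self_pos.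
  exists (exp (lam * t1) * (X0 + (c ^ 2 + 1) * t1)). intros t ht.
  apply Rle_trans with (exp (lam * (t - 0)) * (X0 + (c ^ 2 + 1) * (t - 0))).
  - apply (growth_comparison (fun s => dot n (x s) (x s)) 0 0 t1 lam (c ^ 2) (c ^ 2 + 1) X0);
      try lra.
    + pose proof (pow2_ge_0 c). lra.
    + now apply cont_norm_sqr.
    + rewrite Rminus_diag, !Rmult_0_r, exp_0. unfold X0. lra.
    + intros r hr _ l hl.
      apply (norm_sqr_right_slope n x r (mv n A (x r)) c l c0).
      * apply right_deriv_within_ext_deriv with (vadd (mv n A (x r)) (mv m B (u r))).
        { intros i _. unfold vadd. rewrite (mv_ext m B (u r) vzero) by now apply hu.
          unfold mv at 2. rewrite (fsum_ext m _ (fun _ => 0)), fsum_zero; [ring|].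
          intros; unfold vzero; ring. }
        apply (perturbed_right_deriv n x D r _ c 1); [lra|apply xdyn; lra|].
        intros s hs. specialize (lip r (r + s) ltac:(lra) ltac:(lra)).
        replace (r + s - r) with s in lip by ring. now rewrite Rabs_right in lip by lra.
      * pose proof (dot_mv_le_mu n A muA hmu (x r)) as h2.
        pose proof (Rle_abs muA) as h3. pose proof (dot_self_pos n (x r)) as h4.
        pose proof (vnorm_sqr n (x r)) as h5.
        assert (muA * dot n (x r) (x r) <= Rabs muA * dot n (x r) (x r))
          by (apply Rmult_le_compat_r; easy).
        assert (2 * c * vnorm n (x r) <= c ^ 2 + vnorm n (x r) ^ 2)
          by (pose proof (pow2_ge_0 (c - vnorm n (x r))); nra).
        unfold lam in hl. nra.
  - rewrite Rminus_0_r. apply Rmult_le_compat.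
    + left. apply exp_pos.
    + pose proof (pow2_ge_0 c). nra.
    + apply exp_le_compat. apply Rmult_le_compat_l; lra.
    + pose proof (pow2_ge_0 c). nra.
Qed.

Theorem theorem2
  (n m : nat) (A B K M P : mat)
  (alpha1 alpha2 gamma1 gamma2 muA normPhi sigma : R)
  (Delta delta : R) (b h : nat)
  (dom : nat -> Prop) (hs taus : nat -> R) (eta tauD kappa T : R) :
  (* process and controller *)
  stabilizable n m A B ->
  hurwitz n (madd A (mm m B K)) ->
  pos_def n M ->
  meq n n (madd (madd (mm n (mtr (madd A (mm m B K))) P)
                      (mm n P (madd A (mm m B K)))) M) (fun _ _ => 0) ->
  is_min_eigenvalue n P alpha1 ->
  is_max_eigenvalue n P alpha2 ->
  is_min_eigenvalue n M gamma1 ->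
  is_opnorm n n (mscale 2 (mm m (mm n P B) K)) gamma2 ->
  is_max_eigenvalue n (mscale (1 / 2) (madd A (mtr A))) muA ->
  is_opnorm n n (madd A (mm m B K)) normPhi ->
  0 < sigma -> 0 < gamma1 - sigma * gamma2 ->
  0 < Delta -> (1 <= b)%nat -> delta = Delta / INR b -> (1 <= h)%nat ->
  (* sampling condition *)
  (0 < muA -> delta <= 1 / muA * ln (sigma / (1 + sigma) * muA / Rmax normPhi 1 + 1)) ->
  (muA <= 0 -> delta <= sigma / (1 + sigma) * (1 / Rmax normPhi 1)) ->
  (* DoS signal satisfying Assumptions 1 and 2 *)
  dos_signal dom hs taus ->
  0 <= eta -> 0 < tauD -> dos_frequency dom hs eta tauD ->
  0 <= kappa -> 1 < T -> dos_duration dom hs taus kappa T ->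
  1 / T + Delta / tauD < 1 ->
  (* prediction horizon condition *)
  (let omega1 := (gamma1 - sigma * gamma2) / (2 * alpha2) in
   let omega2 := gamma2 * (2 + sigma) / alpha1 in
   let Q := (kappa + eta * Delta) * / (1 - 1 / T - Delta / tauD) in
   INR h * delta > omega2 / (omega1 + omega2) * (Q + Delta)) ->
  (* stability of the closed loop *)
  forall (x0 : vec) (D : R -> vec) (nz : R -> vec) (x : R -> vec) (u : R -> vec),
    primitive_of_bounded n D ->      (* d bounded (D = primitive of d) *)
    bounded_sig n nz ->              (* measurement noise bounded *)
    (* process: x(0) = x0, xdot = A x + B u + d (Caratheodory sense) *)
    veq n (x 0) x0 ->
    cont_nonneg n (fun s => vsub (x s) (D s)) ->
    (forall t, 0 <= t ->
       rderiv n (fun s => vsub (x s) (D s)) t (vadd (mv n A (x t)) (mv m B (u t)))) ->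
    (* packetized buffered control law *)
    (forall t, 0 <= t ->
       ((forall z, success dom hs taus Delta z -> t < z) -> veq m (u t) vzero) /\
       (forall z (p : nat), success dom hs taus Delta z -> z <= t ->
          (forall z', success dom hs taus Delta z' -> z' <= t -> z' <= z) ->
          INR p * delta <= t - z < INR (S p) * delta ->
          veq m (u t) (mv n K (predict n m (Adisc n A delta) (Bdisc n A B delta) K
                                  (vadd (x z) (nz z)) (Nat.min p (h - 1)))))) ->
    (bounded_sig n x /\ bounded_sig m u) /\
    (primitive_of_vanishing n D -> conv_zero n nz -> conv_zero n x /\ conv_zero m u).
Proof.
  intros _ hur Mpd lyap hal1 hal2 hga1 hga2 hmu hPhi sigma0 margin Delta0 b1 hdelta h1
    samp_pos samp_neg sig eta0 tauD0 freq kappa0 T1 dur slow horizon.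
  intros x0 D nz x u [_ [cD lipD]] [cn hn] _ xDcont xdyn law.
  cbv zeta in horizon.
  set (w1 := (gamma1 - sigma * gamma2) / (2 * alpha2)) in *.
  set (w2 := gamma2 * (2 + sigma) / alpha1) in *.
  set (Q := (kappa + eta * Delta) * / (1 - 1 / T - Delta / tauD)) in *.
  set (L := Q + Delta) in *.
  assert (0 < delta) as delta0.
  { rewrite hdelta. apply Rdiv_lt_0_compat; [easy|]. apply lt_0_INR. lia. }
  assert (0 <= Q) as Q0.
  { unfold Q. apply Rmult_le_pos; [nra|]. left. apply Rinv_0_lt_compat. lra. }
  pose proof (w1_pos n m A B K M P alpha1 alpha2 gamma1 gamma2 sigma
    hur Mpd lyap hal1 hal2 margin) as w10. fold w1 in w10.
  pose proof (w2_nonneg n m A B K M P alpha1 gamma2 sigma hur Mpd lyap hal1 hga2 sigma0) as w20.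
  fold w2 in w20.
  pose proof (alpha1_pos n m A B K M P alpha1 hur Mpd lyap hal1) as al10.
  set (H := INR h * delta) in *.
  assert (0 < H) as H0 by (apply Rmult_lt_0_compat; [apply lt_0_INR; lia|easy]).
  destruct (mv_bounded n n P) as [pP [pP0 hpP]].
  destruct (mv_bounded m n K) as [kK [kK0 hkK]].
  pose proof (cont_of_primitive n x D cD lipD xDcont) as xcont.
  pose (zs := success_time dom hs taus Delta Q).
  assert (forall k, exists j, (k <= j)%nat /\ success dom hs taus Delta (INR j * Delta) /\
            INR j * Delta <= INR k * Delta + Q) as within.
  { intros k. now apply (success_within dom hs taus eta tauD kappa T Delta). }
  set (rho := Rmax (exp (- w1 * Delta)) (exp (w2 * (L - H) - w1 * H))).
  assert (0 <= rho < 1) as hrho.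
  { split.
    - left. eapply Rlt_le_trans; [|apply Rmax_l]. apply exp_pos.
    (* Multiplied by w1 + w2, the horizon condition reads w2 L < (w1 + w2) H, so the second exponent
       is negative. *)
    - assert (w2 / (w1 + w2) * L * (w1 + w2) = w2 * L) as e by (field; lra).
      apply Rmax_lub_lt; rewrite <- exp_0; apply exp_increasing; nra. }
  set (lam := 2 * Rabs muA + 1).
  set (cE := exp (lam * H) * (1 + 2 * H)).
  set (C1 := (gamma2 * (1 + sigma) * cE + 2 * pP) ^ 2 / (2 * (gamma1 - sigma * gamma2))).
  assert (0 <= C1) as C10.
  { apply Rdiv_le_0_compat; [apply pow2_ge_0|lra]. }
  set (C2 := exp (w2 * L) * ((C1 + 1) * (H + L))).
  assert (0 <= L) as L0 by (unfold L; lra).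
  assert (0 < exp (w2 * L)) as eL0 by apply exp_pos.
  assert (0 <= C2) as C20.
  { unfold C2. apply Rmult_le_pos; [lra|]. apply Rmult_le_pos; lra. }
  (* G turns bounds on V into bounds on |x|^2; C is one constant for the recursion, the states and
     the inputs. *)
  set (G := (exp (w2 * L) + C2) / alpha1).
  assert (0 <= G) as G0 by (apply Rdiv_le_0_compat; lra).
  set (C := C2 + G + 2 * kK ^ 2 * (G + cE ^ 2)).
  pose proof (pow2_ge_0 kK) as kK2. pose proof (pow2_ge_0 cE) as cE2.
  assert (0 <= 2 * kK ^ 2 * (G + cE ^ 2)) as Cu0 by (apply Rmult_le_pos; lra).
  assert (0 <= C) as C0 by (unfold C; lra).
  pose (V := fun t => qform n P (x t)).
  (* State and input are tracked together, so each abstract result yields both conclusions at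
     once. *)
  pose (e := fun t => vnorm n (x t) ^ 2 + vnorm m (u t) ^ 2).
  pose (level := fun W s => 0 <= s /\ (forall t, s <= t -> vnorm n (nz t) <= W) /\
    forall r t, s <= r -> s <= t -> vnorm n (vsub (D t) (D r)) <= W * Rabs (t - r)).
  assert (forall t, 0 <= V t) as V0.
  { intros t. now apply (V_nonneg n m A B K M P alpha1). }
  assert (forall k W, 0 < W -> level W (zs k) ->
    V (zs (S k)) <= rho * V (zs k) + C * W ^ 2 /\
    forall t, zs k <= t < zs (S k) -> e t <= C * (V (zs k) + W ^ 2)) as step.
  { intros k W W0 [z0 [lnz lD]].
    assert (0 < W ^ 2) as W2 by nra.
    pose proof (success_time_gap dom hs taus Delta Q Delta0 within k) as g. fold zs in g.
    set (z := zs k) in *. set (z' := zs (S k)) in *. fold L in g.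
    pose (a0 := vadd (x z) (nz z)).
    assert (vnorm n (vsub (x z) a0) <= W) as init.
    { rewrite vnorm_sub_sym, (vnorm_ext n _ (nz z)); [apply lnz; lra|].
      intros i _. unfold a0, vsub, vadd. ring. }
    assert (forall s t, z <= s <= z' -> z <= t <= z' ->
      vnorm n (vsub (D t) (D s)) <= W * Rabs (t - s)) as Dl by (intros; apply lD; lra).
    assert (forall t (p : nat), z <= t < z' -> INR p * delta <= t - z < INR (S p) * delta ->
      veq m (u t) (mv n K (predict n m (Adisc n A delta) (Bdisc n A B delta) K a0
                             (Nat.min p (h - 1))))) as law'.
    { intros t p ht hp. apply (proj2 (law t ltac:(lra)) z p); try easy; try lra.
      - now apply success_time_success.
      - intros zz szz lzz. now apply (success_time_last dom hs taus Delta Q Delta0 within k zz t). }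
    assert (forall t, z <= t <= z' ->
      V t <= exp (w2 * L) * V z + exp (w2 * L) * ((C1 + 1) * (H + L)) * W ^ 2) as between.
    { intros t ht.
      apply (V_between n m A B K M P alpha1 alpha2 gamma1 gamma2 muA normPhi sigma delta h) with
        (u := u) (D := D) (a0 := a0) (z' := z'); try easy; lra. }
    fold C2 in between.
    assert (forall t, z <= t <= z' -> vnorm n (x t) ^ 2 <= G * (V z + W ^ 2)) as xb.
    { intros t ht. specialize (between t ht). rewrite vnorm_sqr.
      assert (alpha1 * dot n (x t) (x t) <= V t) as vl
        by exact (V_lower n m A B K M P alpha1 hur Mpd lyap hal1 (x t)).
      unfold G. apply Rmult_le_reg_l with alpha1; [easy|].
      replace (alpha1 * ((exp (w2 * L) + C2) / alpha1 * (V z + W ^ 2)))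
        with ((exp (w2 * L) + C2) * (V z + W ^ 2)) by (field; lra).
      assert (0 <= exp (w2 * L) * W ^ 2) by (apply Rmult_le_pos; lra).
      assert (0 <= C2 * V z) by (apply Rmult_le_pos; [easy|apply V0]). lra. }
    split.
    - eapply Rle_trans.
      + apply (V_contraction n m A B K M P alpha1 alpha2 gamma1 gamma2 muA normPhi sigma
          Delta delta h) with (u := u) (D := D) (a0 := a0) (z := z) (W := W) (pP := pP) (L := L);
          try easy; lra.
      + fold w1 w2 lam H cE C1 C2 rho. apply Rplus_le_compat; [apply Rle_refl|].
        apply Rmult_le_compat_r; [lra|]. unfold C. lra.
    - intros t ht.
      destruct (input_between n m A B K muA delta h hmu delta0 h1 x u D xcont xdyn a0 z z' W
        z0 W0 init Dl law' t kK ht kK0 hkK) as [s [zsz hus]].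
      fold lam H cE in hus. pose proof (xb s zsz) as xs. pose proof (xb t ltac:(lra)) as xt.
      set (Y := V z + W ^ 2) in *. assert (W ^ 2 <= Y) by (unfold Y; specialize (V0 z); lra).
      assert (vnorm m (u t) ^ 2 <= 2 * kK ^ 2 * (G + cE ^ 2) * Y) as ub.
      { set (X := vnorm n (x s)) in *.
        apply Rle_trans with ((kK * (X + cE * W)) ^ 2).
        - apply pow_incr. split; [apply vnorm_pos|easy].
        - assert ((X + cE * W) ^ 2 <= 2 * (G + cE ^ 2) * Y).
          { pose proof (pow2_ge_0 (X - cE * W)).
            assert (cE ^ 2 * W ^ 2 <= cE ^ 2 * Y) by (apply Rmult_le_compat_l; easy). nra. }
          rewrite Rpow_mult_distr.
          replace (2 * kK ^ 2 * (G + cE ^ 2) * Y) with (kK ^ 2 * (2 * (G + cE ^ 2) * Y)) by ring.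
          now apply Rmult_le_compat_l. }
      unfold e, C. assert (0 <= C2 * Y) by (apply Rmult_le_pos; lra). nra. }
  assert (forall W s t, level W s -> s <= t -> level W t) as mono.
  { intros W s t [s0 [l1 l2]] st. split; [lra|]. split; intros; [apply l1|apply l2]; lra. }
  assert (forall k, zs k + Delta <= zs (S k)) as gap by (intros k; now apply success_time_gap).
  assert (0 <= zs 0%nat) as z00.
  { unfold zs, success_time. apply Rmult_le_pos; [apply pos_INR|lra]. }
  split.
  - set (W := Rmax 1 (Rmax cD cn)).
    assert (1 <= W) as W1 by apply Rmax_l.
    assert (cD <= W) as WD by (eapply Rle_trans; [apply Rmax_l|apply Rmax_r]).
    assert (cn <= W) as Wn by (eapply Rle_trans; [apply Rmax_r|apply Rmax_r]).
    assert (forall s t, 0 <= s -> 0 <= t -> vnorm n (vsub (D t) (D s)) <= W * Rabs (t - s)) as lipW.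
    { intros s t s0 t0. eapply Rle_trans; [now apply lipD|].
      apply Rmult_le_compat_r; [apply Rabs_pos|easy]. }
    assert (level W (zs 0%nat)) as lW.
    { split; [easy|]. split.
      - intros t ht. eapply Rle_trans; [apply hn|]; lra.
      - intros r t hr ht. apply lipW; lra. }
    destruct (switched_bounded zs Delta Delta0 gap V e rho C level hrho C0 V0 mono step W
      ltac:(lra) lW) as [c hc].
    assert (forall t, 0 <= t < zs 0%nat -> veq m (u t) vzero) as uz.
    { intros t ht. apply (law t ltac:(lra)). intros zz szz.
      pose proof (success_time_first dom hs taus Delta Q Delta0 within zz szz). unfold zs in ht. lra. }
    destruct (zero_input_bounded n m A B muA x u D W (zs 0%nat) hmu xcont xdyn lipW ltac:(lra) uz)
      as [c' hc'].
    assert (forall t, 0 <= t -> e t <= Rmax c c') as all.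
    { intros t t0. destruct (Rlt_le_dec t (zs 0%nat)) as [lt|le].
      - eapply Rle_trans; [|apply Rmax_r]. unfold e.
        rewrite (vnorm_ext m (u t) vzero) by (apply uz; lra).
        rewrite vnorm_zero, vnorm_sqr. specialize (hc' t ltac:(lra)). lra.
      - eapply Rle_trans; [now apply hc|apply Rmax_l]. }
    set (c2 := Rmax c c') in *.
    (* X^2 <= c2 gives X <= c2 + 1 without square roots. *)
    split; exists (c2 + 1); intros t t0; specialize (all t t0); unfold e in all;
      pose proof (pow2_ge_0 (vnorm n (x t))); pose proof (pow2_ge_0 (vnorm m (u t)));
      pose proof (vnorm_pos n (x t)); pose proof (vnorm_pos m (u t)); nra.
  - intros vD vn.
    assert (forall eps, 0 < eps -> exists T0, forall t, T0 <= t -> e t <= eps ^ 2) as conv.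
    { intros eps e0.
      destruct (switched_convergent zs Delta Delta0 gap V e rho C level hrho C0 V0 mono step)
        with (eps := eps ^ 2) as [T0 [_ hT]]; [|nra|now exists T0].
      intros W W0. destruct (vD W W0) as [s1 hs1]. destruct (vn W W0) as [s2 hs2].
      exists (Rmax 0 (Rmax s1 s2)).
      assert (0 <= Rmax 0 (Rmax s1 s2)) by apply Rmax_l.
      assert (s1 <= Rmax 0 (Rmax s1 s2)) by (eapply Rle_trans; [apply Rmax_l|apply Rmax_r]).
      assert (s2 <= Rmax 0 (Rmax s1 s2)) by (eapply Rle_trans; [apply Rmax_r|apply Rmax_r]).
      split; [easy|]. split; intros; [apply hs2|apply hs1]; lra. }
    split; intros eps e0; destruct (conv eps e0) as [T0 hT]; exists T0; intros t ht;
      specialize (hT t ht); unfold e in hT;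
      pose proof (pow2_ge_0 (vnorm n (x t))); pose proof (pow2_ge_0 (vnorm m (u t)));
      pose proof (vnorm_pos n (x t)); pose proof (vnorm_pos m (u t)); nra.
Qed.
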